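(* Let $\tau:[0,1]\to[0,1]$ be piecewise monotonic, transitive, and not essentially injective, with associated local homeomorphism $\sigma:X\to X$. Let $X_1,\dots,X_n$ be a partition of $X$ into clopen sets cyclically permuted by $\sigma$ (that is, $\sigma(X_i)=X_{i+1\bmod n}$) such that $\sigma^n$ restricted to each $X_i$ is topologically exact. Then $F_\tau=A_1\oplus A_2\oplus\cdots\oplus A_n$, where for each $i$, $A_i\cong C^*(R(X_i,\sigma^n))$ is a simple AF-algebra. For each index $i$, the canonical endomorphism $\Phi$ of $F_\tau$ maps $A_i$ into $A_{i-1\bmod n}$.
   Context: Let $I=[0,1]$. A map $\tau:I\to I$ is piecewise monotonic if there are points $0=a_0<a_1<\dots<a_q=1$ such that each $\tau|_{(a_{i-1},a_i)}$ is continuous and strictly monotonic; the $a_i$ are chosen so that no $(a_{i-1},a_i)$ is contained in a larger open interval on which $\tau$ is continuous and strictly monotonic. $C=\{a_0,\dots,a_q\}$ is the partition associated with $\tau$, and $\tau_i:[a_{i-1},a_i]\to I$ is the continuous extension of $\tau|_{(a_{i-1},a_i)}$. The actual values of $\tau$ at discontinuities are ignored: for $A\subset I$ put $\widehat\tau(A)=\bigcup_i\tau_i(A\cap[a_{i-1},a_i])$ and $\widehat\tau^{-1}(A)=\bigcup_i\{x\in[a_{i-1},a_i]:\tau_i(x)\in A\}$. Associated local homeomorphism: $I_1$ is the smallest subset of $I$ containing $C$ and forward and backward invariant under $\widehat\tau$; $I_0=I\setminus I_1$. $X$ is the totally ordered set obtained from $I$ by replacing each $x\in I_1\setminus\{0,1\}$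 by two points $x^-<x^+$, with the order topology ($X$ is homeomorphic to a compact subset of $\mathbb R$). $\pi:X\to I$ is the collapse map ($\pi(x^\pm)=x$ for $x\in I_1$, $\pi(x)=x$ otherwise), and $X_0=\pi^{-1}(I_0)$. There is a unique continuous $\sigma:X\to X$ with $\pi\circ\sigma=\tau\circ\pi$ on $X_0$; it is a local homeomorphism. C*-algebra: for a local homeomorphism $\sigma$ of a compact metrizable space $X$, $R_n=\{(x,y)\in X\times X:\sigma^nx=\sigma^ny\}$ with the topology from $X\times X$, and $R(X,\sigma)=\bigcup_nR_n$ with the inductive limit topology. $C_c(R(X,\sigma))$ is a *-algebra with $(f\star g)(x,y)=\sum_{z:(x,z)\in R(X,\sigma)}f(x,z)g(z,y)$ and $f^*(x,y)=\overline{f(y,x)}$; it has a unique C*-norm, and $C^*(R(X,\sigma))$ is its completion. $F_\tau=C^*(R(X,\sigma))$ for the $\sigma$ associated with $\tau$. When $\sigma$ is surjective (automatic if $\tau$ is transitive), the canonical endomorphism $\Phi$ of $C^*(R(X,\sigma))$ is the *-endomorphism extending $\Phi(f)(x,y)=\big(p(\sigma(x))\,p(\sigma(y))\big)^{-1/2}f(\sigma(x),\sigma(y))$ for $f\in C_c(R(X,\sigma))$, where $p(z)$ is the cardinality of $\sigma^{-1}(z)$. $\tau$ (viewed as undefined on $C$) is transitive if for each pair $U,V$ of non-empty open sets there is $n\ge0$ with $\tau^n(U)\cap V\neq\emptyset$. $\tau$ is essentially injective if there is no pair of disjoint non-empty open sets $U,V$ with $\tau(U)=\tau(V)$. A continuous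 map $f:Y\to Y$ is topologically exact if for every non-empty open $U\subset Y$ there is $n$ with $f^n(U)=Y$. Under the hypotheses on $\tau$, a partition $X_1,\dots,X_n$ as in the statement always exists. *)

(* Defs.v *)
From HB Require Import structures.
From mathcomp Require Import all_boot all_order all_algebra finmap.
From mathcomp Require Import complex.
From mathcomp Require Import all_classical all_reals all_analysis.

Set Implicit Arguments.
Unset Strict Implicit.
Unset Printing Implicit Defensive.

Import Order.TTheory GRing.Theory Num.Theory.
Import numFieldNormedType.Exports.

Local Open Scope classical_set_scope.
Local Open Scope complex_scope.
Local Open Scope ring_scope.

(* Not necessarily unital, hence not built on MathComp's ring hierarchy. The
   norm takes its values in R[i], as for every normedModType over R[i]. *)
HB.mixin Record isCStarAlgebra (R : realType) A of
    @CompleteNormedModule R[i] A := {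
  cmul : A -> A -> A;
  cstar : A -> A;
  cmulA : associative cmul;
  cmul_linearl : forall b : A, linear (fun a : A => cmul a b);
  cmul_linearr : forall a : A, linear (fun b : A => cmul a b);
  cnormM : forall a b : A, `|cmul a b| <= `|a| * `|b|;
  cstarK : involutive cstar;
  cstarD : forall a b : A, cstar (a + b) = cstar a + cstar b;
  cstarZ : forall (c : R[i]) (a : A), cstar (c *: a) = c^* *: cstar a;
  cstarM : forall a b : A, cstar (cmul a b) = cmul (cstar b) (cstar a);
  cstar_norm : forall a : A, `|cmul (cstar a) a| = `|a| ^+ 2
}.

#[short(type="cstarAlgType")]
HB.structure Definition CStarAlgebra (R : realType) :=
  {A of @CompleteNormedModule R[i] A & isCStarAlgebra R A}.

Section cstar_algebras.
Variable R : realType.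
Implicit Types A B : cstarAlgType R.

Definition star_hom A B (phi : A -> B) :=
  [/\ linear phi,
      forall a b, phi (cmul a b) = cmul (phi a) (phi b) &
      forall a, phi (cstar a) = cstar (phi a)].

Definition linear_subspace A (S : set A) :=
  S 0 /\ forall (c : R[i]) (a b : A), S a -> S b -> S (c *: a + b).

Definition star_subalgebra A (S : set A) :=
  [/\ linear_subspace S,
      forall a b, S a -> S b -> S (cmul a b) &
      forall a, S a -> S (cstar a)].

Definition closed_ideal A (J : set A) :=
  [/\ linear_subspace J, closed J &
      forall a b, J b -> J (cmul a b) /\ J (cmul b a)].

Definition simple_algebra A :=
  (exists a : A, a != 0) /\
  forall J : set A, closed_ideal J -> J = [set 0] \/ J = setT.

Definition finite_dimensional A (S : set A) :=
  exists s : seq A, forall a, S a ->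
    exists c : 'I_(size s) -> R[i], a = \sum_i c i *: s`_i.

Definition AF_algebra A :=
  exists B : nat -> set A,
    [/\ forall k, star_subalgebra (B k) /\ finite_dimensional (B k),
        forall k, B k `<=` B k.+1 &
        closure (\bigcup_k B k) = setT].

(* (a_i)_i |-> \sum_i j_i(a_i) is a *-isomorphism of the direct sum of the A_i,
   with coordinatewise operations, onto F. *)
Definition cstar_direct_sum (F : cstarAlgType R) n (A : 'I_n -> cstarAlgType R)
    (j : forall i, A i -> F) :=
  [/\ forall i, star_hom (j i),
      forall i k, i != k ->
        forall (a : A i) (b : A k), cmul (j i a) (j k b) = 0 &
      forall x : F, exists! a : forall i, A i, x = \sum_i j i (a i)].

End cstar_algebras.

(* The relation lives on a subset D of Y mapped to itself by s; (D, s) is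
   (X, sigma) or (X_i, sigma^n) in applications, the latter for X_i clopen. *)
Section tail_relation.
Variables (Y : topologicalType) (D : set Y) (s : Y -> Y).

Definition tail_relation_at (n : nat) : set (Y * Y) :=
  [set p | [/\ D p.1, D p.2 & iter n s p.1 = iter n s p.2]].

Definition tail_relation : set (Y * Y) := \bigcup_n tail_relation_at n.

Definition tail_space : Type := {p : Y * Y | p \in tail_relation}.

HB.instance Definition _ := Choice.on tail_space.

(* The inductive limit topology: U is open iff each trace of U on R_n(D, s) is
   open for the topology of Y * Y. *)
Definition tail_open : set_system tail_space :=
  [set U | forall n, exists2 V : set (Y * Y), open V &
    forall g : tail_space, tail_relation_at n (val g) -> (U g <-> V (val g))].

Lemma tail_openT : tail_open setT.
Proof. by move=> n; exists setT; first exact: openT. Qed.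

Lemma tail_openI : setI_closed tail_open.
Proof.
move=> U U' oU oU' n; have [V oV UV] := oU n; have [V' oV' UV'] := oU' n.
exists (V `&` V'); first exact: openI.
by move=> g gn; split=> -[gU gU']; split; apply/UV || apply/UV'.
Qed.

Lemma tail_open_bigcup (I : Type) (f : I -> set tail_space) :
  (forall i, tail_open (f i)) -> tail_open (\bigcup_i f i).
Proof.
move=> of_ n; have /choice[V VP] : forall i, exists V : set (Y * Y), open V /\
    forall g : tail_space, tail_relation_at n (val g) -> (f i g <-> V (val g)).
  by move=> i; have [V oV fV] := of_ i n; exists V.
exists (\bigcup_i V i); first by apply: bigcup_open => i _; have [] := VP i.
move=> g gn; split=> -[i _ gi]; exists i => //.
  by have [_ h] := VP i; apply/(h g gn).
by have [_ h] := VP i; apply/(h g gn).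
Qed.

HB.instance Definition _ := isOpenTopological.Build tail_space
  tail_openT tail_openI tail_open_bigcup.

Variable R : realType.

(* A function on R(D, s) is represented by its extension by 0 to Y * Y. *)
Definition tail_Cc : set (Y * Y -> R[i]) :=
  [set f | [/\ forall p, ~ tail_relation p -> f p = 0,
               continuous (fun g : tail_space => f (val g) : R[i]^o) &
               compact (closure [set g : tail_space | f (val g) != 0])]].

Definition tail_conv (f g : Y * Y -> R[i]) (p : Y * Y) : R[i] :=
  \sum_(z \in [set z | tail_relation (p.1, z)]) f (p.1, z) * g (z, p.2).

Definition tail_star (f : Y * Y -> R[i]) (p : Y * Y) : R[i] :=
  (f (p.2, p.1))^*.

(* A, with the embedding iota of C_c(R(D, s)), is the completion of
   C_c(R(D, s)) for a C*-norm; this C*-norm being unique, A is C*(R(D, s)).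
   Only the values of iota on C_c(R(D, s)) are meaningful. *)
Definition tail_cstar_completion (A : cstarAlgType R)
    (iota : (Y * Y -> R[i]) -> A) :=
  [/\ forall (c : R[i]) f g, tail_Cc f -> tail_Cc g ->
        iota (fun p => c * f p + g p) = c *: iota f + iota g,
      forall f g, tail_Cc f -> tail_Cc g ->
        iota (tail_conv f g) = cmul (iota f) (iota g),
      forall f, tail_Cc f -> iota (tail_star f) = cstar (iota f),
      forall f g, tail_Cc f -> tail_Cc g -> iota f = iota g -> f = g &
      closure (iota @` tail_Cc) = setT].

Definition is_tail_cstar_algebra (A : cstarAlgType R) :=
  exists iota : (Y * Y -> R[i]) -> A, tail_cstar_completion iota.

End tail_relation.

Section canonical_endomorphism.
Variables (R : realType) (Y : topologicalType) (s : Y -> Y).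

Definition preimage_card (z : Y) : nat := #|` fset_set (s @^-1` [set z])|.

Definition canonical_endo_Cc (f : Y * Y -> R[i]) (p : Y * Y) : R[i] :=
  ((Num.sqrt (preimage_card (s p.1) * preimage_card (s p.2))%:R : R)^-1)%:C
  * f (s p.1, s p.2).

Definition canonical_endomorphism (F : cstarAlgType R)
    (iota : (Y * Y -> R[i]) -> F) (Phi : F -> F) :=
  star_hom Phi /\
  forall f, tail_Cc (R := R) [set: Y] s f ->
    Phi (iota f) = iota (canonical_endo_Cc f).

End canonical_endomorphism.

(* For a subset D mapped to itself by f; the O `&` D are the open sets of D. *)
Definition topologically_exact_on (Y : topologicalType) (D : set Y)
    (f : Y -> Y) :=
  forall O : set Y, open O -> O `&` D !=set0 ->
    exists m, iter m f @` (O `&` D) = D.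

Section piecewise_monotonic.
Variables (R : realType) (tau : R -> R).

Definition continuous_monotonic_on (u v : R) :=
  {within `]u, v[, continuous tau} /\
  ({in `]u, v[ &, {homo tau : x y / x < y}} \/
   {in `]u, v[ &, {homo tau : x y /~ x < y}}).

(* a 0 < ... < a q is the partition associated with tau; the values a i for
   i > q and the values of tau outside [0, 1] are irrelevant. *)
Definition piecewise_monotonic (q : nat) (a : nat -> R) :=
  [/\ forall x, x \in `[0, 1] -> tau x \in `[0, 1],
      [/\ (0 < q)%N, a 0%N = 0, a q = 1 &
        forall i, (i < q)%N -> a i < a i.+1],
      forall i, (i < q)%N -> continuous_monotonic_on (a i) (a i.+1) &
      forall i, (i < q)%N -> forall u v : R, 0 <= u -> v <= 1 ->
        `]a i, a i.+1[%classic `<` `]u, v[%classic ->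
        ~ continuous_monotonic_on u v].

Variables (q : nat) (a : nat -> R).

Definition partition_points : set R := [set a i | i in [set i | (i <= q)%N]].

Definition branch (i : nat) (x : R) : R :=
  lim (tau @ within `]a i, a i.+1[%classic (nbhs x)).

Definition hat_image (S : set R) : set R :=
  \bigcup_(i in `I_q) (branch i @` (S `&` `[a i, a i.+1]%classic)).

Definition hat_preimage (S : set R) : set R :=
  \bigcup_(i in `I_q) (`[a i, a i.+1]%classic `&` branch i @^-1` S).

Definition I1 : set R :=
  smallest [set S | [/\ S `<=` `[0, 1]%classic, hat_image S `<=` S &
                        hat_preimage S `<=` S]]
           partition_points.

Definition I0 : set R := `[0, 1]%classic `\` I1.

(* tau is viewed as undefined on the partition points. *)
Definition tau_image (S : set R) : set R := tau @` (S `\` partition_points).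

Definition open_in_I (U : set R) :=
  exists2 O : set R, open O & U = O `&` `[0, 1]%classic.

Definition transitive_map :=
  forall U V, open_in_I U -> open_in_I V -> U !=set0 -> V !=set0 ->
    exists n, iter n tau_image U `&` V !=set0.

Definition essentially_injective :=
  ~ exists U V, [/\ open_in_I U /\ open_in_I V, U !=set0 /\ V !=set0,
                    U `&` V = set0 & tau_image U = tau_image V].

End piecewise_monotonic.

(* [0, 1] with each point x of S other than 0 and 1 replaced by
   x^- = (x, false) < x^+ = (x, true); any other point x is (x, false). *)
Section split_interval.
Variables (R : realType) (S : set R).

Definition split_carrier : pred (R *l bool) :=
  fun p => (0 <= p.1 <= 1) && (p.2 ==> (p.1 \in S) && (0 < p.1 < 1)).

Definition split_order : Type := {p : R *l bool | split_carrier p}.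

HB.instance Definition _ := SubType.on split_order.
HB.instance Definition _ := Choice.on split_order.
HB.instance Definition _ :=
  [SubChoice_isSubOrder of split_order by <: with Order.Disp tt tt].

Definition split_interval := order_topology split_order.

HB.instance Definition _ := Topological.on split_interval.

Definition collapse (x : split_interval) : R := (val (x : split_order)).1.

End split_interval.

(* These conditions determine sigma, since X_0 = collapse @^-1` I0 is dense. *)
Definition associated_map (R : realType) (tau : R -> R) (q : nat)
    (a : nat -> R) (sigma : split_interval (I1 tau q a) ->
                            split_interval (I1 tau q a)) :=
  continuous sigma /\
  forall x, I0 tau q a (collapse x) -> collapse (sigma x) = tau (collapse x).

(* Main.v *)
Require Import Defs.
From HB Require Import structures.
From mathcomp Require Import all_boot all_order all_algebra finmap.
From mathcomp Require Import complex ring lra.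
From mathcomp Require Import all_classical all_reals all_analysis.

(* The cuts of X at the points of I_1 make X compact and totally disconnected,
   and sigma open and injective on the cells of a finite partition into clopen
   cells; density of the cuts follows from exactness, since every iterate of
   sigma is injective on a gap of I_1. Colour X by the finitely many cuts of
   level L and let kappa x be the word of colours of x, sigma x, ..,
   sigma^n x. Then x is determined by kappa x and sigma^n x, so that a
   function f on R_n is a matrix-valued function m on X,
     f (x, y) = m (sigma^n x) (kappa x) (kappa y),
   and convolution is the matrix product over the colours present above a
   point. Locally constant matrix-valued functions yield the finite-dimensional
   algebras. The C*-norm is at most a constant C_n times the sup norm on C(R_n),
   and the constant disappears on applying this to the powers of a selfadjoint
   element: its norm is at most the supremum of the norms of the matrices.
   Compressing an element of a nonzero closed ideal J by a vector almost
   realising this norm gives an element at distance < 1 from a projection 1_V,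
   whence 1_V lies in J; exactness spreads V over the whole of X_i. *)

(** [F] is given only as a completion for some C*-norm, so no representation is at hand: every norm
    bound has to be extracted from the C*-identity and from products inside C_c(R). The summands are
    not completed anew but cut out of [F]. Tail-equivalent points lie in the same X_i, so the
    characteristic function of X_i on the diagonal is a central projection e_i, and A_i = e_i F. Of
    the endomorphism, only the values at the e_i then have to be computed. Which words occur above a
    point depends on the point. Matrices are therefore indexed by all words and sums restricted to
    those present; as sigma is open and X compact, the set of words present is locally constant. On
    the side of tau, sigma is prescribed only over I_0. Since I_1 is countable, I_0 is dense, and
    inclusions between clopen sets pass from I_0 to X by continuity. Injectivity of sigma on the
    cells, however, is seen by means of the cuts, and for this I_1 has to be dense as well. *)

Set Implicit Arguments.
Unset Strict Implicit.
Unset Printing Implicit Defensive.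

Import Order.TTheory GRing.Theory Num.Theory.
Import numFieldNormedType.Exports.

Local Open Scope classical_set_scope.
Local Open Scope ring_scope.

(** * C*-algebras and their central corners *)

Section CStarBasics.
Variables (R : realType) (A : cstarAlgType R).
Implicit Types (x y z : A) (c : R[i]).

Lemma cmulDl x y z : cmul (x + y) z = cmul x z + cmul y z.
Proof. by have := cmul_linearl z 1 x y; rewrite !scale1r. Qed.

Lemma cmulDr x y z : cmul x (y + z) = cmul x y + cmul x z.
Proof. by have := cmul_linearr x 1 y z; rewrite !scale1r. Qed.

Lemma cmul0l x : cmul 0 x = 0.
Proof. by apply: (addIr (cmul 0 x)); rewrite -cmulDl !add0r. Qed.

Lemma cmul0r x : cmul x 0 = 0.
Proof. by apply: (addIr (cmul x 0)); rewrite -cmulDr !add0r. Qed.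

Lemma cmulZl c x y : cmul (c *: x) y = c *: cmul x y.
Proof. by have := cmul_linearl y c x 0; rewrite !addr0 cmul0l addr0. Qed.

Lemma cmulZr c x y : cmul x (c *: y) = c *: cmul x y.
Proof. by have := cmul_linearr x c y 0; rewrite !addr0 cmul0r addr0. Qed.

Lemma cmulBl x y z : cmul (x - y) z = cmul x z - cmul y z.
Proof. by rewrite cmulDl -scaleN1r cmulZl scaleN1r. Qed.

Lemma cmulBr x y z : cmul x (y - z) = cmul x y - cmul x z.
Proof. by rewrite cmulDr -(scaleN1r z) cmulZr scaleN1r. Qed.

Lemma cmul_sumr (I : Type) (r : seq I) (P : pred I) (f : I -> A) y :
  cmul y (\sum_(i <- r | P i) f i) = \sum_(i <- r | P i) cmul y (f i).
Proof. by elim/big_rec2: _ => [|i u v _ <-]; rewrite (cmul0r, cmulDr). Qed.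

Lemma cstar0 : cstar (0 : A) = 0.
Proof. by apply: (addIr (cstar 0)); rewrite -cstarD !add0r. Qed.

Lemma cstarN x : cstar (- x) = - cstar x.
Proof. by apply: (addIr (cstar x)); rewrite -cstarD !addNr cstar0. Qed.

Lemma cstarB x y : cstar (x - y) = cstar x - cstar y.
Proof. by rewrite cstarD cstarN. Qed.

(** The norm of a module over [R[i]] is itself a complex number; its real part lives in [R], where
    [lra], [nra] and limits of powers are available. *)
Definition cnorm x : R := complex.Re `|x|.

Lemma cnormE x : `|x| = (cnorm x)%:C%C.
Proof.
by rewrite /cnorm RRe_real.
Qed.

Lemma cnorm_ge0 x : 0 <= cnorm x.
Proof. by have := normr_ge0 x; rewrite cnormE lecR. Qed.

Lemma cnormD x y : cnorm (x + y) <= cnorm x + cnorm y.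
Proof. by have := ler_normD x y; rewrite !cnormE -rmorphD lecR. Qed.

Lemma cnormN x : cnorm (- x) = cnorm x.
Proof. by rewrite /cnorm normrN. Qed.

Lemma cnormB x y : cnorm (x - y) = cnorm (y - x).
Proof. by rewrite -cnormN opprB. Qed.

Lemma cnorm_cmul x y : cnorm (cmul x y) <= cnorm x * cnorm y.
Proof. by have := cnormM x y; rewrite !cnormE -rmorphM lecR. Qed.

Lemma cnormZ c x : cnorm (c *: x) = complex.Re `|c| * cnorm x.
Proof.
apply: (@complexI R); rewrite rmorphM -cnormE normrZ cnormE; by congr (_ * _).
Qed.

Lemma cnorm_star_sq x : cnorm (cmul (cstar x) x) = cnorm x ^+ 2.
Proof. by apply: (@complexI R); rewrite rmorphXn /= -!cnormE cstar_norm. Qed.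

Lemma cnorm_eq0 x : cnorm x = 0 -> x = 0.
Proof. by move=> x0; apply/normr0_eq0; rewrite cnormE x0. Qed.

Lemma cnorm0 : cnorm (0 : A) = 0.
Proof. by rewrite /cnorm normr0. Qed.

Lemma cnorm_sum (I : Type) (r : seq I) (P : pred I) (f : I -> A) :
  cnorm (\sum_(i <- r | P i) f i) <= \sum_(i <- r | P i) cnorm (f i).
Proof.
elim/big_rec2: _ => [|i u v _ le]; first by rewrite cnorm0.
by apply: le_trans (cnormD _ _) _; rewrite lerD2l.
Qed.

(** The C*-identity and submultiplicativity give |y|^2 <= |y^*| |y|; the reverse inequality is the
    same one applied to y^*. *)
Lemma cnorm_star x : cnorm (cstar x) = cnorm x.
Proof.
suff h y : cnorm y <= cnorm (cstar y).
  by apply/eqP; rewrite eq_le h andbT -{2}[x]cstarK h.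
have [->|y0] := eqVneq (cnorm y) 0; first exact: cnorm_ge0.
have yp : 0 < cnorm y by rewrite lt0r y0 cnorm_ge0.
by rewrite -(ler_pM2r yp) -expr2 -cnorm_star_sq cnorm_cmul.
Qed.

Lemma closure_cnorm (S : set A) x :
  closure S x <-> forall e : R, 0 < e -> exists2 y, S y & cnorm (x - y) < e.
Proof.
split=> [cS e e0|h].
  have : nbhs x (ball x e%:C%C) by apply: nbhsx_ballx; rewrite ltcR.
  move=> /cS[y [Sy]]; rewrite -ball_normE /= cnormE ltcR => ?.
  by exists y.
move=> B /nbhs_ballP[eps /= eps0]; rewrite -ball_normE => eB.
have eE : eps = (complex.Re eps)%:C%C by rewrite RRe_real ?gtr0_real.
have e0 : 0 < complex.Re eps by rewrite -ltcR -eE.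
have [y Sy xy] := h _ e0.
by exists y; split=> //; apply: eB; rewrite /= cnormE eE ltcR.
Qed.

End CStarBasics.

(** A record, because [corner] is a type whose structures are inferred from its argument: the
    properties of the projection have to travel with it. *)
Record central_projection (R : realType) (A : cstarAlgType R) :=
  CentralProjection {
    cproj :> A;
    cproj_comm : forall x, cmul cproj x = cmul x cproj;
    cproj_idem : cmul cproj cproj = cproj;
    cproj_star : cstar cproj = cproj }.

Section Corner.
Variables (R : realType) (A : cstarAlgType R) (e : central_projection A).
Local Open Scope complex_scope.
Local Open Scope ring_scope.

(** As e is central, e A = e A e, and this one equation describes an algebra with unit e. *)
Definition in_corner : pred A := fun x => cmul e x == x.

Lemma in_corner_submod : submod_closed in_corner.
Proof.
split=> [|c x y]; rewrite !unfold_in; first by rewrite cmul0r.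
by move=> /eqP xe /eqP ye; rewrite cmulDr cmulZr xe ye.
Qed.

HB.instance Definition _ := GRing.isSubmodClosed.Build R[i] A in_corner
  in_corner_submod.

Definition corner : Type := {x : A | in_corner x}.

HB.instance Definition _ := SubType.on corner.
HB.instance Definition _ := Choice.on corner.
HB.instance Definition _ := [SubChoice_isSubLmodule of corner by <:].

Definition corner_norm (x : corner) : R[i] := `|val x|.

Lemma corner_ler_normD (x y : corner) :
  corner_norm (x + y) <= corner_norm x + corner_norm y.
Proof. exact: ler_normD. Qed.

Lemma corner_normrZ (c : R[i]) (x : corner) :
  corner_norm (c *: x) = `|c| * corner_norm x.
Proof. exact: normrZ. Qed.

Lemma corner_normr0_eq0 (x : corner) : corner_norm x = 0 -> x = 0.
Proof. by move=> /normr0_eq0 x0; exact: val_inj. Qed.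

HB.instance Definition _ := Lmodule_isNormed.Build R[i] corner
  corner_ler_normD corner_normrZ corner_normr0_eq0.

Lemma cornerP (x : corner) : cmul e (val x) = val x.
Proof. exact/eqP/(valP x). Qed.

Lemma in_corner_cmul (x : A) : in_corner (cmul e x).
Proof. by rewrite /in_corner cmulA cproj_idem. Qed.

Definition to_corner (x : A) : corner := exist _ (cmul e x) (in_corner_cmul x).

Lemma val_to_corner (x : A) : val (to_corner x) = cmul e x.
Proof. by []. Qed.

Definition corner_mul (x y : corner) : corner :=
  to_corner (cmul (val x) (val y)).

Lemma val_corner_mul (x y : corner) :
  val (corner_mul x y) = cmul (val x) (val y).
Proof. by rewrite val_to_corner cmulA cornerP. Qed.

Definition corner_star (x : corner) : corner := to_corner (cstar (val x)).

Lemma val_corner_star (x : corner) : val (corner_star x) = cstar (val x).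
Proof.
by rewrite val_to_corner -{2}(cornerP x) cstarM cproj_star cproj_comm.
Qed.

Lemma corner_complete (G : set_system corner) :
  ProperFilter G -> cauchy G -> cvg G.
Proof.
move=> PG /cauchyP cG.
have cvG : cauchy (val @ G).
  apply/cauchyP => eps eps0; have [x Gx] := cG _ eps0; exists (val x).
  apply: filterS Gx => y; rewrite -!ball_normE /=; exact.
have /cauchy_cvgP/cvg_ex[/= a Ga] := cvG.
(* The limit stays in the corner: for x there, e a - a = e (a - x) - (a - x), of norm at most (|e| +
   1) |a - x|. *)
have aP : in_corner a.
  rewrite /in_corner -subr_eq0 -normr_le0.
  apply/ler_addgt0Pl => eps eps0; rewrite addr0.
  have c0 : 0 < eps / (`|e : A| + 1).
    by rewrite divr_gt0 // ltr_wpDl.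
  have : \forall x \near G, ball a (eps / (`|e : A| + 1)) (val x).
    by apply: Ga; exact: nbhsx_ballx.
  move=> /filter_ex[x]; rewrite -ball_normE /= => ax.
  have -> : cmul e a - a = cmul e (a - val x) - (a - val x).
    by rewrite cmulBr cornerP opprB addrA subrK.
  apply: le_trans (ler_normB _ _) _.
  apply: (@le_trans _ _ ((`|e : A| + 1) * `|a - val x|)).
    by rewrite mulrDl mul1r lerD2r cnormM.
  rewrite mulrC -ler_pdivlMr; last by rewrite ltr_wpDl.
  exact: ltW.
apply/cvg_ex; exists (exist _ a aP : corner).
move=> B /nbhs_ballP[eps eps0]; rewrite -ball_normE => eB.
have : \forall x \near G, ball a eps (val x) by apply: Ga; exact: nbhsx_ballx.
by apply: filterS => x; rewrite -ball_normE /= => ax; apply: eB.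
Qed.

HB.instance Definition _ := Uniform_isComplete.Build corner corner_complete.

Lemma val_linear (c : R[i]) (x y : corner) :
  val (c *: x + y) = c *: val x + val y.
Proof. by []. Qed.

Lemma corner_mulA : associative corner_mul.
Proof. by move=> x y z; apply: val_inj; rewrite !val_corner_mul cmulA. Qed.

Lemma corner_mul_linearl (y : corner) : linear (fun x => corner_mul x y).
Proof.
move=> c u v; apply: val_inj.
by rewrite val_linear !val_corner_mul val_linear cmul_linearl.
Qed.

Lemma corner_mul_linearr (x : corner) : linear (corner_mul x).
Proof.
move=> c u v; apply: val_inj.
by rewrite val_linear !val_corner_mul val_linear cmul_linearr.
Qed.

Lemma corner_normM (x y : corner) : `|corner_mul x y| <= `|x| * `|y|.
Proof. by rewrite /Num.norm /= /corner_norm val_corner_mul cnormM. Qed.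

Lemma corner_starK : involutive corner_star.
Proof. by move=> x; apply: val_inj; rewrite !val_corner_star cstarK. Qed.

Lemma corner_starD (x y : corner) :
  corner_star (x + y) = corner_star x + corner_star y.
Proof.
by apply: val_inj; rewrite val_corner_star cstarD -!val_corner_star.
Qed.

Lemma corner_starZ (c : R[i]) (x : corner) :
  corner_star (c *: x) = c^* *: corner_star x.
Proof.
by apply: val_inj; rewrite val_corner_star cstarZ -val_corner_star.
Qed.

Lemma corner_starM (x y : corner) :
  corner_star (corner_mul x y) = corner_mul (corner_star y) (corner_star x).
Proof.
by apply: val_inj; rewrite !(val_corner_star, val_corner_mul) cstarM.
Qed.

Lemma corner_star_norm (x : corner) :
  `|corner_mul (corner_star x) x| = `|x| ^+ 2.
Proof.
by rewrite /Num.norm /= /corner_norm val_corner_mul val_corner_star cstar_norm.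
Qed.

HB.instance Definition _ := isCStarAlgebra.Build R corner
  corner_mulA corner_mul_linearl corner_mul_linearr corner_normM
  corner_starK corner_starD corner_starZ corner_starM corner_star_norm.

Definition corner_alg : cstarAlgType R := corner.

Lemma val_star_hom : star_hom (val : corner_alg -> A).
Proof.
by split=> [c x y|x y|x]; [|exact: val_corner_mul|exact: val_corner_star].
Qed.

End Corner.

(** * The topology of the tail relation *)

Section LocallyConstant.
Variables (Z : topologicalType).

(** [K] carries no topology, so the notion applies equally to booleans, words of colours, indices of
    pieces and complex numbers. *)
Definition loc_const (K : Type) (f : Z -> K) := forall k,
  open (f @^-1` [set k]).

Lemma loc_const_open (K : Type) (f : Z -> K) (P : set K) :
  loc_const f -> open (f @^-1` P).
Proof.
move=> lf; have -> : f @^-1` P = \bigcup_(k in P) (f @^-1` [set k]).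
  by apply/seteqP; split=> [z Pz|z [k Pk /= zk]];
    [exists (f z)|rewrite /preimage /= zk].
exact: bigcup_open.
Qed.

Lemma loc_const_clopen (K : Type) (f : Z -> K) (P : set K) :
  loc_const f -> clopen (f @^-1` P).
Proof.
move=> lf; split; first exact: loc_const_open.
by rewrite -openC preimage_setC; exact: loc_const_open.
Qed.

Lemma loc_const_pair (K L : Type) (f : Z -> K) (g : Z -> L) :
  loc_const f -> loc_const g -> loc_const (fun z => (f z, g z)).
Proof.
move=> lf lg [k l]; have := openI (lf k) (lg l); congr open.
by apply/seteqP; split=> z /= [e1 e2]; [congr pair|split].
Qed.

Lemma loc_const_app (K L : Type) (f : Z -> K) (g : K -> L) :
  loc_const f -> loc_const (g \o f).
Proof. by move=> lf l; exact: (@loc_const_open K f (g @^-1` [set l])). Qed.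

Lemma loc_const_bool (b : Z -> bool) :
  clopen [set z | b z] -> loc_const b.
Proof.
move=> [ob cb] [].
  by move: ob; congr open; apply/seteqP; split=> z /=.
move: cb; rewrite -openC; congr open; apply/seteqP; split=> z /=.
  by move/negP/negbTE.
by move=> ->.
Qed.

Lemma open_forall (I : finType) (P : I -> set Z) :
  (forall i, open (P i)) -> open [set z | forall i, P i z].
Proof.
move=> oP; have -> : [set z | forall i, P i z] = \big[setI/setT]_(i <- enum I)
  P i.
  rewrite -bigcap_seq; apply/seteqP; split=> z Pz i; first by move=> _;
    exact: Pz.
  by apply: Pz; rewrite /= mem_enum.
by apply: big_ind => // *; [exact: openT | exact: openI].
Qed.

Lemma loc_const_ffun (I : finType) (K : Type) (f : I -> Z -> K) :
  (forall i, loc_const (f i)) -> loc_const (fun z => [ffun i => f i z]).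
Proof.
move=> lf k; have := open_forall (fun i => lf i (k i)); congr open.
apply/seteqP; split=> z /=; last by move=> <- i; rewrite ffunE.
by move=> h; apply/ffunP => i; rewrite ffunE.
Qed.

End LocallyConstant.

Lemma loc_const_comp (Z Z' : topologicalType) (K : Type) (f : Z -> K)
    (g : Z' -> Z) :
  continuous g -> loc_const f -> loc_const (f \o g).
Proof. by move=> cg lf k; move/continuousP: cg => /(_ _ (lf k)). Qed.

Lemma iter_continuous (Z : topologicalType) (g : Z -> Z) n :
  continuous g -> continuous (iter n g).
Proof.
move=> cg; elim: n => [|n IH] z; first exact: cvg_id.
by apply: (@continuous_comp _ _ _ (iter n g) g); [exact: IH | exact: cg].
Qed.

Lemma closed_eqfun (Z Z' : topologicalType) (g h : Z -> Z') :
  hausdorff_space Z' -> continuous g -> continuous h ->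
  closed [set z | g z = h z].
Proof.
rewrite open_hausdorff => hZ cg ch; rewrite -openC openE => z /= /eqP.
move=> /hZ[[U V] /= [/set_mem gU /set_mem hV] [oU oV /eqP UV]].
have gN : nbhs z (g @^-1` U) by apply: cg; exact: open_nbhs_nbhs.
have hN : nbhs z (h @^-1` V) by apply: ch; exact: open_nbhs_nbhs.
apply: filterS (filterI gN hN) => t [/= gt ht] e.
suff: (U `&` V) (g t) by rewrite UV.
by split=> //=; rewrite e.
Qed.

(** Otherwise the sets K \ U n generate a proper filter on K, and a cluster point of it lies in no U
    n. *)
Lemma compact_increasing (Z : topologicalType) (K : set Z) (U : nat -> set Z) :
  compact K -> (forall n, open (U n)) ->
  (forall m n, (m <= n)%N -> U m `<=` U n) ->
  K `<=` \bigcup_n U n -> exists n, K `<=` U n.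
Proof.
move=> cK oU incr KU; apply: contrapT => noN.
pose G := filter_from setT (fun n => K `\` U n).
have GF : Filter G.
  apply: filter_from_filter; first by exists 0%N.
  move=> m n _ _; exists (maxn m n) => // z [Kz Uz]; split; split=> // h;
    apply: Uz.
    by apply: incr h; rewrite leq_maxl.
  by apply: incr h; rewrite leq_maxr.
have GP : ProperFilter G.
  apply: filter_from_proper => // n _; apply/set0P/eqP => e.
  by apply: noN; exists n; apply/subsets_disjoint; rewrite -setDE.
have [|x [Kx clx]] := cK G GP; first by exists 0%N => // z [].
have [n _ Ux] := KU x Kx.
have Gn : G (K `\` U n) by exists n.
by have [z [[_ nU] /nU]] := clx _ _ Gn (open_nbhs_nbhs (conj (oU n) Ux)).
Qed.

(** * The filtration of R(D, s) by the R_N *)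

Section TailTopology.
Variables (R : realType) (Y : topologicalType) (D : set Y) (s : Y -> Y).
Variables (K : Type) (c : Y -> K).
Hypotheses (cY : compact [set: Y]) (hY : hausdorff_space Y) (clD : closed D).
Hypotheses (cs : continuous s) (lc : loc_const c).
Hypothesis s_inj : forall x y, c x = c y -> s x = s y -> x = y.
Implicit Types (f : Y * Y -> R[i]) (N M : nat).

Local Notation RN := (tail_relation_at D s).

Lemma tail_relation_atS N M p : (N <= M)%N -> RN N p -> RN M p.
Proof.
by move=> /subnK <- [D1 D2 e]; split=> //; rewrite !iterD e.
Qed.

(** Since [s] is injective on each colour class, a pair in R_M lies in R_N exactly when its colours
    agree at the times N, ..., M - 1 ([agree_tail]); membership in R_N is thus a clopen condition
    inside R_M. *)
Definition agree N M : set (Y * Y) :=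
  [set p | forall i, (N <= i < M)%N -> c (iter i s p.1) = c (iter i s p.2)].

Lemma agree_clopen N M : clopen (agree N M).
Proof.
have h i : clopen [set p : Y * Y | c (iter i s p.1) = c (iter i s p.2)].
  apply: (@loc_const_clopen _ _ (fun p : Y * Y => (c (iter i s p.1),
    c (iter i s p.2)))
    [set q | q.1 = q.2]).
  have ci := @iter_continuous _ _ i cs.
  apply: loc_const_pair; apply: (loc_const_comp (g := fun p : Y * Y =>
    iter i s _)) lc.
    by move=> p; apply: (continuous_comp (f := fst));
      [exact: cvg_fst | exact: ci].
  by move=> p; apply: (continuous_comp (f := snd));
    [exact: cvg_snd | exact: ci].
elim: M => [|M IH].
  have -> : agree N 0 = setT; last exact: clopenT.
  by apply/seteqP; split=> // p _ i; rewrite ltn0 andbF.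
have [NM|MN] := leqP N M; last first.
  have -> : agree N M.+1 = setT; last exact: clopenT.
  apply/seteqP; split=> // p _ i /andP[Ni]; rewrite ltnS => iM.
  by have := leq_ltn_trans (leq_trans Ni iM) MN; rewrite ltnn.
have -> : agree N M.+1 = agree N M `&`
    [set p : Y * Y | c (iter M s p.1) = c (iter M s p.2)].
  apply/seteqP; split=> p.
    move=> ap; split=> [i /andP[Ni iM]|]; first by apply: ap; rewrite Ni ltnW.
    by apply: ap; rewrite NM ltnSn.
  move=> [ap pM] i /andP[Ni]; rewrite ltnS leq_eqVlt => /orP[/eqP -> //|iM].
  by apply: ap; rewrite Ni.
exact: clopenI.
Qed.

Lemma agree_tail N M p : (N <= M)%N -> RN M p -> RN N p <-> agree N M p.
Proof.
move=> NM [D1 D2 e]; split=> [[_ _ eN] i /andP[Ni _]|ap].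
  by rewrite -(subnK Ni) !iterD eN.
split=> //; elim: M NM e ap => [|M IH]; first by rewrite leqn0 => /eqP ->.
rewrite leq_eqVlt => /orP[/eqP -> //|]; rewrite ltnS => NM e ap;
  apply: IH => //.
  by apply: s_inj => //; apply: ap; rewrite NM ltnSn.
by move=> i /andP[Ni iM]; apply: ap; rewrite Ni ltnW.
Qed.

(** Continuity of [f] on R_N for the topology of Y * Y: it refers to a single level, unlike
    continuity on [tail_space]. *)
Definition trace_cont f N := forall O : set R[i]^o, open O ->
  exists V : set (Y * Y), open V /\ forall p, RN N p -> (O (f p) <-> V p).

Lemma tail_in_rel N p : RN N p -> p \in tail_relation D s.
Proof. by move=> pN; apply/mem_set; exists N. Qed.

Lemma tail_Cc_trace f N : tail_Cc D s f -> trace_cont f N.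
Proof.
move=> [_ /continuousP cf _] O /cf /(_ N)[V oV VP].
exists V; split=> // p pN.
by have /= := VP (exist _ p (tail_in_rel pN)) pN.
Qed.

Definition RN_tail N : set (tail_space D s) := [set g | RN N (val g)].

Lemma tail_openE (U : set (tail_space D s)) : open U = tail_open U.
Proof. by []. Qed.

(** The trace of R_N on R_M is everything when M <= N and is cut out by [agree N M] otherwise. *)
Lemma RN_tail_clopen N : clopen (RN_tail N).
Proof.
split; rewrite -?openC (tail_openE _) => M;
  have [MN|/ltnW NM] := leqP M N; have [oa ca] := agree_clopen N M.
- exists setT => [|g /(tail_relation_atS MN)]; [exact: openT|by split].
- by exists (agree N M) => // g /(agree_tail NM).
- exists set0 => [|g /(tail_relation_atS MN) gN]; [exact: open0|by split].
- exists (~` agree N M) => [|g /(agree_tail NM) gE]; first exact: closed_openC.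
  by split=> h /gE.
Qed.

(** The R_N are open and increase to R(D, s), so one of them contains the compact closure of the
    support. *)
Lemma tail_Cc_supp f : tail_Cc D s f -> exists N, forall p, f p != 0 -> RN N p.
Proof.
move=> [f0 _ /compact_increasing].
move=> /(_ RN_tail (fun N => (RN_tail_clopen N).1)) [] .
- by move=> m n mn g; exact: tail_relation_atS.
- by move=> g _; have /set_mem[N _ gN] := valP g; exists N.
move=> N sN; exists N => p fp.
have pR : tail_relation D s p by apply: contrapT => /f0 fp0;
  rewrite fp0 eqxx in fp.
by have := sN (exist _ p (mem_set pR)); apply; exact: subset_closure.
Qed.

Lemma RN_closed N : closed (RN N).
Proof.
have -> : RN N = (fst @^-1` D) `&` (snd @^-1` D) `&`
    [set p | iter N s p.1 = iter N s p.2].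
  by apply/seteqP; split=> p; [case|case=> -[]].
apply: closedI; first by apply: closedI; apply: preimage_closed clD => p _;
  [exact: cvg_fst|exact: cvg_snd].
have ci := @iter_continuous _ _ N cs.
apply: closed_eqfun => // p.
  by apply: (continuous_comp (f := fst)); [exact: cvg_fst | exact: ci].
by apply: (continuous_comp (f := snd)); [exact: cvg_snd | exact: ci].
Qed.

Lemma RN_compact N : compact (RN N).
Proof.
apply: (subclosed_compact (@RN_closed N) (compact_setX cY cY)).
by move=> p _; split.
Qed.

(** The traces on R_N of open sets of the inductive limit come from open sets of Y * Y, so a cluster
    point found in the compact subset R_N of Y * Y is a cluster point here too. *)
Lemma RN_tail_compact N : compact (RN_tail N).
Proof.
move=> G PG GN.
have [p [pN clp]] := @RN_compact N (val @ G) _ GN.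
exists (exist _ p (tail_in_rel pN)); split=> //.
move=> A B GA; rewrite nbhsE => -[B' [oB' B'p] B'B].
have [V oV VP] := oB' N.
have Vp : V p by apply/(VP (exist _ p (tail_in_rel pN)) pN).
have [] := clp (val @` (A `&` RN_tail N)) V.
- have : G (val @^-1` (val @` (A `&` RN_tail N))); last by [].
  by apply: filterS (filterI GA GN) => g gA; exists g.
- exact: open_nbhs_nbhs.
move=> _ [[g [gA gN] <-] Vg]; exists g; split=> //.
by apply: B'B; apply/(VP g gN).
Qed.

Lemma tail_CcI f N : (forall p, f p != 0 -> RN N p) -> trace_cont f N ->
  tail_Cc D s f.
Proof.
move=> sf tf; split.
- move=> p np; apply/eqP/negPn/negP => /sf pN; apply: np; exists N => //.
- apply/continuousP => O oO; rewrite tail_openE => M;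
    have [V [oV VP]] := tf O oO.
  have [MN|/ltnW NM] := leqP M N.
    by exists V => // g gM; apply: VP; exact: tail_relation_atS gM.
  have [oa /closed_openC ona] := agree_clopen N M.
  (* Inside [agree N M] the set V describes the preimage of O; outside it f vanishes, so the
     preimage is all or nothing according to [O 0]. *)
  exists ((V `&` agree N M) `|` (~` agree N M `&` [set _ | O 0])).
    apply: openU; first exact: openI.
    apply: openI => //; have [z0|z0] := pselect (O 0).
      by rewrite (_ : [set _ | _] = setT); [exact: openT | apply/seteqP; split].
    by rewrite (_ : [set _ | _] = set0); [exact: open0 | apply/seteqP; split].
  move=> g gM; have gE := agree_tail NM gM.
  have [gN|gN] := pselect (RN N (val g)).
    split=> [Og|[[Vg _]|[]]]; [|exact/VP|by move=> h; case: h; apply/gE].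
    by left; split; [exact/VP | exact/gE].
  have f0 : f (val g) = 0 by apply/eqP/negPn/negP => /sf.
  rewrite /= f0; split=> [z0|[[_ /gE //]|[//]]].
  by right; split=> // /gE.
- apply: (subclosed_compact _ (RN_tail_compact (N := N)));
    first exact: closed_closure.
  have -> : RN_tail N = closure (RN_tail N).
    by apply/closure_id; case: (RN_tail_clopen N).
  by apply: closureS => g; exact: sf.
Qed.

End TailTopology.

(** * Colourings by clopen cuts *)

(* [E] is a sequence of clopen cuts; the first [N0] of them separate the points
   of each fibre of [s]. *)
Record colour_system (Y : topologicalType) (s : Y -> Y) (E : nat -> Y -> bool)
    (N0 : nat) : Prop := ColourSystem {
  colour_compact : compact [set: Y];
  colour_clopen : forall i, clopen [set x | E i x];
  colour_sep : forall x y, (forall i, E i x = E i y) -> x = y;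
  colour_cont : continuous s;
  colour_open : forall O, open O -> open (s @` O);
  colour_inj : forall x y, (forall i, (i < N0)%N -> E i x = E i y) ->
    s x = s y -> x = y }.

Section Colours.
Variables (Y : topologicalType) (s : Y -> Y) (E : nat -> Y -> bool) (N0 : nat).
Hypothesis cs : colour_system s E N0.
Implicit Types (n L : nat) (x y z w : Y).

Definition colour L x : {ffun 'I_L -> bool} := [ffun j => E (val j) x].

(* Together with [iter n s x] the itinerary determines [x] when [N0 <= L]. *)
Definition itin n L x : {ffun 'I_n.+1 * 'I_L -> bool} :=
  [ffun p => E (val p.2) (iter (val p.1) s x)].

Lemma loc_const_E i : loc_const (E i).
Proof. exact/loc_const_bool/(colour_clopen cs). Qed.

Lemma loc_const_colour L : loc_const (colour L).
Proof. by apply: loc_const_ffun => j; exact: loc_const_E. Qed.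

Lemma cont_iter n : continuous (iter n s).
Proof. exact/iter_continuous/(colour_cont cs). Qed.

Lemma loc_const_itin n L : loc_const (itin n L).
Proof.
apply: loc_const_ffun => p.
exact: (loc_const_comp (@cont_iter (val p.1)) (@loc_const_E (val p.2))).
Qed.

Lemma colourP L x y : colour L x = colour L y <-> forall i,
  (i < L)%N -> E i x = E i y.
Proof.
split=> [/ffunP e i iL|h]; last by apply/ffunP => j; rewrite !ffunE;
  exact: h (ltn_ord j).
by have := e (Ordinal iL); rewrite !ffunE.
Qed.

Lemma itinP n L x y : itin n L x = itin n L y <->
  forall i, (i <= n)%N -> colour L (iter i s x) = colour L (iter i s y).
Proof.
split=> [/ffunP e i iL|h].
  apply/ffunP => j; have := e (Ordinal (iL : (i < n.+1)%N), j).
  by rewrite !ffunE.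
apply/ffunP => -[i j]; rewrite !ffunE /=.
have /ffunP/(_ j) := h i (ltn_ord i); rewrite !ffunE; exact.
Qed.

Lemma colour_le L M x y : (L <= M)%N -> colour M x = colour M y ->
  colour L x = colour L y.
Proof.
by move=> LM /colourP h; apply/colourP => i iL; apply: h; exact: leq_trans LM.
Qed.

Lemma colour_hausdorff : hausdorff_space Y.
Proof.
rewrite open_hausdorff => x y xy.
have [i Ei] : exists i, E i x != E i y.
  apply: contrapT => h; case/eqP: xy; apply: (colour_sep cs) => i.
  by apply/eqP/negPn/negP => e; apply: h; exists i.
exists (E i @^-1` [set E i x], E i @^-1` [set E i y]).
  by rewrite !inE.
split=> /=; [exact: loc_const_E | exact: loc_const_E |].
by apply/eqP/seteqP; split=> // z /= [e1 e2]; move: Ei; rewrite -e1 -e2 eqxx.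
Qed.

Lemma itin_inj n L x y : (N0 <= L)%N -> itin n L x = itin n L y ->
  iter n s x = iter n s y -> x = y.
Proof.
move=> NL /itinP; elim: n => // n IH h e; apply: IH.
  by move=> i iN; apply: h; exact: leqW.
apply: (colour_inj cs) e => i iN; have /colourP := h n (leqnSn n); apply.
exact: leq_trans NL.
Qed.

(** The colour classes of x decrease to {x} by [colour_sep]; by compactness one of them avoids the
    complement of O. *)
Lemma colour_nbhs x (O : set Y) : open O -> O x ->
  exists L, forall y, colour L y = colour L x -> O y.
Proof.
move=> oO Ox.
have cO : compact (~` O).
  by apply: subclosed_compact (colour_compact cs) _ => //; exact: open_closedC.
have [|||L sub] := @compact_increasing _ _ (fun L =>
  [set y | colour L y <> colour L x]) cO.
- move=> L; exact: (loc_const_open (fun k => k <> colour L x)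
    (@loc_const_colour L)).
- by move=> L M LM y /= h /(colour_le LM).
- move=> y /= nOy; apply: contrapT => h; apply: nOy.
  suff -> : y = x by [].
  apply: (colour_sep cs) => i; apply: contrapT => e; apply: h;
    exists i.+1 => //.
  by move=> /colourP /(_ i (ltnSn i)).
by exists L => y e; apply: contrapT => /sub /=.
Qed.

(** A Lebesgue number lemma, with the level [L] of the colours in the place of the radius. *)
Lemma colour_uniform (Q : Y -> Y -> Prop) :
  (forall x, exists O, [/\ open O, O x & forall y z, O y -> O z -> Q y z]) ->
  exists L, forall x y, colour L x = colour L y -> Q x y.
Proof.
move=> hQ.
pose U L := [set x | forall y z, colour L y = colour L x ->
  colour L z = colour L x -> Q y z].
have [|||L sub] := @compact_increasing _ _ U (colour_compact cs).
- move=> L; exact: (loc_const_open (fun k => forall y z, colour L y = k ->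
    colour L z = k -> Q y z) (@loc_const_colour L)).
- by move=> L M LM x /= h y z /(colour_le LM) ? /(colour_le LM) ?; exact: h.
- move=> x _; have [W [oO Ox h]] := hQ x; have [L hL] := colour_nbhs oO Ox.
  by exists L => // y z /hL Oy /hL Oz; exact: h.
by exists L => x y e; exact: (sub y I).
Qed.

Lemma colour_loc_const (T : Type) (f : Y -> T) : loc_const f ->
  exists L, forall x y, colour L x = colour L y -> f x = f y.
Proof.
move=> lf; apply: colour_uniform => x; exists (f @^-1` [set f x]).
by split=> // y z /= -> ->.
Qed.

Definition fibre_set n L (k : {ffun 'I_n.+1 * 'I_L -> bool}) : set Y :=
  iter n s @` (itin n L @^-1` [set k]).

Definition in_fibre n L (k : {ffun 'I_n.+1 * 'I_L -> bool}) w : bool :=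
  `[< fibre_set k w >].

Lemma iter_open n (O : set Y) : open O -> open (iter n s @` O).
Proof.
move=> oO; elim: n => [|n IH]; first by rewrite /= image_id.
have -> : iter n.+1 s @` O = s @` (iter n s @` O) by rewrite image_comp.
exact: (colour_open cs).
Qed.

(** Open because [s] is open, closed as a continuous image of a compact set in a Hausdorff space. *)
Lemma fibre_set_clopen n L (k : {ffun 'I_n.+1 * 'I_L -> bool}) :
  clopen (fibre_set k).
Proof.
split; first exact/iter_open/loc_const_itin.
apply: compact_closed; first exact: colour_hausdorff.
apply: continuous_compact.
  by apply: continuous_subspaceT => x; exact: cont_iter.
apply: subclosed_compact (colour_compact cs) _ => //.
by have [] := loc_const_clopen [set k] (@loc_const_itin n L).
Qed.

Lemma loc_const_in_fibre n L (k : {ffun 'I_n.+1 * 'I_L ->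
  bool}) : loc_const (in_fibre k).
Proof.
apply: loc_const_bool; have := fibre_set_clopen k; congr clopen.
by apply/seteqP; split=> w /asboolP.
Qed.

(* Arbitrary unless [in_fibre k w]. *)
Definition fibre_pt n L (k : {ffun 'I_n.+1 * 'I_L -> bool}) w : Y :=
  xget w [set x | itin n L x = k /\ iter n s x = w].

Lemma fibre_ptP n L (k : {ffun 'I_n.+1 * 'I_L -> bool}) w : in_fibre k w ->
  itin n L (fibre_pt k w) = k /\ iter n s (fibre_pt k w) = w.
Proof.
move=> /asboolP[x /= kx xw].
exact: (@xgetPex _ w [set x | itin n L x = k /\
  iter n s x = w] (ex_intro _ x (conj kx xw))).
Qed.

Lemma in_fibre_itin n L x : in_fibre (itin n L x) (iter n s x).
Proof. by apply/asboolP; exists x. Qed.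

Lemma fibre_pt_itin n L x : (N0 <= L)%N -> fibre_pt (itin n L x) (iter n s x) =
  x.
Proof.
by move=> NL; have [kx sx] := fibre_ptP (in_fibre_itin n L x);
  exact: (itin_inj NL kx sx).
Qed.

End Colours.

(** * Functions on R_n as matrix-valued functions *)

Section ContinuousComplex.
Variables (R : realType) (Z : topologicalType).
Local Open Scope complex_scope.
Local Open Scope ring_scope.
Implicit Types f g : Z -> R[i]^o.

Lemma continuous_loc_const f : loc_const f -> continuous f.
Proof. by move=> lf; apply/continuousP => O _; exact: loc_const_open. Qed.

Lemma continuous_add f g : continuous f -> continuous g ->
  continuous (fun z => f z + g z : R[i]^o).
Proof. by move=> cf cg z; apply: cvgD; [exact: cf | exact: cg]. Qed.

Lemma continuous_mul f g : continuous f -> continuous g ->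
  continuous (fun z => f z * g z : R[i]^o).
Proof. by move=> cf cg z; apply: cvgM; [exact: cf | exact: cg]. Qed.

Lemma continuous_cst (c : R[i]) : continuous (fun _ : Z => c : R[i]^o).
Proof. by move=> z; exact: cvg_cst. Qed.

Lemma continuous_fin_sum (I : finType) (F : I -> Z -> R[i]^o) :
  (forall i, continuous (F i)) -> continuous (fun z => \sum_i F i z : R[i]^o).
Proof.
move=> cF; rewrite (_ : (fun _ => _) = \sum_i F i); last first.
  by apply/funext => z; rewrite fct_sumE.
apply: (big_ind (fun f : Z -> R[i]^o => continuous f)) => //.
- exact: continuous_cst.
- by move=> f g cf cg; exact: continuous_add.
Qed.

Lemma continuous_cabs_lt f : 
  (forall z (e : R), 0 < e -> exists O : set Z, [/\ open O, O z &
     forall t, O t -> complex.Re `|f z - f t| < e]) -> continuous f.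
Proof.
move=> h z; apply/cvgrPdist_lt => eps eps0.
have eE : eps = (complex.Re eps)%:C%C by rewrite RRe_real ?gtr0_real.
have [|W [oW Wz hW]] := h z (complex.Re eps); first by rewrite -ltcR -eE.
have : nbhs z W by exact: open_nbhs_nbhs.
apply: filterS => t /hW; rewrite -ltcR -eE RRe_real //.
Qed.

Lemma cabs_lt_open f z (e : R) : continuous f -> 0 < e ->
  exists O : set Z, [/\ open O, O z & forall t,
    O t -> complex.Re `|f z - f t| < e].
Proof.
move=> cf e0; have := cf z => /cvgrPdist_lt /(_ e%:C); rewrite ltcR => /(_ e0).
move=> h; have : nbhs z [set t | `|f z - f t| < e%:C] by exact: h.
rewrite nbhsE => -[W [oW Wz] hW]; exists W; split=> // t /hW /=.
by rewrite -[X in X < _ -> _]RRe_real // ltcR.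
Qed.

Lemma continuous_conj f : continuous f -> continuous (fun z =>
  (f z)^* : R[i]^o).
Proof.
move=> cf; apply: continuous_cabs_lt => z e e0.
have [W [oW Wz h]] := cabs_lt_open z cf e0; exists W; split=> // t /h.
by rewrite -rmorphB norm_conjC.
Qed.

End ContinuousComplex.

Lemma cont_fst (U V : topologicalType) : continuous (@fst U V).
Proof. by move=> p; exact: cvg_fst. Qed.

Lemma cont_snd (U V : topologicalType) : continuous (@snd U V).
Proof. by move=> p; exact: cvg_snd. Qed.

Section MatrixFunctions.
Variables (R : realType) (Y : topologicalType) (s : Y -> Y) (E : nat -> Y ->
  bool).
Variable N0 : nat.
Hypothesis cs : colour_system s E N0.
Local Open Scope complex_scope.
Local Open Scope ring_scope.

Notation K n L := {ffun 'I_n.+1 * 'I_L -> bool}.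
Notation mat n L := (K n L -> K n L -> R[i]).
Notation mfun n L := (Y -> mat n L).

Definition mcont n L (m : mfun n L) :=
  forall k l, continuous (fun w => m w k l : R[i]^o).

(* The entry [m w k l] only matters if [w] has preimages under [iter n s] of
   itineraries [k] and [l]; hence the restricted sum in [mmul]. *)
Definition fun_of n L (m : mfun n L) (p : Y * Y) : R[i] :=
  if iter n s p.1 == iter n s p.2
  then m (iter n s p.1) (itin s E n L p.1) (itin s E n L p.2) else 0.

Definition mstar n L (m : mfun n L) : mfun n L := fun w k l => (m w l k)^*.

Definition mmul n L (m m' : mfun n L) : mfun n L := fun w k l =>
  \sum_(j | in_fibre s E j w) m w k j * m' w j l.

Lemma fun_of_lin n L (c : R[i]) (m m' : mfun n L) :
  (fun p => c * fun_of m p + fun_of m' p) =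
  fun_of (fun w k l => c * m w k l + m' w k l).
Proof. by apply/funext => p; rewrite /fun_of; case: eqP => // _;
  rewrite mulr0 addr0. Qed.

Lemma fun_of_star n L (m : mfun n L) :
  tail_star (fun_of m) = fun_of (mstar m).
Proof.
apply/funext => p; rewrite /tail_star /fun_of /= eq_sym.
by case: eqP => [->|_] //; rewrite conjC0.
Qed.

Definition fibre_seq n L w : seq Y :=
  [seq fibre_pt s E k w | k <- enum [pred k : K n L | in_fibre s E k w]].

Lemma mem_fibre_seq n L w z : (N0 <= L)%N ->
  (z \in fibre_seq n L w) = (iter n s z == w).
Proof.
move=> NL; apply/mapP/eqP => [[k]|zw].
  by rewrite mem_enum => /(fibre_ptP)[_ kw] ->.
exists (itin s E n L z); first by rewrite mem_enum;
  have := in_fibre_itin s E n L z; rewrite zw.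
by rewrite -zw (fibre_pt_itin cs).
Qed.

Lemma fibre_seq_uniq n L w : uniq (fibre_seq n L w).
Proof.
rewrite map_inj_in_uniq ?enum_uniq // => k l; rewrite !mem_enum => kw lw e.
by rewrite -(fibre_ptP kw).1 e (fibre_ptP lw).1.
Qed.

(** Convolution sums run over a whole tail class, possibly infinite; the summand vanishes off the
    fibre of w, which the words present above w list without repetition. *)
Lemma sum_fibre n L (A : set Y) (w : Y) (F : Y -> R[i]) : (N0 <= L)%N ->
  [set z | iter n s z = w] `<=` A ->
  (forall z, F z != 0 -> iter n s z = w) ->
  \sum_(z \in A) F z = \sum_(k : K n L | in_fibre s E k w) F (fibre_pt s E k w).
Proof.
move=> NL BA Fw.
rewrite -(@fsbig_widen _ _ _ _ [set` fibre_seq n L w] A).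
- by rewrite -fsbig_seq ?fibre_seq_uniq // big_map big_enum.
- by move=> z /=; rewrite mem_fibre_seq // => /eqP ?; exact: BA.
- move=> z [_ /= /negP]; rewrite mem_fibre_seq // => zw.
  by apply/eqP/negPn/negP => /Fw /eqP; rewrite (negbTE zw).
Qed.

(** Expressed through words, the number of preimages is seen to be locally constant in [w]. *)
Lemma preimage_card_fibre L w : (N0 <= L)%N ->
  preimage_card s w = #|[pred k : K 1 L | in_fibre s E k w]|.
Proof.
move=> NL; rewrite /preimage_card.
have -> : s @^-1` [set w] = [set` [fset z in fibre_seq 1 L w]%fset].
  by apply/seteqP; split=> z /=; rewrite inE /= mem_fibre_seq // => /eqP.
by rewrite set_fsetK card_fseq undup_id ?fibre_seq_uniq // size_map -cardE.
Qed.

Lemma fun_of_conv n L (m m' : mfun n L) : (N0 <= L)%N ->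
  tail_conv setT s (fun_of m) (fun_of m') = fun_of (mmul m m').
Proof.
move=> NL; apply/funext => -[x y]; rewrite /tail_conv /=.
rewrite (@sum_fibre n L _ (iter n s x)) //; last 2 first.
- move=> z /= zx; by exists n => //; split=> //=; rewrite zx.
- move=> z; rewrite /fun_of /=; case: (iter n s x =P _) => [-> //|_].
  by rewrite mul0r eqxx.
rewrite [RHS]/fun_of /= /mmul; case: eqP => xy.
  apply: eq_bigr => k /fibre_ptP[kk kw]; rewrite /fun_of /= kw xy eqxx.
  by rewrite -xy kk.
apply: big1 => k /fibre_ptP[kk kw]; rewrite /fun_of /= kw eqxx.
by case: eqP => // _; rewrite mulr0.
Qed.

Lemma mcont_mstar n L (m : mfun n L) : mcont m -> mcont (mstar m).
Proof. by move=> cm k l; exact: continuous_conj. Qed.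

Lemma continuous_in_fibre n L (j : K n L) :
  continuous (fun w => (in_fibre s E j w)%:R : R[i]^o).
Proof.
apply: continuous_loc_const.
exact: (loc_const_app (fun b : bool => b%:R : R[i]^o) (loc_const_in_fibre cs
  j)).
Qed.

Lemma mcont_mmul n L (m m' : mfun n L) : mcont m -> mcont m' ->
  mcont (mmul m m').
Proof.
move=> cm cm' k l; rewrite /mmul.
rewrite (_ : (fun _ => _) =
  (fun w => \sum_j ((in_fibre s E j w)%:R * (m w k j * m' w j l)) : R[i]^o)).
  apply: continuous_fin_sum => j; apply: continuous_mul;
    first exact: continuous_in_fibre.
  exact: continuous_mul.
apply/funext => w; rewrite big_mkcond; apply: eq_bigr => j _.
by case: in_fibre; rewrite ?mul1r ?mul0r.
Qed.

Let hY := colour_hausdorff cs.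
Let sc := colour_cont cs.

Lemma colour_tail_inj x y : colour E N0 x = colour E N0 y -> s x = s y -> x = y.
Proof. by move=> /colourP; exact: (colour_inj cs). Qed.

Lemma tail_Cc_fun_of n L (m : mfun n L) : mcont m -> tail_Cc setT s (fun_of m).
Proof.
move=> cm.
apply: (@tail_CcI R Y setT s _ (colour E N0) (colour_compact cs) hY closedT sc
  (loc_const_colour cs (L := N0)) colour_tail_inj _ n).
  by move=> p; rewrite /fun_of; case: (iter n s p.1 =P _) => [h _|];
    [split|rewrite eqxx].
move=> W oW.
pose k2 (p : Y * Y) := (itin s E n L p.1, itin s E n L p.2).
have lk2 : loc_const k2.
  apply: loc_const_pair.
    exact: (loc_const_comp (@cont_fst Y Y) (loc_const_itin cs (n := n) (L :=
      L))).
  exact: (loc_const_comp (@cont_snd Y Y) (loc_const_itin cs (n := n) (L := L))).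
exists (\bigcup_(kl : K n L * K n L) ((k2 @^-1` [set kl]) `&`
   ((fun p => m (iter n s p.1) kl.1 kl.2 : R[i]^o) @^-1` W))).
split.
  apply: bigcup_open => kl _; apply: openI; first exact: lk2.
  apply: open_comp => // p _.
  apply: (@continuous_comp _ _ _ (fun p : Y * Y => iter n s p.1)
    (fun w => m w kl.1 kl.2 : R[i]^o)); last exact: cm.
  by apply: (continuous_comp (f := fst));
    [exact: cvg_fst | exact: (cont_iter cs)].
move=> p [_ _ e]; rewrite /fun_of e eqxx; split=> [Wp|[kl _ [/= <-]]] //=;
  last by rewrite e.
by exists (k2 p) => //; split=> //=; rewrite e.
Qed.

(** The level n0 bounds the support. An entry is the value of f at the two points with the given
    words, and 0 when one of the words is absent. *)
Lemma fun_of_tail_Cc f : tail_Cc setT s f -> exists n0, forall n L,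
  (n0 <= n)%N ->
  (N0 <= L)%N -> exists m : mfun n L, mcont m /\ f = fun_of m.
Proof.
move=> cf.
have [n0 sf] := tail_Cc_supp sc (loc_const_colour cs (L :=
  N0)) colour_tail_inj cf.
exists n0 => n L n0n NL.
exists (fun w k l => if in_fibre s E k w && in_fibre s E l w then f (fibre_pt s
  E k w, fibre_pt s E l w) else 0).
split; last first.
  apply/funext => -[x y]; rewrite /fun_of /=; case: eqP => [e|ne].
    by rewrite in_fibre_itin {1}e in_fibre_itin /= (fibre_pt_itin cs) // e
      (fibre_pt_itin cs).
  apply/eqP/negPn/negP => /sf /(tail_relation_atS n0n)[_ _ /=] e; exact: ne.
(* Continuity is tested on a closed set C: where both words are present, the preimage of C is the
   image of the compact set Z of pairs in R_n with itineraries k, l and value in C. *)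
move=> k l; apply/continuous_closedP => C cC.
pose Z := [set p : Y * Y | [/\ iter n s p.1 = iter n s p.2,
   itin s E n L p.1 = k, itin s E n L p.2 = l & C (f p)]].
have cZ : compact Z.
  have [V [oV VP]] := tail_Cc_trace n cf (closed_openC cC).
  have -> : Z = tail_relation_at setT s n `&` ((fst @^-1` (itin s E n L @^-1`
    [set k]))
    `&` (snd @^-1` (itin s E n L @^-1` [set l]))) `&` ~` V.
    apply/seteqP; split=> p.
      move=> [e kp lp Cp]; have pn : tail_relation_at setT s n p by split.
      by split; [split|move=> /(VP p pn)].
    move=> [[pn [kp lp]] nV]; have [_ _ e] := pn; split=> //.
    by apply: contrapT => nC; apply: nV; apply/(VP p pn).
  apply: subclosed_compact (compact_setX (colour_compact cs) (colour_compact
    cs)) _ => //.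
  have ck t := (loc_const_clopen [set t] (loc_const_itin cs (n := n) (L :=
    L))).2.
  apply: closedI; last exact: open_closedC.
  apply: closedI; first exact: RN_closed.
  by apply: closedI; apply: preimage_closed (ck _) => p _;
    [exact: cvg_fst|exact: cvg_snd].
have -> : (fun w : Y => if in_fibre s E k w &&
  in_fibre s E l w then f (fibre_pt s E k w, fibre_pt s E l w)
   else 0) @^-1` C = ((fun p : Y * Y => iter n s p.1) @` Z) `|`
    ((fun w => in_fibre s E k w && in_fibre s E l w) @^-1` [set b | ~~ b /\
      C 0]).
  apply/seteqP; split=> w /=.
    case: ifPn => [/andP[kw lw] Cf|nw C0]; last by right; split.
    left; exists (fibre_pt s E k w, fibre_pt s E l w);
      last exact: (fibre_ptP kw).2.
    by split=> //=; rewrite ?(fibre_ptP kw).1 ?(fibre_ptP lw).1 ?(fibre_ptP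
      kw).2 ?(fibre_ptP lw).2.
  move=> [[[x y] [/= e <- <- Cf] <-]|[/negbTE -> //]].
  by rewrite in_fibre_itin {1}e in_fibre_itin /= (fibre_pt_itin cs) // e
    (fibre_pt_itin cs).
apply: closedU.
  apply: compact_closed => //; apply: continuous_compact cZ.
  apply: continuous_subspaceT => p.
  by apply: (continuous_comp (f := fst));
    [exact: cvg_fst | exact: (cont_iter cs)].
apply: (loc_const_clopen _ _).2.
exact: (loc_const_app (fun b : bool * bool => b.1 && b.2)
  (loc_const_pair (loc_const_in_fibre cs k) (loc_const_in_fibre cs l))).
Qed.

End MatrixFunctions.

(** * Norm estimates *)

Section ComplexModulus.
Variable R : realType.
Local Open Scope complex_scope.
Local Open Scope ring_scope.
Implicit Types x y : R[i].

Definition cabs x : R := complex.Re `|x|.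

Lemma cabsE x : `|x| = (cabs x)%:C.
Proof. by rewrite /cabs RRe_real. Qed.

Lemma cabs_ge0 x : 0 <= cabs x.
Proof. by rewrite -ler0c -cabsE. Qed.

Lemma cabsD x y : cabs (x + y) <= cabs x + cabs y.
Proof. by rewrite -lecR rmorphD /= -!cabsE ler_normD. Qed.

Lemma cabs_real (a : R) : cabs a%:C = `|a|.
Proof. by apply: (@complexI R); rewrite -cabsE normc_def /= expr0n /= addr0
  sqrtr_sqr. Qed.

Lemma cabs_sq x : (cabs x ^+ 2)%:C = x^* * x.
Proof. by rewrite rmorphXn /= -cabsE normCKC. Qed.

Lemma cabs0 : cabs 0 = 0.
Proof. by rewrite /cabs normr0. Qed.

Lemma cabs1 : cabs 1 = 1.
Proof. by rewrite /cabs normr1. Qed.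

Lemma cabsN x : cabs (- x) = cabs x.
Proof. by rewrite /cabs normrN. Qed.

Lemma cabsB x y : cabs (x - y) = cabs (y - x).
Proof. by rewrite /cabs distrC. Qed.

Lemma cnormZ_cabs (A : cstarAlgType R) x (a : A) :
  cnorm (x *: a) = cabs x * cnorm a.
Proof. exact: cnormZ. Qed.

Lemma Re_le_cabs x : `|complex.Re x| <= cabs x.
Proof. by rewrite -lecR -cabsE; exact: normc_ge_Re. Qed.

(** If 0 < y < x, Bernoulli's inequality makes (x / y) ^ (2 ^ j) unbounded in j. The exponents 2 ^ j
    are those produced by repeated squaring, which the C*-identity controls. *)
Lemma pow2_le (x y C : R) : 0 <= x -> 0 <= y ->
  (forall j, x ^+ (2 ^ j) <= C * y ^+ (2 ^ j)) -> x <= y.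
Proof.
move=> x0 y0 h; rewrite leNgt; apply/negP => yx.
have [ye|yn] := eqVneq y 0.
  have := h 0%N; rewrite expn0 !expr1 ye mulr0 => xl.
  by move: yx; rewrite ye ltNge xl.
have yp : 0 < y by rewrite lt0r yn y0.
pose d := x / y - 1.
have dp : 0 < d by rewrite subr_gt0 ltr_pdivlMr // mul1r.
have bern p : 1 + p%:R * d <= (1 + d) ^+ p.
  elim: p => [|p IH]; first by rewrite expr0 mul0r addr0.
  rewrite exprS; apply: le_trans (_ : (1 + d) * (1 + p%:R * d) <= _);
    last first.
    by rewrite ler_wpM2l // addr_ge0 // ltW.
  rewrite -natr1; have : 0 <= p%:R * d * d by rewrite !mulr_ge0 // ltW.
  by nra.
have hd j : (2 ^ j)%:R * d <= C.
  have := h j; rewrite -ler_pdivrMr ?exprn_gt0 // -expr_div_n.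
  rewrite (_ : x / y = 1 + d); last by rewrite /d addrC subrK.
  by move=> /(le_trans (bern _)); lra.
have [j jC] : exists j : nat, C / d < j%:R.
  exists (Num.bound `|C / d|); apply: le_lt_trans (ler_norm _) _.
  by apply: archi_boundP.
have : C < (2 ^ j)%:R * d.
  rewrite -ltr_pdivrMr //; apply: lt_le_trans jC _.
  by rewrite ler_nat; exact/ltnW/ltn_expl.
by rewrite ltNge hd.
Qed.

End ComplexModulus.

Section RealComplexContinuity.
Variables (R : realType) (Z : topologicalType).
Local Open Scope complex_scope.
Local Open Scope ring_scope.

Lemma continuous_real_complex (h : Z -> R) :
  continuous h -> continuous (fun z => (h z)%:C : R[i]^o).
Proof.
move=> ch; apply: continuous_cabs_lt => z e e0.
have : nbhs z [set t | `|h z - h t| < e].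
  by have := ch z => /cvgrPdist_lt; apply.
rewrite nbhsE => -[W [oW Wz] hW]; exists W; split=> // t /hW.
by rewrite -rmorphB; have := cabs_real (h z - h t); rewrite /cabs => ->.
Qed.

Lemma continuous_Re (f : Z -> R[i]^o) :
  continuous f -> continuous (fun z => complex.Re (f z)).
Proof.
move=> cf z; apply/cvgrPdist_lt => e e0.
have [W [oW Wz h]] := cabs_lt_open z cf e0.
have : nbhs z W by exact: open_nbhs_nbhs.
apply: filterS => t /h; apply: le_lt_trans.
by have := Re_le_cabs (f z - f t); rewrite raddfB.
Qed.

End RealComplexContinuity.

Section NormEstimates.
Variables (R : realType) (Y : topologicalType) (s : Y -> Y) (E : nat -> Y ->
  bool).
Variable N0 : nat.
Hypothesis cs : colour_system s E N0.
Variables (F : cstarAlgType R) (iota : (Y * Y -> R[i]) -> F).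
Hypothesis Fs : tail_cstar_completion setT s iota.
Local Open Scope complex_scope.
Local Open Scope ring_scope.
Notation K n L := {ffun 'I_n.+1 * 'I_L -> bool}.
Notation mat n L := (K n L -> K n L -> R[i]).
Notation mfun n L := (Y -> mat n L).

Lemma fun_of_ext n L (m m' : mfun n L) :
  (forall w k l, in_fibre s E k w -> in_fibre s E l w -> m w k l = m' w k l) ->
  fun_of s E m = fun_of s E m'.
Proof.
move=> h; apply/funext => p; rewrite /fun_of; case: eqP => // e.
by apply: h; [exact: in_fibre_itin | rewrite e; exact: in_fibre_itin].
Qed.

Section FixedLevel.
Variables (n L : nat).
Hypothesis NL : (N0 <= L)%N.
Implicit Types m : mfun n L.

(* [C(R_n)] inside [F], in matrix form. *)
Definition rho m : F := iota (fun_of s E m).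

Let Cc m : mcont m -> tail_Cc setT s (fun_of s E m).
Proof. exact: (tail_Cc_fun_of cs). Qed.

Lemma rho_lin (c : R[i]) m m' : mcont m -> mcont m' ->
  rho (fun w k l => c * m w k l + m' w k l) = c *: rho m + rho m'.
Proof.
move=> cm cm'; have [h _ _ _ _] := Fs.
by rewrite /rho -(h _ _ _ (Cc cm) (Cc cm')) fun_of_lin.
Qed.

Lemma rho_mul m m' : mcont m -> mcont m' ->
  rho (mmul s E m m') = cmul (rho m) (rho m').
Proof.
move=> cm cm'; have [_ h _ _ _] := Fs.
by rewrite /rho -(h _ _ (Cc cm) (Cc cm')) (fun_of_conv cs _ _ NL).
Qed.

Lemma rho_star m : mcont m -> rho (mstar m) = cstar (rho m).
Proof.
move=> cm; have [_ _ h _ _] := Fs.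
by rewrite /rho -(h _ (Cc cm)) fun_of_star.
Qed.

Lemma rho_ext m m' :
  (forall w k l, in_fibre s E k w -> in_fibre s E l w -> m w k l = m' w k l) ->
  rho m = rho m'.
Proof. by move=> /fun_of_ext; rewrite /rho => ->. Qed.

Lemma mcont_lin (c : R[i]) m m' : mcont m -> mcont m' ->
  mcont (fun w k l => c * m w k l + m' w k l).
Proof.
move=> cm cm' k l; apply: continuous_add; last exact: cm'.
by apply: continuous_mul; [exact: continuous_cst | exact: cm].
Qed.

Lemma mcont_cst (A : mat n L) : mcont ((fun _ => A) : mfun n L).
Proof. by move=> k l; exact: continuous_cst. Qed.

Lemma rho_add m m' : mcont m -> mcont m' ->
  rho (fun w k l => m w k l + m' w k l) = rho m + rho m'.
Proof.
move=> cm cm'; rewrite -[rho m]scale1r -(rho_lin 1 cm cm').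
by apply: rho_ext => *; rewrite mul1r.
Qed.

Lemma rho0 : rho (fun _ _ _ => 0) = 0.
Proof.
have c0 : mcont ((fun _ _ _ => 0) : mfun n L) by exact: mcont_cst.
apply: (addIr (rho (fun _ _ _ => 0))); rewrite add0r -(rho_add c0 c0).
by apply: rho_ext => *; rewrite addr0.
Qed.

Lemma rho_scale (c : R[i]) m : mcont m ->
  rho (fun w k l => c * m w k l) = c *: rho m.
Proof.
have c0 : mcont ((fun _ _ _ => 0) : mfun n L) by exact: mcont_cst.
move=> cm; rewrite -[RHS]addr0 -rho0 -(rho_lin c cm c0).
by apply: rho_ext => *; rewrite addr0.
Qed.

Lemma rho_sum (I : finType) (m : I -> mfun n L) : (forall i, mcont (m i)) ->
  rho (fun w k l => \sum_i m i w k l) = \sum_i rho (m i).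
Proof.
move=> cm.
suff [] : rho (fun w k l => \sum_i m i w k l) = \sum_i rho (m i) /\
   mcont (fun w k l => \sum_i m i w k l) by [].
have -> : (fun w k l => \sum_i m i w k l) =
  \sum_i ((fun w k l => m i w k l) : Y -> K n L -> K n L -> R[i]).
  by apply/funext => w; apply/funext => k; apply/funext => l; rewrite !fct_sumE.
apply: (big_ind2 (fun (x : mfun n L) y => rho x = y /\ mcont x)).
- by split; [exact: rho0 | exact: mcont_cst].
- move=> x1 x2 y1 y2 [<- cx] [<- cy]; split; first exact: rho_add.
  by move=> k l; apply: continuous_add; [exact: cx | exact: cy].
- by move=> i _; split=> //; exact: cm.
Qed.

Definition munit (h : Y -> R[i]) (k l : K n L) : mfun n L :=
  fun w k' l' => if (k' == k) && (l' == l) then h w else 0.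

Lemma mcont_munit (h : Y -> R[i]) k l :
  continuous (h : Y -> R[i]^o) -> mcont (munit h k l).
Proof.
move=> ch k' l'; rewrite /munit.
by case: ((k' == k) && (l' == l)); [exact: ch | exact: continuous_cst].
Qed.

Lemma mstar_munit h k l : mstar (munit h k l) = munit (fun w => (h w)^*) l k.
Proof.
apply/funext => w; apply/funext => k'; apply/funext => l'.
by rewrite /mstar /munit andbC; case: ifP => // _; rewrite conjC0.
Qed.

Lemma mmul_munit h h' k j l : mmul s E (munit h k j) (munit h' j l) =
  munit (fun w => (in_fibre s E j w)%:R * (h w * h' w)) k l.
Proof.
apply/funext => w; apply/funext => k'; apply/funext => l'.
rewrite /mmul /munit big_mkcond (bigD1 j) //= big1 ?addr0 => [|i /negbTE ij];
  last first.
  by rewrite ij andbF mul0r if_same.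
rewrite eqxx andbT; case: (k' == k); case: (l' == l); case: in_fibre => //=;
  by rewrite ?mul1r ?mul0r ?mulr0.
Qed.

Lemma munit_sum m : m = fun w k l => \sum_(p : K n L * K n L) munit (fun w =>
  m w p.1 p.2) p.1 p.2 w k l.
Proof.
apply/funext => w; apply/funext => k; apply/funext => l.
rewrite (bigD1 (k, l)) //= /munit !eqxx /= big1 ?addr0 // => -[i j] /=.
by rewrite xpair_eqE [i == k]eq_sym [j == l]eq_sym => /negbTE ->.
Qed.

Lemma rho_unit_idem l : cnorm (rho (munit (fun _ => 1) l l)) <= 1.
Proof.
set P := rho _.
have c1 : continuous (fun _ : Y => 1 : R[i]^o) by exact: continuous_cst.
have c1' : continuous (fun _ : Y => 1^* : R[i]^o) by exact: continuous_cst.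
have PP : cmul (cstar P) P = P.
  rewrite -(rho_star (@mcont_munit _ l l c1)) mstar_munit.
  rewrite -(rho_mul (@mcont_munit _ l l c1') (@mcont_munit _ l l c1))
    mmul_munit.
  apply: rho_ext => w k j kw jw; rewrite /munit.
  by case: ifP => // /andP[/eqP kl _]; rewrite -kl kw conjC1 !mul1r.
have := cnorm_star_sq P; rewrite PP => e.
have [->|p0] := eqVneq (cnorm P) 0; first exact: ler01.
have pp : 0 < cnorm P by rewrite lt0r p0 cnorm_ge0.
by rewrite -(ler_pM2r pp) mul1r -expr2 -e.
Qed.

(* With [v = h + i sqrt (1 - h ^ 2)] one has [v^* v = 1] on the corner, and [h]
   is the real part of [v]. *)
Lemma rho_diag_le1 (h : Y -> R) l : continuous h -> (forall w, `|h w| <= 1) ->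
  cnorm (rho (munit (fun w => (h w)%:C) l l)) <= 1.
Proof.
move=> ch h1.
pose g w := Num.sqrt (1 - h w ^+ 2).
have cg : continuous g.
  move=> w; apply: (@continuous_comp _ _ _ (fun w => 1 - h w ^+ 2));
    last exact: sqrt_continuous.
  by apply: cvgB; [exact: cvg_cst | apply: cvgM; exact: ch].
have g2 w : g w ^+ 2 = 1 - h w ^+ 2.
  rewrite sqr_sqrtr // subr_ge0 -[h w ^+ 2]ger0_norm ?sqr_ge0 // normrX.
  by rewrite exprn_ile1.
pose v w : R[i] := h w +i* g w.
have vE w : v w = (h w)%:C + 'i * (g w)%:C by rewrite {1}[v w]complexE.
have cv : continuous (v : Y -> R[i]^o).
  rewrite (_ : v = (fun w => (h w)%:C + 'i * (g w)%:C)); last exact/funext.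
  apply: continuous_add; first exact: continuous_real_complex.
  apply: continuous_mul; first exact: continuous_cst.
  exact: continuous_real_complex.
have vv w : (v w)^* * v w = 1.
  rewrite -cabs_sq /cabs normc_def /= sqr_sqrtr ?addr_ge0 ?sqr_ge0 // g2.
  by rewrite addrC subrK.
have cv' : continuous (fun w => (v w)^* : R[i]^o) by exact: continuous_conj.
have muv := @mcont_munit _ l l cv; have muv' := @mcont_munit _ l l cv'.
set V := rho (munit v l l).
have V1 : cnorm V <= 1.
  rewrite -(@ler_pXn2r _ 2) ?nnegrE ?cnorm_ge0 // expr1n -cnorm_star_sq.
  rewrite -(rho_star muv) mstar_munit -(rho_mul muv' muv) mmul_munit.
  rewrite (rho_ext (m' := munit (fun=> 1) l l)); first exact: rho_unit_idem.
  move=> w k j kw jw; rewrite /munit.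
  by case: ifP => // /andP[/eqP kl _]; rewrite -kl kw vv mul1r.
have -> : rho (munit (fun w => (h w)%:C) l l) = (2^-1 : R)%:C *: (V + cstar V).
  rewrite -(rho_star muv) mstar_munit -(rho_add muv muv').
  have muv2 : mcont (fun w k j => munit v l l w k j + munit (fun w =>
    (v w)^*) l l w k j).
    by move=> k j; apply: continuous_add; [exact: muv | exact: muv'].
  rewrite -(rho_scale _ muv2); apply: rho_ext => w k j _ _.
  rewrite /munit; case: ifP => _; last by rewrite addr0 mulr0.
  have -> : v w + (v w)^* = ((h w) * 2)%:C.
    rewrite -[(v w)^*]/(h w -i* g w); apply/eqP.
    by rewrite eq_complex /= subrr eqxx andbT mulr_natr.
  by rewrite -rmorphM /= mulrC mulfK.
rewrite cnormZ_cabs cabs_real ger0_norm; last by lra.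
have := cnormD V (cstar V); rewrite cnorm_star; lra.
Qed.

(** The C*-identity trades the entry (k, l) for the diagonal entry |h|^2 at (l, l), restricted to
    the points where k is present; divided by M ^ 2 this is a real function covered by
    [rho_diag_le1]. *)
Lemma rho_munit_le (h : Y -> R[i]) (M : R) k l :
  continuous (h : Y -> R[i]^o) -> 0 < M -> (forall w, cabs (h w) <= M) ->
  cnorm (rho (munit h k l)) <= M.
Proof.
move=> ch M0 hM.
rewrite -(@ler_pXn2r _ 2) ?nnegrE ?cnorm_ge0 ?(ltW M0) // -cnorm_star_sq.
pose f w : R[i] := (in_fibre s E k w)%:R * ((h w)^* * h w).
have cf : continuous (f : Y -> R[i]^o).
  apply: continuous_mul; first exact: (continuous_in_fibre cs).
  by apply: continuous_mul; [exact: continuous_conj | exact: ch].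
have ch' : continuous (fun w => (h w)^* : R[i]^o) by exact: continuous_conj.
rewrite -(rho_star (@mcont_munit _ k l ch)) mstar_munit.
rewrite -(rho_mul (@mcont_munit _ l k ch') (@mcont_munit _ k l ch)) mmul_munit
  -/f.
pose g w : R := complex.Re (f w) / M ^+ 2.
have fE w : f w = ((in_fibre s E k w)%:R * cabs (h w) ^+ 2)%:C.
  by rewrite /f -cabs_sq; case: in_fibre; rewrite ?mul1r ?mul0r.
have cg : continuous g.
  by move=> w; apply: cvgM; [exact: continuous_Re | exact: cvg_cst].
rewrite (rho_ext (m' := fun w i j => (M ^+ 2)%:C * munit (fun w =>
  (g w)%:C) l l w i j)).
  rewrite (rho_scale _ (@mcont_munit _ l l (continuous_real_complex cg))).
  rewrite cnormZ_cabs cabs_real ger0_norm ?sqr_ge0 //.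
  rewrite -[X in _ <= X]mulr1 ler_pM2l ?exprn_gt0 //;
    apply: rho_diag_le1 => // w.
  rewrite /g fE /= ger0_norm; last by rewrite divr_ge0 ?sqr_ge0 // mulr_ge0
    ?sqr_ge0.
  rewrite ler_pdivrMr ?exprn_gt0 // mul1r.
  apply: le_trans (_ : cabs (h w) ^+ 2 <= _).
    by case: in_fibre; rewrite ?mul1r ?mul0r ?sqr_ge0.
  by rewrite ler_pXn2r ?nnegrE ?cabs_ge0 ?(ltW M0).
move=> w i j _ _; rewrite /munit; case: ifP => _; last by rewrite mulr0.
rewrite -rmorphM /g mulrCA divff ?mulr1 ?expf_neq0 ?gt_eqF //.
by rewrite fE.
Qed.

Lemma rho_le m (M : R) : mcont m -> 0 < M ->
  (forall w k l, cabs (m w k l) <= M) ->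
  cnorm (rho m) <= #|{: K n L * K n L}|%:R * M.
Proof.
move=> cm M0 mM.
have cu p : mcont (munit (fun w => m w p.1 p.2) p.1 p.2) by apply: mcont_munit;
  exact: cm.
rewrite [X in rho X]munit_sum (rho_sum cu).
apply: le_trans (cnorm_sum _ _ _) _.
apply: le_trans (_ : \sum_(p : K n L * K n L) M <= _).
  by apply: ler_sum => p _; exact: rho_munit_le.
by rewrite sumr_const mulr_natl; exact: lexx.
Qed.

(** Entries at absent words are unconstrained, whereas [rho_le] asks for a bound on all entries;
    setting them to 0 leaves [rho m] unchanged. *)
Definition mcut m : mfun n L := fun w k l =>
  if in_fibre s E k w && in_fibre s E l w then m w k l else 0.

Lemma mcont_mcut m : mcont m -> mcont (mcut m).
Proof.
move=> cm k l; rewrite (_ : (fun _ => _) = (fun w =>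
  (in_fibre s E k w)%:R * ((in_fibre s E l w)%:R * m w k l) : R[i]^o)).
  do 2 (apply: continuous_mul; first exact: (continuous_in_fibre cs)).
  exact: cm.
by apply/funext => w; rewrite /mcut; do 2 case: in_fibre; rewrite ?mul1r ?mul0r.
Qed.

Lemma rho_mcut m : rho (mcut m) = rho m.
Proof. by apply: rho_ext => w k l kw lw; rewrite /mcut kw lw. Qed.

(* [M] bounds the l^2 operator norms of the matrices [m w]. *)
Definition op_bound m (M : R) := forall w (xi : K n L -> R[i]),
  \sum_(k | in_fibre s E k w) cabs (\sum_(l | in_fibre s E l w) m w k l * xi l)
    ^+ 2 <=
  M ^+ 2 * \sum_(l | in_fibre s E l w) cabs (xi l) ^+ 2.

Lemma op_bound_mmul m m' M M' : op_bound m M -> op_bound m' M' ->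
  op_bound (mmul s E m m') (M * M').
Proof.
move=> h h' w xi.
pose eta j := \sum_(l | in_fibre s E l w) m' w j l * xi l.
apply: le_trans (_ : _ <= M ^+ 2 * \sum_(l | in_fibre s E l w) cabs (eta l) ^+
  2) _.
  apply: le_trans (h w eta); apply: ler_sum => k kw.
  rewrite le_eqVlt; apply/orP; left; apply/eqP; congr (cabs _ ^+ 2).
  rewrite /mmul; under eq_bigr do rewrite mulr_suml.
  rewrite exchange_big /=; apply: eq_bigr => j _.
  by rewrite /eta mulr_sumr; apply: eq_bigr => l _; rewrite mulrA.
rewrite exprMn -[X in _ <= X]mulrA ler_wpM2l ?sqr_ge0 //.
exact: h'.
Qed.

Lemma op_bound_entry m M w k l : 0 <= M -> op_bound m M ->
  in_fibre s E k w -> in_fibre s E l w -> cabs (m w k l) <= M.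
Proof.
move=> M0 h kw lw; rewrite -(@ler_pXn2r _ 2) ?nnegrE ?cabs_ge0 //.
(* Tested on the basis vector at l, the bound controls the whole l-th column. *)
have := h w (fun j => (j == l)%:R).
rewrite [X in _ <= _ * X](bigD1 l) //= eqxx [X in _ * (_ + X)]big1 ?addr0;
  last first.
  by move=> j /andP[_ jl]; rewrite (negbTE jl) cabs0 expr0n.
rewrite cabs1 expr1n mulr1; apply: le_trans.
rewrite (bigD1 k) //= (bigD1 l) //= eqxx mulr1 [X in cabs (_ + X)]big1 ?addr0.
  by rewrite lerDl; apply: sumr_ge0 => i _; exact: sqr_ge0.
by move=> j /andP[_ jl]; rewrite (negbTE jl) mulr0.
Qed.

(* The factor lost in [rho_le] disappears on passing to the powers
   [rho m ^ (2 ^ j)]. *)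
Lemma selfadjoint_le m (M : R) : mcont m -> 0 < M -> cstar (rho m) = rho m ->
  op_bound m M -> cnorm (rho m) <= M.
Proof.
move=> cm M0 sm bm.
apply: (@pow2_le _ _ _ #|{: K n L * K n L}|%:R);
  [exact: cnorm_ge0 | exact: ltW |].
suff h j : exists m', [/\ mcont m', cstar (rho m') = rho m',
  op_bound m' (M ^+ (2 ^ j)) &
    cnorm (rho m') = cnorm (rho m) ^+ (2 ^ j)].
  move=> j; have [m' [cm' _ bm' <-]] := h j.
  rewrite -rho_mcut; apply: rho_le; [exact: mcont_mcut | by rewrite exprn_gt0
    |].
  move=> w k l; rewrite /mcut; case: ifP => [/andP[kw lw]|_].
    by apply: op_bound_entry bm' _ _ => //; rewrite exprn_ge0 // ltW.
  by rewrite cabs0 exprn_ge0 // ltW.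
elim: j => [|j [m' [cm' sm' bm' nm']]]; first by exists m; rewrite expn0 !expr1.
exists (mmul s E m' m'); split.
- exact: (mcont_mmul cs).
- by rewrite (rho_mul cm' cm') cstarM sm'.
- by rewrite expnS mulnC exprM expr2; exact: op_bound_mmul.
(* For selfadjoint x the C*-identity reads |x x| = |x|^2, so squaring loses nothing. *)
- rewrite (rho_mul cm' cm') -{1}sm' cnorm_star_sq nm' -exprM; congr (_ ^+ _).
  by rewrite expnS mulnC.
Qed.

End FixedLevel.
End NormEstimates.

(** * Diagonal projections and cyclic pieces *)

Section Diagonal.
Variables (R : realType) (Y : topologicalType) (s : Y -> Y).
Local Open Scope complex_scope.
Local Open Scope ring_scope.
Implicit Types (V W : Y -> bool) (f : Y * Y -> R[i]).

(** The projection written 1_V elsewhere: V is viewed as a part of the diagonal R_0, and convolution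
    with this function truncates a coordinate ([cutl], [cutr]). *)
Definition diag_ind V (p : Y * Y) : R[i] := if (p.1 == p.2) &&
  V p.1 then 1 else 0.

Definition cutl V f (p : Y * Y) : R[i] := if V p.1 then f p else 0.
Definition cutr V f (p : Y * Y) : R[i] := if V p.2 then f p else 0.

Definition on_tail (D : set Y) f := forall p, ~ tail_relation D s p -> f p = 0.

Lemma tail_refl (D : set Y) x : D x -> tail_relation D s (x, x).
Proof. by exists 0%N. Qed.

Lemma tail_conv_dgl V f : on_tail setT f -> tail_conv setT s (diag_ind V) f =
  cutl V f.
Proof.
move=> hf; apply/funext => -[x y]; rewrite /tail_conv /cutl /=.
rewrite -(@fsbig_widen _ _ _ _ [set x]).
- by rewrite fsbig_set1 /diag_ind /= eqxx /=; case: ifP; rewrite ?mul1r ?mul0r.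
- by move=> z /= ->; exact: tail_refl.
- move=> z [_ /= zx]; rewrite /diag_ind /=.
  by case: eqP => [xz|_]; [case: zx | rewrite mul0r].
Qed.

Lemma tail_conv_dgr V f : on_tail setT f -> tail_conv setT s f (diag_ind V) =
  cutr V f.
Proof.
move=> hf; apply/funext => -[x y]; rewrite /tail_conv /cutr /=.
have [xy|nxy] := pselect (tail_relation setT s (x, y)).
  rewrite -(@fsbig_widen _ _ _ _ [set y]).
  - by rewrite fsbig_set1 /diag_ind /= eqxx /=; case: ifP;
      rewrite ?mulr1 ?mulr0.
  - by move=> z /= ->.
  - move=> z [_ /= zy]; rewrite /diag_ind /=.
    by case: eqP => [yz|_]; [case: zy | rewrite mulr0].
rewrite hf // if_same; apply: fsbig1 => z /= xz.
rewrite /diag_ind /=; case: eqP => [zy|_]; last by rewrite mulr0.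
by case: nxy; rewrite -zy.
Qed.

Lemma tail_Cc_on f (D : set Y) : tail_Cc D s f -> on_tail D f.
Proof. by case. Qed.

Lemma tail_star_diag_ind V : tail_star (diag_ind V) = diag_ind V.
Proof.
apply/funext => -[x y]; rewrite /tail_star /diag_ind /= eq_sym.
by case: eqP => [->|_] /=; [case: ifP; rewrite ?conjC1 ?conjC0|rewrite conjC0].
Qed.

Lemma cutl_diag_ind V W : cutl V (diag_ind W) = diag_ind (fun x => V x && W x).
Proof.
by apply/funext => p; rewrite /cutl /diag_ind; case: V => //=; rewrite andbF.
Qed.

End Diagonal.

Section DiagonalElements.
Variables (R : realType) (Y : topologicalType) (s : Y -> Y) (E : nat -> Y ->
  bool).
Variable N0 : nat.
Hypothesis cs : colour_system s E N0.
Variables (F : cstarAlgType R) (iota : (Y * Y -> R[i]) -> F).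
Hypothesis Fs : tail_cstar_completion setT s iota.
Local Open Scope complex_scope.
Local Open Scope ring_scope.
Implicit Types (V W : Y -> bool) (f : Y * Y -> R[i]).

Lemma tail_Cc_diag_ind V : loc_const V -> tail_Cc setT s (diag_ind R V).
Proof.
move=> lV.
rewrite (_ : diag_ind R V = fun_of s E (fun w (k l : {ffun 'I_1 * 'I_N0 ->
  bool}) => (V w)%:R)).
  apply: (tail_Cc_fun_of cs) => k l; apply: continuous_loc_const.
  exact: (loc_const_app (fun b : bool => b%:R : R[i]^o) lV).
by apply/funext => p; rewrite /diag_ind /fun_of /=; case: eqP => //= _;
  case: (V _).
Qed.

Definition diag_pr V : F := iota (diag_ind R V).

Lemma tail_Cc_conv f g : tail_Cc setT s f -> tail_Cc setT s g ->
  tail_Cc setT s (tail_conv setT s f g).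
Proof.
move=> /(fun_of_tail_Cc cs)[n0 hf] /(fun_of_tail_Cc cs)[n1 hg].
have [m [cm ->]] := hf _ _ (leq_maxl n0 n1) (leqnn _).
have [m' [cm' ->]] := hg _ _ (leq_maxr n0 n1) (leqnn _).
rewrite (fun_of_conv cs _ _ (leqnn _)).
by apply: (tail_Cc_fun_of cs); exact: (mcont_mmul cs).
Qed.

Lemma tail_Cc_cutl V f : loc_const V -> tail_Cc setT s f ->
  tail_Cc setT s (cutl V f).
Proof.
move=> lV cf; rewrite -(tail_conv_dgl V (tail_Cc_on cf)).
by apply: tail_Cc_conv cf; exact: tail_Cc_diag_ind.
Qed.

Lemma diag_pr_mull V f : loc_const V -> tail_Cc setT s f ->
  cmul (diag_pr V) (iota f) = iota (cutl V f).
Proof.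
move=> lV cf; have [_ h _ _ _] := Fs.
by rewrite /diag_pr -(h _ _ (tail_Cc_diag_ind lV) cf) tail_conv_dgl //;
  exact: tail_Cc_on cf.
Qed.

Lemma diag_pr_mulr V f : loc_const V -> tail_Cc setT s f ->
  cmul (iota f) (diag_pr V) = iota (cutr V f).
Proof.
move=> lV cf; have [_ h _ _ _] := Fs.
by rewrite /diag_pr -(h _ _ cf (tail_Cc_diag_ind lV)) tail_conv_dgr //;
  exact: tail_Cc_on cf.
Qed.

Lemma diag_pr_mul V W : loc_const V -> loc_const W ->
  cmul (diag_pr V) (diag_pr W) = diag_pr (fun x => V x && W x).
Proof. by move=> lV lW; rewrite {2}/diag_pr diag_pr_mull ?cutl_diag_ind //;
  exact: tail_Cc_diag_ind. Qed.

Lemma diag_pr_star V : loc_const V -> cstar (diag_pr V) = diag_pr V.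
Proof.
move=> lV; have [_ _ h _ _] := Fs.
by rewrite /diag_pr -(h _ (tail_Cc_diag_ind lV)) tail_star_diag_ind.
Qed.

Lemma proj_norm_le1 (e : F) : cmul e e = e -> cstar e = e -> cnorm e <= 1.
Proof.
move=> ee se; have := cnorm_star_sq e; rewrite se ee => h.
have [->|p0] := eqVneq (cnorm e) 0; first exact: ler01.
have pp : 0 < cnorm e by rewrite lt0r p0 cnorm_ge0.
by rewrite -(ler_pM2r pp) mul1r -expr2 -h.
Qed.

Lemma diag_pr_idem V : loc_const V -> cmul (diag_pr V) (diag_pr V) = diag_pr V.
Proof. by move=> lV; rewrite diag_pr_mul //; congr diag_pr; apply/funext => x;
  rewrite andbb. Qed.

Lemma iota_dense (a : F) (e : R) : 0 < e ->
  exists2 f, tail_Cc setT s f & cnorm (a - iota f) < e.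
Proof.
move=> e0; have [_ _ _ _ d] := Fs.
have : [set: F] a by []; rewrite -d.
by move=> /closure_cnorm /(_ e e0) [_ [f cf <-]] h; exists f.
Qed.

(** Identities in [F] are reduced to C_c(R) by taking for [g] the difference of their two sides. *)
Lemma dense_eq0 (g : F -> F) (C : R) : (forall a b, g (a - b) = g a - g b) ->
  (forall a, cnorm (g a) <= C * cnorm a) ->
  (forall f, tail_Cc setT s f -> g (iota f) = 0) -> forall a, g a = 0.
Proof.
move=> gB gC g0 a; apply: cnorm_eq0; apply/eqP; rewrite eq_le cnorm_ge0 andbT.
apply/ler_addgt0Pl => e e0; rewrite addr0.
have C1 : 0 < `|C| + 1 by rewrite ltr_wpDl.
have [f cf fe] := iota_dense a (divr_gt0 e0 C1).
rewrite -[g a]subr0 -(g0 f cf) -gB; apply: le_trans (gC _) _.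
apply: le_trans (_ : (`|C| + 1) * cnorm (a - iota f) <= _).
  by rewrite ler_wpM2r ?cnorm_ge0 // ler_wpDr // ler_norm.
by rewrite mulrC -ler_pdivlMr // ltW.
Qed.

End DiagonalElements.

Section Pieces.
Variables (R : realType) (Y : topologicalType) (s : Y -> Y) (E : nat -> Y ->
  bool).
Variable N0 : nat.
Hypothesis cs : colour_system s E N0.
Variables (p : nat) (X : 'I_p -> set Y).
Hypotheses (X_disj : trivIset setT X) (X_cover : \bigcup_i X i = setT).
Hypothesis X_clopen : forall i, clopen (X i).
Hypothesis X_cyclic : forall i, s @` X i = X (ordS i).

Lemma piece_ex x : exists i, X i x.
Proof. by have : setT x by []; rewrite -X_cover => -[i _ Xi]; exists i. Qed.

Definition piece x : 'I_p := projT1 (cid (piece_ex x)).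

Lemma pieceP x i : X i x <-> piece x = i.
Proof.
have h : X (piece x) x := projT2 (cid (piece_ex x)).
split=> [Xi|<- //]; apply: (X_disj (i := piece x) (j := i)) => //.
by exists x.
Qed.

Lemma loc_const_piece : loc_const piece.
Proof.
move=> i; have [oX _] := X_clopen i; move: oX; congr open.
by apply/seteqP; split=> x /pieceP.
Qed.

Lemma piece_s x : piece (s x) = ordS (piece x).
Proof. by apply/pieceP; rewrite -X_cyclic; exists x => //; exact/pieceP. Qed.

Lemma piece_iter m x y : piece x = piece y <->
  piece (iter m s x) = piece (iter m s y).
Proof.
elim: m => // m IH; rewrite /= !piece_s IH; split=> [-> //|].
exact: (can_inj (@ordSK p)).
Qed.

Lemma piece_tail x y : tail_relation setT s (x, y) -> piece x = piece y.
Proof. by move=> [m _ [_ _ /= e]]; apply/(piece_iter m); rewrite e. Qed.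

Lemma piece_full x : piece (iter p s x) = piece x.
Proof.
have h m : val (piece (iter m s x)) = ((piece x + m) %% p)%N.
  elim: m => [|m IH] /=; first by rewrite addn0 modn_small.
  by rewrite piece_s /= IH -addn1 modnDml addn1 addnS.
by apply: val_inj; rewrite /= h modnDr modn_small.
Qed.

Lemma iter_full m x : iter m (iter p s) x = iter (m * p) s x.
Proof. by elim: m => //= m ->; rewrite mulSn iterD. Qed.

Lemma piece_number_gt0 (x : Y) : (0 < p)%N.
Proof. by case: p (piece x) => // -[]. Qed.

Lemma tail_piece_at i m q : tail_relation_at (X i) (iter p s) m q <->
  [/\ X i q.1, X i q.2 & tail_relation_at setT s (m * p) q].
Proof.
rewrite /tail_relation_at /= !iter_full.
by split=> [[]|[? ? []]]; split.
Qed.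

Lemma tail_piece i q : tail_relation (X i) (iter p s) q <->
  [/\ X i q.1, X i q.2 & tail_relation setT s q].
Proof.
split=> [[m _ /tail_piece_at[? ? h]]|[x1 x2 [m _ h]]].
  by split=> //; exists (m * p)%N.
(* [p] is positive because a piece exists, so R_m lies in R_(m p), which is the m-th level for
   [iter p s]. *)
exists m => //; apply/tail_piece_at; split=> //.
by apply: tail_relation_atS h; rewrite -{1}[m]muln1 leq_mul2l (piece_number_gt0
  q.1) orbT.
Qed.

Local Notation hY := (colour_hausdorff cs).

(* R(X_i, s^p) is the clopen part of R(Y, s) above X_i. *)
Lemma tail_Cc_piece i (f : Y * Y -> R[i]) : tail_Cc (X i) (iter p s) f <->
  tail_Cc setT s f /\ forall q, f q != 0 -> X i q.1 /\ X i q.2.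
Proof.
have cp : continuous (iter p s) := cont_iter cs (n := p).
have inj_p x y : itin s E p N0 x = itin s E p N0 y ->
  iter p s x = iter p s y -> x = y.
  exact: (itin_inj cs).
have lk := loc_const_itin cs (n := p) (L := N0).
have lc := loc_const_colour cs (L := N0).
have inj1 := colour_tail_inj cs.
have cY := colour_compact cs.
have cl := (X_clopen i).2.
have oXX : open [set q : Y * Y | X i q.1 /\ X i q.2].
  by apply: openI; (apply: open_comp; last exact: (X_clopen i).1) => q _;
    [exact: cvg_fst|exact: cvg_snd].
have cXX : open [set q : Y * Y | ~ (X i q.1 /\ X i q.2)].
  apply: closed_openC; apply: closedI; apply: preimage_closed (cl) => q _;
    [exact: cvg_fst|exact: cvg_snd].
split=> [cf|[cf sX]].
  have [m sf] := tail_Cc_supp cp lk inj_p cf.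
  have sX q : f q != 0 -> X i q.1 /\ X i q.2 by move=> /sf[].
  split=> //.
  apply: (@tail_CcI R Y setT s _ (colour E N0) cY hY closedT (colour_cont cs)
    lc inj1 _ (m * p)%N).
    by move=> q /sf /tail_piece_at[].
  move=> W oW; have [V [oV VP]] := tail_Cc_trace m cf oW.
  exists ((V `&` [set q | X i q.1 /\ X i q.2]) `|`
          ([set q | ~ (X i q.1 /\ X i q.2)] `&` [set _ | W 0])).
  split.
    apply: openU; first exact: openI.
    apply: openI => //; have [z0|z0] := pselect (W 0).
      by rewrite (_ : [set _ | _] = setT); [exact: openT | apply/seteqP; split].
    by rewrite (_ : [set _ | _] = set0); [exact: open0 | apply/seteqP; split].
  move=> q qm; have [Xq|nXq] := pselect (X i q.1 /\ X i q.2).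
    have qm' : tail_relation_at (X i) (iter p s) m q.
      by case: Xq => ? ?; apply/tail_piece_at.
    split=> [/(VP q qm') Vq|[[/(VP q qm')]|[/(_ Xq)]] //].
    by left.
  have f0 : f q = 0 by apply/eqP/negPn/negP => /sX.
  rewrite f0; split=> [W0|[[_ /nXq]|[]] //].
  by right.
have [m0 sf] := tail_Cc_supp (colour_cont cs) lc inj1 cf.
apply: (@tail_CcI R Y (X i) (iter p s) _ (itin s E p N0) cY hY cl cp lk inj_p _
  m0).
  move=> q fq; have [X1 X2] := sX q fq; apply/tail_piece_at; split=> //.
  apply: tail_relation_atS (sf q fq).
  by rewrite -{1}[m0]muln1 leq_mul2l (piece_number_gt0 q.1) orbT.
move=> W oW; have [V [oV VP]] := tail_Cc_trace (m0 * p) cf oW.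
by exists V; split=> // q /tail_piece_at[_ _ /VP].
Qed.

Lemma tail_conv_piece i (f g : Y * Y -> R[i]) :
  tail_Cc (X i) (iter p s) f -> tail_Cc (X i) (iter p s) g ->
  tail_conv (X i) (iter p s) f g = tail_conv setT s f g.
Proof.
move=> [f0 _ _] _; apply/funext => -[x y]; rewrite /tail_conv /=.
apply: fsbig_widen => z /=; first by move=> /tail_piece[].
by move=> [_ /f0 ->]; rewrite mul0r.
Qed.

End Pieces.

(** * The direct sum decomposition *)

Section Linearity.
Variables (R : realType) (Y : topologicalType) (s : Y -> Y) (E : nat -> Y ->
  bool).
Variable N0 : nat.
Hypothesis cs : colour_system s E N0.
Variables (F : cstarAlgType R) (iota : (Y * Y -> R[i]) -> F).
Hypothesis Fs : tail_cstar_completion setT s iota.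
Local Open Scope complex_scope.
Local Open Scope ring_scope.
Implicit Types f g : Y * Y -> R[i].

Lemma tail_Cc_lin (c : R[i]) f g : tail_Cc setT s f -> tail_Cc setT s g ->
  tail_Cc setT s (fun q => c * f q + g q).
Proof.
move=> /(fun_of_tail_Cc cs)[n0 hf] /(fun_of_tail_Cc cs)[n1 hg].
have [m [cm ->]] := hf _ _ (leq_maxl n0 n1) (leqnn _).
have [m' [cm' ->]] := hg _ _ (leq_maxr n0 n1) (leqnn _).
by rewrite fun_of_lin; apply: (tail_Cc_fun_of cs); exact: mcont_lin.
Qed.

Lemma tail_Cc0 : tail_Cc setT s (fun _ : Y * Y => 0 : R[i]).
Proof.
have h : mcont ((fun _ _ _ => 0) : Y -> {ffun 'I_1 * 'I_N0 -> bool} ->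
   {ffun 'I_1 * 'I_N0 -> bool} -> R[i]) by move=> k l; exact: continuous_cst.
have := tail_Cc_fun_of cs h; congr tail_Cc.
by apply/funext => q; rewrite /fun_of if_same.
Qed.

Lemma iota_add f g : tail_Cc setT s f -> tail_Cc setT s g ->
  iota (fun q => f q + g q) = iota f + iota g.
Proof.
move=> cf cg; have [h _ _ _ _] := Fs.
rewrite -[iota f]scale1r -(h _ _ _ cf cg); congr iota.
by apply/funext => q; rewrite mul1r.
Qed.

Lemma iota0 : iota (fun _ => 0) = 0.
Proof.
apply: (addIr (iota (fun _ => 0))); rewrite add0r -(iota_add tail_Cc0 tail_Cc0).
by congr iota; apply/funext => q; rewrite addr0.
Qed.

Lemma iota_sum (I : finType) (f : I -> Y * Y -> R[i]) :
  (forall i, tail_Cc setT s (f i)) ->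
  iota (fun q => \sum_i f i q) = \sum_i iota (f i).
Proof.
move=> cf.
suff [] : iota (fun q => \sum_i f i q) = \sum_i iota (f i) /\
   tail_Cc setT s (fun q => \sum_i f i q) by [].
have -> : (fun q => \sum_i f i q) = \sum_i f i by apply/funext => q;
  rewrite fct_sumE.
apply: (big_ind2 (fun x y => iota x = y /\ tail_Cc setT s x)).
- by split; [exact: iota0 | exact: tail_Cc0].
- move=> x1 x2 y1 y2 [<- cx] [<- cy]; split; first exact: iota_add.
  have := tail_Cc_lin 1 cx cy; congr tail_Cc.
  by apply/funext => q; rewrite mul1r.
- by move=> i _; split=> //; exact: cf.
Qed.

End Linearity.

Section Summands.
Variables (R : realType) (Y : topologicalType) (s : Y -> Y) (E : nat -> Y ->
  bool).
Variable N0 : nat.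
Hypothesis cs : colour_system s E N0.
Variables (F : cstarAlgType R) (iota : (Y * Y -> R[i]) -> F).
Hypothesis Fs : tail_cstar_completion setT s iota.
Variables (p : nat) (X : 'I_p -> set Y).
Hypotheses (X_disj : trivIset setT X) (X_cover : \bigcup_i X i = setT).
Hypothesis X_clopen : forall i, clopen (X i).
Hypothesis X_cyclic : forall i, s @` X i = X (ordS i).
Local Open Scope complex_scope.
Local Open Scope ring_scope.

Local Notation piece := (piece X_cover).
Local Notation pieceP := (pieceP X_disj X_cover).

Definition in_piece (i : 'I_p) (x : Y) : bool := piece x == i.

Lemma loc_const_in_piece i : loc_const (in_piece i).
Proof. exact: (loc_const_app (fun k => k == i) (loc_const_piece X_disj X_cover
  X_clopen)). Qed.

Definition summand_unit i : F := diag_pr iota (in_piece i).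

Let li := loc_const_in_piece.

Lemma summand_unit_idem i : cmul (summand_unit i) (summand_unit i) =
  summand_unit i.
Proof. exact: (diag_pr_idem cs Fs (@li i)). Qed.

Lemma summand_unit_star i : cstar (summand_unit i) = summand_unit i.
Proof. exact: (diag_pr_star cs Fs (@li i)). Qed.

Lemma summand_unit_norm i : cnorm (summand_unit i) <= 1.
Proof. exact: proj_norm_le1 (summand_unit_idem i) (summand_unit_star i). Qed.

Lemma summand_unit_iotal i f : tail_Cc setT s f ->
  cmul (summand_unit i) (iota f) = iota (cutl (in_piece i) f).
Proof. exact: (diag_pr_mull cs Fs (@li i)). Qed.

(** Tail-equivalent points lie in the same piece, so truncating the first coordinate of a function
    on R(Y, s) to X_i amounts to truncating the second. *)
Lemma summand_unit_comm i a : cmul (summand_unit i) a = cmul a (summand_unit i).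
Proof.
apply/eqP; rewrite -subr_eq0; apply/eqP.
apply: (@dense_eq0 _ _ _ _ _ Fs (fun a => cmul (summand_unit i) a - cmul a
  (summand_unit i)) 2).
- by move=> x y; rewrite cmulBr cmulBl !opprD !opprK addrACA.
- move=> x; apply: le_trans (cnormD _ _) _; rewrite cnormN.
  have := cnorm_cmul (summand_unit i) x; have := cnorm_cmul x (summand_unit i).
  by have := summand_unit_norm i; have := cnorm_ge0 x; nra.
- move=> f cf; rewrite (summand_unit_iotal i cf) (diag_pr_mulr cs Fs (@li i)
    cf).
  apply/eqP; rewrite subr_eq0; apply/eqP; congr iota; apply/funext => -[x y].
  rewrite /cutl /cutr /=; have [xy|/(tail_Cc_on cf) ->] :=
    pselect (tail_relation setT s (x, y)).
    by rewrite /in_piece (piece_tail X_disj X_cover X_cyclic xy).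
  by rewrite !if_same.
Qed.

Definition summand_proj i : central_projection F :=
  CentralProjection (summand_unit_comm i) (summand_unit_idem i)
    (summand_unit_star i).

Lemma summand_unit_orth i k : i != k -> cmul (summand_unit i) (summand_unit k)
  = 0.
Proof.
move=> ik; rewrite (diag_pr_mul cs Fs (@li i) (@li k)) -(iota0 cs Fs).
congr iota; apply/funext => q; rewrite /diag_ind /in_piece.
by case: eqP => //= _; case: eqP => //= ->; rewrite (negbTE ik).
Qed.

Lemma summand_unit_sum a : a = \sum_i cmul (summand_unit i) a.
Proof.
apply/eqP; rewrite -subr_eq0; apply/eqP.
apply: (@dense_eq0 _ _ _ _ _ Fs (fun a => a - \sum_i cmul (summand_unit i) a)
  (1 + p%:R)).
- move=> x y.
  have -> : \sum_i cmul (summand_unit i) (x - y) = \sum_i cmul (summand_unit i)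
    x - \sum_i cmul (summand_unit i) y.
    by rewrite -sumrB; apply: eq_bigr => i _; rewrite cmulBr.
  by rewrite !opprD !opprK addrACA.
- move=> x; apply: le_trans (cnormD _ _) _; rewrite cnormN mulrDl mul1r lerD2l.
  apply: le_trans (cnorm_sum _ _ _) _.
  apply: le_trans (_ : \sum_(i < p) cnorm x <= _).
    apply: ler_sum => i _; apply: le_trans (cnorm_cmul _ _) _.
    by rewrite -[X in _ <= X]mul1r ler_wpM2r ?cnorm_ge0 // summand_unit_norm.
  by rewrite sumr_const card_ord mulr_natl.
- move=> f cf; under eq_bigr do rewrite (summand_unit_iotal _ cf).
  have cc i : tail_Cc setT s (cutl (in_piece i) f).
    exact: (tail_Cc_cutl cs (@li i) cf).
  rewrite -(iota_sum cs Fs cc); apply/eqP; rewrite subr_eq0; apply/eqP;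
    congr iota.
  apply/funext => q; rewrite (bigD1 (piece q.1)) //= big1 ?addr0.
    by rewrite /cutl /in_piece eqxx.
  by move=> i; rewrite /cutl /in_piece eq_sym => /negbTE ->.
Qed.

Definition summand i : cstarAlgType R := corner_alg (summand_proj i).

Definition summand_incl i : summand i -> F := val.

Lemma summand_incl_unit i (x : summand i) : cmul (summand_unit i) (summand_incl
  x) = summand_incl x.
Proof. exact: (@cornerP _ _ (summand_proj i) x). Qed.

Lemma summands_direct_sum : cstar_direct_sum summand_incl.
Proof.
split.
- by move=> i; exact: val_star_hom.
- move=> i k ik x y; rewrite -(summand_incl_unit x) -(summand_incl_unit y)
    summand_unit_comm -cmulA [cmul (summand_unit i) _]cmulA.
  by rewrite summand_unit_orth // cmul0l cmul0r.
- move=> x; exists (fun i => to_corner (summand_proj i) x); split.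
    exact: summand_unit_sum.
  move=> a xa; apply: functional_extensionality_dep => i; apply: val_inj.
  rewrite val_to_corner xa cmul_sumr (bigD1 i) //= big1 ?addr0 => [|k ki].
    exact: summand_incl_unit.
  by rewrite -[summand_incl _]summand_incl_unit cmulA summand_unit_orth ?cmul0l
    // eq_sym.
Qed.

Lemma summand_unit_cut i (f : Y * Y -> R[i]) : tail_Cc (X i) (iter p s) f ->
  cmul (summand_unit i) (iota f) = iota f.
Proof.
move=> /(tail_Cc_piece cs X_cover X_clopen)[cf sf].
rewrite summand_unit_iotal //; congr iota; apply/funext => q; rewrite /cutl.
have [->|/sf [/pieceP e _]] := eqVneq (f q) 0; first by rewrite if_same.
by rewrite /in_piece e eqxx.
Qed.

Lemma cut_piece i (f : Y * Y -> R[i]) : tail_Cc setT s f ->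
  tail_Cc (X i) (iter p s) (cutl (in_piece i) f).
Proof.
move=> cf; apply/(tail_Cc_piece cs X_cover X_clopen).
split; first exact: (tail_Cc_cutl cs (@li i) cf).
move=> [x y]; rewrite /cutl /=; case: ifP; last by rewrite eqxx.
move=> /eqP xi fxy.
have xy : tail_relation setT s (x, y).
  by apply: contrapT => /(tail_Cc_on cf) h; rewrite h eqxx in fxy.
split; apply/pieceP => //.
by rewrite -(piece_tail X_disj X_cover X_cyclic xy).
Qed.

Lemma summand_completion i : is_tail_cstar_algebra (X i) (iter p s) (summand i).
Proof.
have sub (f : Y * Y -> R[i]) : tail_Cc (X i) (iter p s) f -> tail_Cc setT s f.
  by move=> /(tail_Cc_piece cs X_cover X_clopen)[].
have [hlin hmul hstar hinj _] := Fs.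
(* Multiplying by the unit serves to land in the type [summand i]; on C_c(R(X_i, s^p)) it changes
   nothing ([ioE]). *)
pose io f : summand i := to_corner (summand_proj i) (iota f).
have ioE f : tail_Cc (X i) (iter p s) f -> val (io f) = iota f by move=>
  /summand_unit_cut.
exists io; split.
- move=> c f g cf cg; apply: val_inj.
  by rewrite val_to_corner (hlin _ _ _ (sub _ cf) (sub _ cg)) cmulDr cmulZr.
- move=> f g cf cg; apply: val_inj.
  rewrite val_corner_mul (ioE f cf) (ioE g cg) val_to_corner.
  rewrite (tail_conv_piece X_cover cf cg) (hmul _ _ (sub _ cf) (sub _ cg)).
  by rewrite cmulA summand_unit_cut.
- move=> f cf; apply: val_inj.
  rewrite val_corner_star (ioE f cf) val_to_corner (hstar _ (sub _ cf)).
  by rewrite -[in RHS](summand_unit_cut cf) cstarM summand_unit_star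
    -summand_unit_comm.
- by move=> f g cf cg /(congr1 val); rewrite (ioE f cf) (ioE g cg);
    exact: hinj (sub _ cf) (sub _ cg).
- apply/seteqP; split=> // a _; apply/closure_cnorm => e e0.
  have [f cf fe] := iota_dense Fs (val a) e0.
  exists (io (cutl (in_piece i) f)); first by exists (cutl (in_piece i) f) =>
    //; exact: cut_piece.
  have ef : val (io (cutl (in_piece i) f)) = cmul (summand_unit i) (iota f).
    by rewrite (ioE _ (cut_piece i cf)) summand_unit_iotal.
  have -> : cnorm (a - io (cutl (in_piece i) f)) =
            cnorm (val a - val (io (cutl (in_piece i) f))) by [].
  rewrite ef -[val a]summand_incl_unit /summand_incl -cmulBr.
  apply: le_lt_trans (cnorm_cmul _ _) _; apply: le_lt_trans fe.
  by rewrite -[X in _ <= X]mul1r ler_wpM2r ?cnorm_ge0 // summand_unit_norm.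
Qed.

End Summands.

(** * Approximation by finite-dimensional algebras *)

Lemma finite_dimensional_span (R : realType) (A : cstarAlgType R) (S : set A)
    (I : finType) (t0 : I) (v : I -> A) :
  (forall a, S a -> exists c : I -> R[i]%C, a = \sum_t c t *: v t) ->
  finite_dimensional S.
Proof.
move=> h; exists [seq v t | t <- enum I] => a /h[c ->].
exists (fun i => c (nth t0 (enum I) i)).
rewrite -big_enum /= (big_nth t0) big_mkord -(size_map v).
by apply: eq_bigr => i _; rewrite (nth_map t0) // -(size_map v).
Qed.

Section LocallyConstantElements.
Variables (R : realType) (Y : topologicalType) (s : Y -> Y) (E : nat -> Y ->
  bool).
Variable N0 : nat.
Hypothesis cs : colour_system s E N0.
Variables (F : cstarAlgType R) (iota : (Y * Y -> R[i]) -> F).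
Hypothesis Fs : tail_cstar_completion setT s iota.
Local Open Scope complex_scope.
Local Open Scope ring_scope.
Notation K n L := {ffun 'I_n.+1 * 'I_L -> bool}.
Notation mat n L := (K n L -> K n L -> R[i]).
Notation mfun n L := (Y -> mat n L).
Notation C L := {ffun 'I_L -> bool}.
Local Notation ccol := (colour E).
Local Notation rho := (rho s E iota).

Definition colour_matrix n L N (phi : C N -> mat n L) : mfun n L :=
  fun w k l => phi (ccol N w) k l.

(* Finite-dimensional spaces; the union over all [n], [L], [N] is dense, and
   [level_ok n L N] makes them algebras. *)
Definition loc_const_elts n L N : set F := [set a | exists phi : C N ->
  mat n L, a = rho (colour_matrix phi)].

Lemma mcont_colm n L N (phi : C N -> mat n L) : mcont (colour_matrix phi).
Proof.
move=> k l; apply: continuous_loc_const.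
exact: (loc_const_app (fun t => phi t k l : R[i]^o) (loc_const_colour cs (L :=
  N))).
Qed.

Lemma loc_const_elts_lin n L N (c : R[i]) a b : loc_const_elts n L N a ->
  loc_const_elts n L N b ->
  loc_const_elts n L N (c *: a + b).
Proof.
move=> [f ->] [g ->]; exists (fun t k l => c * f t k l + g t k l).
by rewrite -(rho_lin cs Fs _ (@mcont_colm _ _ _ f) (@mcont_colm _ _ _ g)).
Qed.

Lemma loc_const_elts0 n L N : loc_const_elts n L N 0.
Proof. by exists (fun _ _ _ => 0); rewrite -(rho0 cs Fs n L). Qed.

Lemma loc_const_elts_star n L N a : loc_const_elts n L N a ->
  loc_const_elts n L N (cstar a).
Proof.
move=> [f ->]; exists (fun t k l => (f t l k)^*).
by rewrite -(rho_star cs Fs (@mcont_colm _ _ _ f)).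
Qed.

(** The words present above w, hence the index set of the sum in [mmul], are then determined by the
    colour of w, so that products remain functions of the colour. *)
Definition level_ok n L N := forall (k : K n L) w w', ccol N w = ccol N w' ->
  in_fibre s E k w = in_fibre s E k w'.

Lemma level_ex n L : exists N, level_ok n L N.
Proof.
have h := loc_const_ffun (fun k : K n L => loc_const_in_fibre cs k).
have [N hN] := colour_loc_const cs h.
by exists N => k w w' /hN /ffunP /(_ k); rewrite !ffunE.
Qed.

Lemma level_le n L N M : (N <= M)%N -> level_ok n L N -> level_ok n L M.
Proof. by move=> NM h k w w' /(colour_le NM); exact: h. Qed.

Lemma loc_const_elts_mul n L N a b : (N0 <= L)%N -> level_ok n L N ->
  loc_const_elts n L N a -> loc_const_elts n L N b ->
    loc_const_elts n L N (cmul a b).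
Proof.
move=> NL ok [f ->] [g ->].
have /choice[d dP] : forall t : C N, exists d : K n L -> bool,
    forall k w, ccol N w = t -> in_fibre s E k w = d k.
  move=> t.
  have [[w0 w0t]|no] := pselect (exists w, ccol N w = t).
    by exists (fun k => in_fibre s E k w0) => k w wt; apply: ok; rewrite wt.
  by exists (fun _ => true) => k w wt; case: no; exists w.
exists (fun t k l => \sum_(j | d t j) f t k j * g t j l).
rewrite -(rho_mul cs Fs NL (@mcont_colm _ _ _ f) (@mcont_colm _ _ _ g)).
congr rho; apply/funext => w; apply/funext => k; apply/funext => l.
by apply: eq_bigl => j; exact: dP.
Qed.

(* Whether [(x, y)] lies in [R_n] can be read off from the colours of
   [s^i x] and [s^i y] once it is known to lie in [R_n']. *)
Lemma loc_const_elts_mono n L N n' L' N' : (N0 <= L)%N -> (n <= n')%N ->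
  (L <= L')%N ->
  (N <= L')%N -> loc_const_elts n L N `<=` loc_const_elts n' L' N'.
Proof.
move=> NL nn LL NL' _ [f ->].
pose g := fun_of s E (colour_matrix f).
pose rel (k l : K n' L') x y := [/\ itin s E n' L' x = k, itin s E n' L' y = l &
  iter n' s x = iter n' s y].
have inj1 := colour_tail_inj cs.
(* On R_n' the function depends on the two itineraries alone, so at level (n', L') it becomes a
   matrix independent of the base point; this is why N' is arbitrary. *)
have key k l x y x1 y1 : rel k l x y -> rel k l x1 y1 -> g (x, y) = g (x1, y1).
  move=> [<- <- e] [/itinP kx /itinP ky e1].
  have h u v : iter n' s u = iter n' s v ->
      (iter n s u == iter n s v) = `[< agree s (ccol N0) n n' (u, v) >].
    move=> uv; apply/eqP/asboolP => [h|].
      by apply/(agree_tail inj1 nn (D := setT)).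
    by move=> /(agree_tail inj1 nn (D := setT)) [].
  rewrite /g /fun_of /= (h _ _ e) (h _ _ e1).
  have NL2 := leq_trans NL LL.
  have -> : `[< agree s (ccol N0) n n' (x1, y1) >] =
    `[< agree s (ccol N0) n n' (x, y) >].
    apply: asbool_equiv_eq; split=> a i /andP[ni iN]; have := a i;
      rewrite ni iN /= => /(_ isT) e2.
      by rewrite -(colour_le NL2 (kx i (ltnW iN))) -(colour_le NL2 (ky i (ltnW
        iN))).
    by rewrite (colour_le NL2 (kx i (ltnW iN))) (colour_le NL2 (ky i (ltnW
      iN))).
  case: ifP => // _; rewrite /colour_matrix.
  have kL u u1 : (forall i, (i <= n')%N -> ccol L' (iter i s u) = ccol L' (iter
    i s u1)) ->
      itin s E n L u = itin s E n L u1.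
    by move=> h1; apply/itinP => i iN; apply: (colour_le LL); apply: h1;
      exact: leq_trans nn.
  by rewrite -(kL _ _ kx) -(kL _ _ ky) -(colour_le NL' (kx n nn)).
have /choice[G GP] : forall kl : K n' L' * K n' L', exists c, forall x y,
    rel kl.1 kl.2 x y -> g (x, y) = c.
  move=> [k l] /=.
  have [[x [y h]]|no] := pselect (exists x y, rel k l x y).
    by exists (g (x, y)) => x1 y1 h1; exact: key h1 h.
  by exists 0 => x y h; case: no; exists x, y.
exists (fun _ k l => G (k, l)).
rewrite /rho; congr iota; apply/funext => -[x y].
rewrite [RHS]/fun_of /=; case: eqP => e; first exact: GP.
rewrite /fun_of /=; case: eqP => // e1; case: e.
by rewrite -(subnK nn) !iterD e1.
Qed.

(** The entries are uniformly continuous with respect to the colours; [phi] samples m at one point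
    of each colour and is 0 at colours that do not occur. *)
Lemma mcont_approx n L (m : mfun n L) (d : R) : mcont m -> 0 < d ->
  exists N (phi : C N -> mat n L), forall w k l,
    cabs (m w k l - colour_matrix phi w k l) < d.
Proof.
move=> cm d0.
have [|N hN] := colour_uniform cs (Q := fun w w' => forall k l,
  cabs (m w k l - m w' k l) < d).
  move=> x.
  have d2 : 0 < d / 2 by rewrite divr_gt0.
  have h (kl : K n L * K n L) : exists W, [/\ open W, W x &
      forall t, W t -> cabs (m x kl.1 kl.2 - m t kl.1 kl.2) < d / 2].
    exact: (cabs_lt_open x (cm kl.1 kl.2) d2).
  have /choice[W WP] := h.
  exists [set z | forall kl, W kl z]; split.
  - by apply: open_forall => kl; case: (WP kl).
  - by move=> kl; case: (WP kl).
  - move=> y z Wy Wz k l; have [_ _ hW] := WP (k, l).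
    have -> : m y k l - m z k l = (m x k l - m z k l) - (m x k l - m y k l) by
      ring.
    apply: le_lt_trans (cabsD _ _) _; rewrite cabsN.
    by have := hW y (Wy _); have := hW z (Wz _); rewrite /= -!/(cabs _); lra.
have /choice[phi phiP] : forall t : C N, exists f : mat n L, forall w,
    ccol N w = t -> forall k l, cabs (m w k l - f k l) < d.
  move=> t.
  have [[w0 w0t]|no] := pselect (exists w, ccol N w = t).
    by exists (m w0) => w wt k l; apply: hN; rewrite wt.
  by exists (fun _ _ => 0) => w wt; case: no; exists w.
by exists N, phi => w k l; exact: phiP.
Qed.

Lemma loc_const_elts_dense (a : F) (e : R) : 0 < e ->
  exists n L N b, [/\ (N0 <= L)%N, loc_const_elts n L N b & cnorm (a - b) < e].
Proof.
move=> e0; have e2 : 0 < e / 2 by rewrite divr_gt0.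
have [f cf fe] := iota_dense Fs a e2.
have [n0 h] := fun_of_tail_Cc cs cf.
have [m [cm fm]] := h n0 N0 (leqnn _) (leqnn _).
pose c : R := #|{: K n0 N0 * K n0 N0}|%:R.
have c0 : 0 < c + 1 by rewrite ltr_wpDl // ler0n.
have d0 : 0 < e / 2 / (c + 1) by rewrite divr_gt0.
have [N [phi phiP]] := mcont_approx cm d0.
exists n0, N0, N, (rho (colour_matrix phi)); split=> //; first by exists phi.
have -> : a - rho (colour_matrix phi) = (a - iota f) + (iota f - rho
  (colour_matrix phi)).
  by rewrite addrA subrK.
apply: le_lt_trans (cnormD _ _) _.
suff : cnorm (iota f - rho (colour_matrix phi)) <= e / 2.
  by move=> h2; have := ltr_leD fe h2; rewrite -splitr.
rewrite cnormB fm -/(rho m) addrC -scaleN1r.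
rewrite -(rho_lin cs Fs _ cm (@mcont_colm _ _ _ phi)).
apply: le_trans (rho_le cs Fs (leqnn N0) _ d0 _) _.
- by apply: mcont_lin; [exact: cm | exact: mcont_colm].
- by move=> w k l; rewrite mulN1r addrC cabsB; exact/ltW/phiP.
- rewrite -/c mulrA ler_pdivrMr // [c * _]mulrC ler_wpM2l ?(ltW e2) //.
  by rewrite lerDl.
Qed.

End LocallyConstantElements.

(** * The AF filtration of a summand *)

Section SummandAF.
Variables (R : realType) (Y : topologicalType) (s : Y -> Y) (E : nat -> Y ->
  bool).
Variable N0 : nat.
Hypothesis cs : colour_system s E N0.
Variables (F : cstarAlgType R) (iota : (Y * Y -> R[i]%C) -> F).
Hypothesis Fs : tail_cstar_completion setT s iota.
Variables (p : nat) (X : 'I_p -> set Y).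
Hypotheses (X_disj : trivIset setT X) (X_cover : \bigcup_i X i = setT).
Hypothesis X_clopen : forall i, clopen (X i).
Hypothesis X_cyclic : forall i, s @` X i = X (ordS i).
Local Open Scope complex_scope.
Local Open Scope ring_scope.
Notation K n L := {ffun 'I_n.+1 * 'I_L -> bool}.
Notation C L := {ffun 'I_L -> bool}.
Local Notation rho := (rho s E iota).
Local Notation loc_const_elts := (loc_const_elts s E iota).
Local Notation summand := (summand cs Fs X_disj X_cover X_clopen X_cyclic).
Local Notation summand_unit := (summand_unit iota X_cover).

Lemma piece_level : exists L1, forall x y, colour E L1 x = colour E L1 y ->
  piece X_cover x = piece X_cover y.
Proof. exact: (colour_loc_const cs (loc_const_piece X_disj X_cover X_clopen)).
  Qed.

Let L1 : nat := projT1 (cid piece_level).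

Definition next_level n L : nat := maxn L (projT1 (cid (level_ex cs n L))).

(** Three demands dictate the growth: words of stage k + 1 must be fine enough to read the colour
    level [fibre_level k] of stage k, every level must eventually be exceeded, and already at the
    start the words must separate fibres ([N0]) and see the pieces ([L1]). *)
Fixpoint itin_level k : nat :=
  if k is k'.+1 then maxn (itin_level k').+1 (next_level k' (itin_level k'))
  else maxn N0 L1.

Definition fibre_level k : nat := next_level k (itin_level k).

Lemma itin_level_mono j k : (j <= k)%N -> (itin_level j <= itin_level k)%N.
Proof.
elim: k => [|k IH]; first by rewrite leqn0 => /eqP ->.
rewrite leq_eqVlt => /orP[/eqP -> //|]; rewrite ltnS => /IH h.
apply: leq_trans h _; rewrite /=; apply: leq_trans (leq_maxl _ _);
  exact: leqnSn.
Qed.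

Lemma itin_level_ge k : (k <= itin_level k)%N.
Proof.
elim: k => //= k IH; apply: leq_trans (leq_maxl _ _); exact: IH.
Qed.

Lemma itin_level_N0 k : (N0 <= itin_level k)%N.
Proof. by apply: leq_trans (itin_level_mono (leq0n k)); exact: leq_maxl. Qed.

Lemma itin_level_L1 k : (L1 <= itin_level k)%N.
Proof. by apply: leq_trans (itin_level_mono (leq0n k)); exact: leq_maxr. Qed.

Lemma fibre_level_next k : (fibre_level k <= itin_level k.+1)%N.
Proof. exact: leq_maxr. Qed.

Lemma fibre_level_ok k : @level_ok _ s E k (itin_level k) (fibre_level k).
Proof.
apply: level_le (leq_maxr _ _) _; exact: (projT2 (cid (level_ex cs k
  (itin_level k)))).
Qed.

Definition AF_stage k : set F := loc_const_elts k (itin_level k) (fibre_level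
  k).

Lemma AF_stage_mono k : AF_stage k `<=` AF_stage k.+1.
Proof.
apply: (loc_const_elts_mono cs); first exact: itin_level_N0.
- exact: leqnSn.
- exact: itin_level_mono.
- exact: fibre_level_next.
Qed.

Lemma loc_const_elts_AF_stage n L N k : (N0 <= L)%N ->
  (maxn n (maxn L N) <= k)%N ->
  loc_const_elts n L N `<=` AF_stage k.
Proof.
move=> NL; rewrite !geq_max => /and3P[nk Lk Nk].
by apply: (loc_const_elts_mono cs) => //; apply: leq_trans (itin_level_ge k).
Qed.

(** With the unit in every stage, cutting an approximant down to the summand does not leave its
    stage. *)
Lemma summand_unit_AF_stage i k : AF_stage k (summand_unit i).
Proof.
have : loc_const_elts 0 N0 L1 (summand_unit i).
  have [d dP] : exists d : C L1 -> bool, forall x,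
    in_piece X_cover i x = d (colour E L1 x).
    have /choice[d dP] : forall t : C L1, exists d, forall x,
      colour E L1 x = t ->
        in_piece X_cover i x = d.
      move=> t; have [[x0 x0t]|no] := pselect (exists x, colour E L1 x = t).
        exists (in_piece X_cover i x0) => x xt; rewrite /in_piece.
        by rewrite (projT2 (cid piece_level) x x0) // xt.
      by exists true => x xt; case: no; exists x.
    by exists d => x; exact: dP.
  exists (fun t _ _ => (d t)%:R); congr iota; apply/funext => q.
  rewrite /diag_ind /fun_of /colour_matrix /= dP; case: eqP => //= _.
  by case: (d _).
apply: (loc_const_elts_mono cs) => //; [exact: itin_level_N0 | exact:
  itin_level_L1].
Qed.

Lemma AF_stage_dense (a : F) (e : R) : 0 < e -> exists k b,
  AF_stage k b /\ cnorm (a - b) < e.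
Proof.
move=> /(loc_const_elts_dense cs Fs a)[n [L [N [b [NL Bb ab]]]]].
by exists (maxn n (maxn L N)), b; split=> //;
  exact: (loc_const_elts_AF_stage NL (leqnn _)).
Qed.

Lemma AF_stage_findim i k : finite_dimensional [set a : summand i | AF_stage k
  (val a)].
Proof.
set n := k; pose L := itin_level k; pose N := fibre_level k.
(* The matrix unit at one colour and one pair of words; cut down to the summand, these span the
   stage. *)
pose d (q : C N * (K n L * K n L)) : C N -> K n L -> K n L -> R[i] :=
  fun t k l => ((t, (k, l)) == q)%:R.
pose v (q : C N * (K n L * K n L)) : summand i :=
  to_corner (summand_proj cs Fs X_disj X_cover X_clopen X_cyclic i) (rho
  (colour_matrix E (d q))).
apply: (@finite_dimensional_span _ _ _ _ ([ffun=> true], ([ffun=> true],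
  [ffun=> true])) v).
move=> a [phi aphi]; exists (fun q => phi q.1 q.2.1 q.2.2).
have cd q : mcont (colour_matrix E (d q)) by exact: (mcont_colm cs).
have cd2 q : mcont (fun w k l => phi q.1 q.2.1 q.2.2 * colour_matrix E (d q) w
  k l).
  move=> k1 l1; apply: continuous_mul; [exact: continuous_cst | exact: cd].
apply: val_inj; rewrite linear_sum.
transitivity (\sum_q cmul (summand_unit i) (phi q.1 q.2.1 q.2.2 *: rho
  (colour_matrix E (d q)))); last first.
  by apply: eq_bigr => q _; rewrite cmulZr.
rewrite -cmul_sumr -[LHS](@cornerP _ _ (summand_proj cs Fs X_disj X_cover
  X_clopen X_cyclic i) a) aphi.
congr cmul.
under eq_bigr => q _ do rewrite -(rho_scale cs Fs _ (cd q)).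
rewrite -(rho_sum cs Fs cd2); congr (rho _).
apply/funext => w; apply/funext => k1; apply/funext => l1.
rewrite (bigD1 (colour E N w, (k1, l1))) //= big1 ?addr0.
  by rewrite /colour_matrix /d eqxx mulr1.
by move=> q; rewrite /colour_matrix /d eq_sym => /negbTE ->; rewrite mulr0.
Qed.

Lemma summand_AF i : AF_algebra (summand i).
Proof.
exists (fun k => [set a : summand i | AF_stage k (val a)]); split.
- move=> k; split; last exact: AF_stage_findim.
  split; [split|..].
  + exact: (loc_const_elts0 cs Fs).
  + by move=> c a b; exact: (loc_const_elts_lin cs Fs).
  + move=> a b Ba Bb; have : AF_stage k (val (corner_mul a b)); last by [].
    rewrite val_corner_mul; exact: (loc_const_elts_mul cs Fs (itin_level_N0 k)
      (@fibre_level_ok k)).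
  + move=> a Ba; have : AF_stage k (val (corner_star a)); last by [].
    by rewrite val_corner_star; exact: (loc_const_elts_star cs Fs).
- by move=> k a; exact: AF_stage_mono.
- apply/seteqP; split=> // a _; apply/closure_cnorm => e e0.
  have [k [b [Bb ab]]] := AF_stage_dense (val a) e0.
  pose b' : summand i := to_corner (summand_proj cs Fs X_disj X_cover X_clopen
    X_cyclic i) b.
  exists b'; first exists k => //.
    by apply: (loc_const_elts_mul cs Fs (itin_level_N0 k) (@fibre_level_ok k))
      => //; exact: summand_unit_AF_stage.
  have -> : cnorm (a - b') = cnorm (val a - cmul (summand_unit i) b) by [].
  rewrite -[val a](@cornerP _ _ (summand_proj cs Fs X_disj X_cover X_clopen
    X_cyclic i) a) -cmulBr.
  apply: le_lt_trans (cnorm_cmul _ _) _; apply: le_lt_trans ab.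
  rewrite -[X in _ <= X]mul1r ler_wpM2r ?cnorm_ge0 //.
  exact: (summand_unit_norm cs Fs X_disj X_cover X_clopen).
Qed.

End SummandAF.

(** * Simplicity *)

Section ClosedIdeals.
Variables (R : realType) (F : cstarAlgType R) (J : set F).
Hypothesis Jlin : forall (c : R[i]%C) a b, J a -> J b -> J (c *: a + b).
Hypothesis Jl : forall a b, J b -> J (cmul a b).
Hypothesis Jr : forall a b, J b -> J (cmul b a).
Hypothesis J0 : J 0.
Hypothesis Jcl : forall a, (forall e : R, 0 < e -> exists b,
  J b /\ cnorm (a - b) < e) -> J a.

Lemma ideal_add a b : J a -> J b -> J (a + b).
Proof. by rewrite -{2}[a]scale1r; exact: Jlin. Qed.

Lemma ideal_scale (c : R[i]%C) a : J a -> J (c *: a).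
Proof. by move=> Ja; rewrite -[_ *: _]addr0; exact: Jlin. Qed.

Lemma ideal_sum (I : finType) (P : pred I) (a : I -> F) :
  (forall i, P i -> J (a i)) -> J (\sum_(i | P i) a i).
Proof. by move=> Ja; apply: big_ind => // x y; exact: ideal_add. Qed.

(* If [d = e - e c e] then [e - d ^ m] stays in the ideal while [d ^ m] tends
   to 0. *)
Lemma ideal_near_projection (e c : F) : cmul e e = e -> cnorm e <= 1 -> J c ->
  cnorm (e - c) < 1 -> J e.
Proof.
move=> ee e1 Jc ec.
pose d := cmul e (cmul (e - c) e).
have dE : d = e - cmul e (cmul c e) by rewrite /d cmulBl cmulBr ee ee.
have d1 : cnorm d <= cnorm (e - c).
  apply: le_trans (cnorm_cmul _ _) _.
  have := cnorm_cmul (e - c) e; have := cnorm_ge0 e; have := cnorm_ge0 (e - c).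
  by have := cnorm_ge0 (cmul (e - c) e); nra.
pose dm m := iter m (cmul d) d.
have de m : cmul e (dm m) = dm m.
  by case: m => [|m]; rewrite /dm /= /d !cmulA ee.
have Jd : J (e - d) by rewrite dE subKr; apply: Jl; exact: Jr.
have Jdm m : J (e - dm m).
  elim: m => [|m IH]; first exact: Jd.
  have -> : e - dm m.+1 = (e - dm m) + cmul (e - d) (dm m).
    by rewrite cmulBl de addrA subrK /dm iterS.
  by apply: ideal_add IH _; exact: Jr.
have ndm m : cnorm (dm m) <= cnorm (e - c) ^+ m.+1.
  elim: m => [|m IH]; first by rewrite expr1.
  rewrite /dm iterS exprS; apply: le_trans (cnorm_cmul _ _) _.
  by apply: ler_pM; rewrite ?cnorm_ge0.
apply: Jcl => eps eps0.
have : (cnorm (e - c)) ^+ m @[m --> \oo] --> (0 : R).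
  by apply: cvg_expr; rewrite ger0_norm ?cnorm_ge0.
move=> /cvgrPdist_lt /(_ eps eps0) [N _ hN].
exists (e - dm N); split; first exact: Jdm.
rewrite subKr; apply: le_lt_trans (ndm N) _.
have := hN N.+1 (leqnSn N); rewrite /= sub0r normrN ger0_norm //.
by rewrite exprn_ge0 // cnorm_ge0.
Qed.

End ClosedIdeals.

Section Simplicity.
Variables (R : realType) (Y : topologicalType) (s : Y -> Y) (E : nat -> Y ->
  bool).
Variable N0 : nat.
Hypothesis cs : colour_system s E N0.
Variables (F : cstarAlgType R) (iota : (Y * Y -> R[i]%C) -> F).
Hypothesis Fs : tail_cstar_completion setT s iota.
Local Open Scope complex_scope.
Local Open Scope ring_scope.
Notation K n L := {ffun 'I_n.+1 * 'I_L -> bool}.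
Notation C L := {ffun 'I_L -> bool}.
Notation mfun n L := (Y -> K n L -> K n L -> R[i]).
Local Notation rho := (rho s E iota).
Local Notation loc_const_elts := (loc_const_elts s E iota).

Variable J : set F.
Hypothesis Jlin : forall (c : R[i]) a b, J a -> J b -> J (c *: a + b).
Hypothesis Jl : forall a b, J b -> J (cmul a b).
Hypothesis Jr : forall a b, J b -> J (cmul b a).
Hypothesis J0 : J 0.
Hypothesis Jcl : forall a, (forall e : R, 0 < e -> exists b,
  J b /\ cnorm (a - b) < e) -> J a.

Lemma loc_const_elts_selfadjoint_approx (a : F) (e : R) : cstar a = a ->
  0 < e ->
  exists n L N b, [/\ (N0 <= L)%N, loc_const_elts n L N b,
    cstar b = b & cnorm (a - b) < e].
Proof.
move=> sa e0; have [n [L [N [b [NL Bb ab]]]]] :=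
  loc_const_elts_dense cs Fs a e0.
pose c : R[i] := (2^-1 : R)%:C.
have cc : c^* = c by exact: conjc_real.
(* The selfadjoint part of b, in the shape that [loc_const_elts_lin] accepts. *)
exists n, L, N, (c *: b + (c *: cstar b + 0)); split=> //.
- apply: (loc_const_elts_lin cs Fs _ Bb); apply: (loc_const_elts_lin cs Fs).
    exact: (loc_const_elts_star cs Fs).
  exact: (loc_const_elts0 cs Fs).
- by rewrite addr0 cstarD !cstarZ cstarK cc addrC.
- have -> : a - (c *: b + (c *: cstar b + 0)) = c *: ((a - b) + cstar (a - b)).
    rewrite addr0 cstarB sa addrACA -opprD scalerBr scalerDr; congr (_ + - _).
    + rewrite -scalerDl -rmorphD /= (_ : 2^-1 + 2^-1 = 1 :> R) ?scale1r //; lra.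
    + by rewrite scalerDr.
  rewrite cnormZ_cabs cabs_real ger0_norm; last by lra.
  by have := cnormD (a - b) (cstar (a - b)); rewrite cnorm_star; lra.
Qed.

Lemma diag_pr_rho n L (V : Y -> bool) (v : Y -> K n L -> bool) : (N0 <= L)%N ->
  (forall x, V x = v (iter n s x) (itin s E n L x)) ->
  diag_pr iota V = rho (fun w k l => if (k == l) && v w k then 1 else 0).
Proof.
move=> NL hV; congr iota; apply/funext => -[x y]; rewrite /diag_ind /fun_of /=.
case: (iter n s x =P iter n s y) => [e|ne]; last first.
  by case: eqP => //= xy; case: ne; rewrite xy.
rewrite -hV; congr (if _ && _ then _ else _).
apply/eqP/eqP => [-> //|k]; exact: (itin_inj cs NL k e).
Qed.

(* A selfadjoint [b] close to [a = y^* y] moves some vector [xi] above some point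
   [w] by almost the norm of [a]; spreading [xi] over a neighbourhood of [w] as
   the column [f] gives [f^* b^2 f = lam P] with [P] a diagonal projection. *)
Lemma ideal_contains_diag_pr (y : F) : J y -> y != 0 ->
  exists V : Y -> bool, [/\ loc_const V, (exists x, V x) & J (diag_pr iota V)].
Proof.
move=> Jy y0.
pose a := cmul (cstar y) y.
have Ja : J a by exact: Jl.
have sa : cstar a = a by rewrite /a cstarM cstarK.
have al0 : 0 < cnorm a.
  rewrite /a cnorm_star_sq exprn_gt0 // lt0r cnorm_ge0 andbT.
  by apply: contra y0 => /eqP /cnorm_eq0 ->.
have d0 : 0 < cnorm a / 8 by rewrite divr_gt0.
have [n [L [N [b [NL [phi bE] sb ab]]]]] := loc_const_elts_selfadjoint_approx
  sa d0.
set m := colour_matrix E phi in bE.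
have cm : mcont m by exact: (mcont_colm cs).
(* From |a - b| < |a| / 8 follow |b| > 7/8 |a| = M and |b^2 - a^2| <= 1/8 * 17/8 |a|^2 = 17/64
   |a|^2, which is below M^2 = 49/64 |a|^2. *)
pose M := cnorm a * 7 / 8.
have M0 : 0 < M by rewrite /M divr_gt0 // mulr_gt0.
have nb : M < cnorm b.
  by have := cnormD (a - b) b; rewrite subrK /M; lra.
(* If every matrix of m were bounded by M, [selfadjoint_le] would give |b| <= M. *)
have [w [xi hxi]] : exists w (xi : K n L -> R[i]),
   M ^+ 2 * \sum_(l | in_fibre s E l w) cabs (xi l) ^+ 2 <
   \sum_(k | in_fibre s E k w) cabs (\sum_(l | in_fibre s E l w) m w k l * xi
     l) ^+ 2.
  apply: contrapT => no.
  have : cnorm (rho m) <= M.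
    apply: (selfadjoint_le cs Fs NL cm M0); first by rewrite -bE.
    move=> w xi; rewrite leNgt; apply/negP => h; apply: no.
    by exists w, xi.
  by rewrite leNgt -bE nb.
pose eta k := \sum_(l | in_fibre s E l w) m w k l * xi l.
set lam := \sum_(k | in_fibre s E k w) cabs (eta k) ^+ 2 in hxi.
set T := \sum_(l | in_fibre s E l w) cabs (xi l) ^+ 2 in hxi.
have T0 : 0 <= T by apply: sumr_ge0 => *; exact: sqr_ge0.
have lam0 : 0 < lam by apply: le_lt_trans hxi; rewrite mulr_ge0 // sqr_ge0.
have [l0 kl0] : exists l0 : K n L, in_fibre s E l0 w.
  apply: contrapT => no; move: lam0; rewrite /lam big1 ?ltxx // => k kw.
  by case: no; exists k.
have [N1 ok1] := level_ex cs n L.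
(* On a colour class of this level both m and the set of words present are constant. *)
pose N' := maxn N N1.
have ok : @level_ok _ s E n L N' by apply: level_le ok1; exact: leq_maxr.
pose W w' : bool := colour E N' w' == colour E N' w.
have lW : loc_const W := loc_const_app (fun t =>
  t == colour E N' w) (loc_const_colour cs (L := N')).
have mW w' : W w' -> m w' = m w.
  by move=> /eqP /(colour_le (leq_maxl N N1)) h; rewrite /m /colour_matrix h.
have dW w' (k : K n L) : W w' -> in_fibre s E k w' = in_fibre s E k w by move=>
  /eqP; exact: ok.
pose h w' : R[i] := (W w')%:R.
have ch : continuous (h : Y -> R[i]^o).
  apply: continuous_loc_const; exact: (loc_const_app (fun b : bool =>
    b%:R : R[i]^o) lW).
pose P := rho (munit h l0 l0).
pose V x := (itin s E n L x == l0) && W (iter n s x).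
have PV : diag_pr iota V = P.
  rewrite (@diag_pr_rho n L V (fun w k => (k == l0) && W w)) //.
  congr (rho _); apply/funext => w'; apply/funext => k; apply/funext => l.
  rewrite /munit /h; case: (k =P l) => [->|kl] /=.
    by case: eqP => //= _; case: (W _).
  by case: (k =P l0) => //= ek; case: eqP => // el; case: kl; rewrite ek el.
have lV : loc_const V.
  have lk := loc_const_app (fun k => k == l0) (loc_const_itin cs (n := n) (L :=
    L)).
  have lw := loc_const_comp (cont_iter cs (n := n)) lW.
  exact: (loc_const_app (fun q => q.1 && q.2) (loc_const_pair lk lw)).
have PP : cmul P P = P by rewrite -PV; exact: (diag_pr_idem cs Fs lV).
have P1 : cnorm P <= 1.
  by apply: proj_norm_le1 PP _; rewrite -PV; exact: (diag_pr_star cs Fs lV).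
(* The vector z placed in column l0 over W; the product gz(z)^* gz(z) is |z|^2 P. Thus f carries xi,
   and b f carries its image eta. *)
pose gz (z : K n L -> R[i]) : mfun n L := fun w' k l =>
  (l == l0)%:R * z k * h w'.
have cgz z : mcont (gz z).
  by move=> k l; apply: continuous_mul; [exact: continuous_cst | exact: ch].
have cgs z : mcont (mstar (gz z)) := mcont_mstar (cgz z).
have sq z : cmul (cstar (rho (gz z))) (rho (gz z)) =
    (\sum_(k | in_fibre s E k w) cabs (z k) ^+ 2)%:C *: P.
  rewrite -(rho_star cs Fs (cgz z)) -(rho_mul cs Fs NL (cgs z) (cgz z)).
  rewrite -(rho_scale cs Fs _ (mcont_munit (k := l0) (l := l0) ch)).
  congr (rho _); apply/funext => w'; apply/funext => k; apply/funext => l.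
  rewrite /mmul /mstar /gz /munit /h.
  case Ww : (W w'); last first.
    by rewrite if_same mulr0 big1 // => j _; rewrite !mulr0.
  under eq_bigl => j do rewrite (dW _ _ Ww).
  case: (k == l0); last first.
    by rewrite mulr0 big1 // => j _; rewrite !mul0r conjC0 mul0r.
  case: (l == l0); last by rewrite mulr0 big1 // => j _; rewrite !mul0r mulr0.
  rewrite mulr1 rmorph_sum; apply: eq_bigr => j _.
  by rewrite !mul1r !mulr1 -cabs_sq.
pose cx k := if in_fibre s E k w then xi k else 0.
pose f := rho (gz cx).
have bf : cmul b f = rho (gz eta).
  rewrite bE -(rho_mul cs Fs NL cm (cgz cx)); congr (rho _).
  apply/funext => w'; apply/funext => k; apply/funext => l.
  rewrite /mmul /gz /h; case Ww : (W w'); last first.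
    by rewrite mulr0 big1 // => j _; rewrite !mulr0.
  under eq_bigl => j do rewrite (dW _ _ Ww).
  rewrite mulr1 /eta mulr_sumr; apply: eq_bigr => j jw.
  by rewrite mW // /cx jw mulr1 mulrCA.
have nf : cnorm f ^+ 2 <= T.
  rewrite -cnorm_star_sq sq cnormZ_cabs cabs_real.
  rewrite (eq_bigr (fun k => cabs (xi k) ^+ 2)); last by move=> k kw;
    rewrite /cx kw.
  by rewrite -/T ger0_norm // -[X in _ <= X]mulr1 ler_wpM2l.
have xx : cmul (cstar f) (cmul (cmul b b) f) = lam%:C *: P.
  by rewrite -[in LHS](cmulA b b f) cmulA -{1}sb -cstarM bf sq.
pose c' := cmul (cstar f) (cmul (cmul a a) f).
have Jc : J c' by apply: Jl; apply: Jr; exact: Jl.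
have nab : cnorm (cmul b b - cmul a a) <= cnorm a / 8 * (cnorm a * 17 / 8).
  have -> : cmul b b - cmul a a = cmul (b - a) b + cmul a (b - a).
    by rewrite cmulBl cmulBr addrA subrK.
  apply: le_trans (cnormD _ _) _.
  have := cnorm_cmul (b - a) b; have := cnorm_cmul a (b - a).
  have : cnorm b <= cnorm a + cnorm (b - a) by rewrite -{1}(subrK a b) addrC
    cnormD.
  have := cnorm_ge0 (b - a); have := cnorm_ge0 b; rewrite (cnormB b a).
  by move: ab al0; nra.
(* Here f^* b^2 f is exactly lam P, and replacing b by a moves it by at most |f|^2 |b^2 - a^2| <=
   17/64 |a|^2 T <= M^2 T < lam. *)
have close : cnorm (lam%:C *: P - c') < lam.
  rewrite -xx /c' -cmulBr -cmulBl.
  apply: le_lt_trans (cnorm_cmul _ _) _; rewrite cnorm_star.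
  apply: le_lt_trans (_ : cnorm f ^+ 2 * cnorm (cmul b b - cmul a a) < _).
    rewrite expr2 -mulrA ler_wpM2l ?cnorm_ge0 // mulrC; exact: cnorm_cmul.
  apply: le_lt_trans hxi; apply: le_trans (_ : T * (cnorm a / 8 * (cnorm a * 17
    / 8)) <= _).
    by apply: ler_pM => //; rewrite ?sqr_ge0 ?cnorm_ge0.
  by rewrite mulrC ler_wpM2r // /M; nra.
exists V; split=> //.
  have [x] : fibre_set s E l0 w by move/asboolP: kl0.
  by move=> /= kx xw; exists x; rewrite /V kx eqxx xw /W eqxx.
rewrite PV; apply: (@ideal_near_projection _ _ _ Jlin Jl Jr Jcl P ((lam^-1)%:C
  *: c') PP P1).
  by apply: (ideal_scale Jlin J0).
have -> : P - (lam^-1)%:C *: c' = (lam^-1)%:C *: (lam%:C *: P - c').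
  by rewrite scalerBr scalerA -rmorphM /= mulVf ?scale1r // gt_eqF.
rewrite cnormZ_cabs cabs_real ger0_norm; last by rewrite invr_ge0 ltW.
by rewrite mulrC ltr_pdivrMr // mul1r.
Qed.

End Simplicity.

(** * Spreading a projection along the tail relation *)

Section SpreadProjections.
Variables (R : realType) (Y : topologicalType) (s : Y -> Y) (E : nat -> Y ->
  bool).
Variable N0 : nat.
Hypothesis cs : colour_system s E N0.
Variables (F : cstarAlgType R) (iota : (Y * Y -> R[i]%C) -> F).
Hypothesis Fs : tail_cstar_completion setT s iota.
Local Open Scope complex_scope.
Local Open Scope ring_scope.
Notation K n L := {ffun 'I_n.+1 * 'I_L -> bool}.
Notation mfun n L := (Y -> K n L -> K n L -> R[i]).
Local Notation rho := (rho s E iota).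

Variable J : set F.
Hypothesis Jlin : forall (c : R[i]) a b, J a -> J b -> J (c *: a + b).
Hypothesis Jl : forall a b, J b -> J (cmul a b).
Hypothesis Jr : forall a b, J b -> J (cmul b a).
Hypothesis J0 : J 0.

(* Matrix units of R_r move 1_V into every colour class of U; the sum of the
   translates is at least 1 on U, hence invertible there. *)
Lemma ideal_spread (V U : Y -> bool) (r : nat) : loc_const V -> loc_const U ->
  (forall x, U x -> exists2 v, V v & iter r s v = iter r s x) ->
  J (diag_pr iota V) -> J (diag_pr iota U).
Proof.
move=> lV lU hU JV.
have [LV hLV] := colour_loc_const cs lV; have [LU hLU] :=
  colour_loc_const cs lU.
pose L := maxn N0 (maxn LV LU).
have NL : (N0 <= L)%N by exact: leq_maxl.
have VL : (LV <= L)%N by rewrite /L leq_max leq_max leqnn orbT.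
have UL : (LU <= L)%N by rewrite /L !leq_max leqnn !orbT.
have kcol x y : itin s E r L x = itin s E r L y -> colour E L x = colour E L y.
  by move=> /itinP /(_ 0%N (leq0n r)).
have [vK vP] : exists vK : K r L -> bool, forall x, V x = vK (itin s E r L x).
  exists (fun k => `[< exists2 x, itin s E r L x = k & V x >]) => x.
  apply/idP/asboolP => [Vx|[y /kcol /(colour_le VL) /hLV -> //]].
  by exists x.
have [uK uP] : exists uK : K r L -> bool, forall x, U x = uK (itin s E r L x).
  exists (fun k => `[< exists2 x, itin s E r L x = k & U x >]) => x.
  apply/idP/asboolP => [Ux|[y /kcol /(colour_le UL) /hLU -> //]].
  by exists x.
have c1 : continuous (fun _ : Y => 1 : R[i]^o) by exact: continuous_cst.
have cu k l : mcont (munit (fun _ : Y => 1) k l : mfun r L) :=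
  mcont_munit (k := k) (l := l) c1.
pose hk (k : K r L) (w : Y) : R[i] := (vK k && in_fibre s E k w)%:R.
have lhk k : loc_const (hk k).
  exact: (loc_const_app (fun b : bool => (vK k &&
    b)%:R : R[i]) (loc_const_in_fibre cs k)).
have chk k : continuous (hk k : Y -> R[i]^o) by apply: continuous_loc_const.
have rho_eq0 (m : mfun r L) : (forall w i j, m w i j = 0) -> rho m = 0.
  move=> m0; rewrite -(rho0 cs Fs r L); apply: rho_ext => w i j _ _; exact: m0.
(* For a word k of V, the product e_lk 1_V e_kl is the diagonal entry at (l, l) equal to 1 where k
   is present and 0 elsewhere. *)
have Jhk (k l : K r L) : J (rho (munit (hk k) l l)).
  case vk : (vK k); last first.
    by rewrite rho_eq0 // => w i j; rewrite /munit /hk vk if_same.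
  have VE : cmul (diag_pr iota V) (rho (munit (fun=>
    1) k l)) = rho (munit (fun=> 1) k l).
    rewrite (@diag_pr_rho R Y s E N0 cs F iota r L V (fun _ k => vK k) NL vP).
    have cd : mcont ((fun w i j => if (i == j) &&
      vK i then 1 else 0) : mfun r L).
      by move=> i j; exact: continuous_cst.
    rewrite -(rho_mul cs Fs NL cd (cu k l)); apply: rho_ext => w i j iw jw.
    rewrite /mmul (bigD1 i) //= eqxx big1 ?addr0; last first.
      by move=> a /andP[_ ai]; rewrite eq_sym (negbTE ai) mul0r.
    rewrite /munit; case: (i =P k) => [->|_] /=; first by rewrite vk mul1r.
    by rewrite mulr0.
  have : J (cmul (rho (munit (fun=> 1) l k)) (cmul (diag_pr iota V) (rho (munit
    (fun=> 1) k l)))).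
    by apply: Jl; exact: Jr.
  rewrite VE -(rho_mul cs Fs NL (cu l k) (cu k l)) mmul_munit.
  congr (J (rho _)); apply/funext => w; apply/funext => i; apply/funext => j.
  by rewrite /munit /hk vk !mulr1.
(* The value at w is the number of its preimages under [iter r s] that lie in V. *)
pose g w : R[i] := \sum_k hk k w.
have lg : loc_const g.
  have lf := loc_const_ffun (fun k : K r L => lhk k).
  have := loc_const_app (fun f : {ffun K r L -> R[i]} => \sum_k f k) lf.
  congr loc_const; apply/funext => w /=.
  by apply: eq_bigr => k _; rewrite ffunE.
have cg : continuous (g : Y -> R[i]^o) by apply: continuous_loc_const.
have cgi : continuous ((fun w => (g w)^-1) : Y -> R[i]^o).
  by apply: continuous_loc_const; exact: (loc_const_app (fun z => z^-1) lg).
have g0 l w : uK l -> in_fibre s E l w -> g w != 0.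
  move=> ul /asboolP[x /= xl xw].
  have [v Vv vx] : exists2 v, V v & iter r s v = w.
    by rewrite -xw; apply: hU; rewrite uP xl.
  rewrite /g (bigD1 (itin s E r L v)) //= /hk -vP Vv -vx in_fibre_itin /=.
  rewrite gt_eqF // ltr_pwDl ?ltr01 //; apply: sumr_ge0 => k _; exact: ler0n.
have Jg (l : K r L) : J (rho (munit g l l)).
  have -> : rho (munit g l l) = \sum_k rho (munit (hk k) l l).
    rewrite -(rho_sum cs Fs (fun k => mcont_munit (k := l) (l := l) (chk k))).
    congr (rho _); apply/funext => w; apply/funext => i; apply/funext => j.
    by rewrite /munit /g; case: ifP => // _; rewrite big1.
  by apply: (ideal_sum Jlin J0) => k _.
have Ju (l : K r L) : J (rho (munit (fun _ => (uK l)%:R) l l)).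
  case ul : (uK l); last first.
    by rewrite rho_eq0 // => w i j; rewrite /munit if_same.
  have : J (cmul (rho (munit (fun w => (g w)^-1) l l)) (rho (munit g l l))) by
    exact: Jl.
  rewrite -(rho_mul cs Fs NL (mcont_munit (k := l) (l := l) cgi)
     (mcont_munit (k := l) (l := l) cg)) mmul_munit.
  rewrite (@rho_ext _ _ _ _ _ iota r L _ (munit (fun=> true%:R) l l)) //.
  move=> w i j iw jw; rewrite /munit; case: ifP => // /andP[/eqP il _].
  have gw : g w != 0 by apply: (g0 l) => //; rewrite -il.
  by rewrite -il iw mul1r mulVf.
have -> : diag_pr iota U = \sum_l rho (munit (fun _ => (uK l)%:R) l l).
  rewrite (@diag_pr_rho R Y s E N0 cs F iota r L U (fun _ k => uK k) NL uP).
  have cul l : mcont (munit (fun _ : Y => (uK l)%:R) l l : mfun r L).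
    by apply: mcont_munit; exact: continuous_cst.
  rewrite -(rho_sum cs Fs cul); congr (rho _).
  apply/funext => w; apply/funext => i; apply/funext => j.
  rewrite (bigD1 i) //= /munit big1 ?addr0; last first.
    by move=> k ki; rewrite eq_sym (negbTE ki).
  by rewrite eqxx /= [j == i]eq_sym; case: (i == j); case: (uK i).
by apply: (ideal_sum Jlin J0) => l _.
Qed.

End SpreadProjections.

(** * Simplicity of a summand *)

Section SummandSimple.
Variables (R : realType) (Y : topologicalType) (s : Y -> Y) (E : nat -> Y ->
  bool).
Variable N0 : nat.
Hypothesis cs : colour_system s E N0.
Variables (F : cstarAlgType R) (iota : (Y * Y -> R[i]%C) -> F).
Hypothesis Fs : tail_cstar_completion setT s iota.
Variables (p : nat) (X : 'I_p -> set Y).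
Hypotheses (X_disj : trivIset setT X) (X_cover : \bigcup_i X i = setT).
Hypothesis X_clopen : forall i, clopen (X i).
Hypothesis X_cyclic : forall i, s @` X i = X (ordS i).
Hypothesis X_neq0 : forall i, X i !=set0.
Hypothesis X_exact : forall i, topologically_exact_on (X i) (iter p s).
Local Open Scope complex_scope.
Local Open Scope ring_scope.
Local Notation summand := (summand cs Fs X_disj X_cover X_clopen X_cyclic).
Local Notation summand_unit := (summand_unit iota X_cover).
Local Notation summand_proj := (summand_proj cs Fs X_disj X_cover X_clopen
  X_cyclic).
Local Notation pieceP := (pieceP X_disj X_cover).

Lemma diag_pr_inj V W : loc_const V -> loc_const W ->
  diag_pr iota V = diag_pr iota W -> V =1 W.
Proof.
move=> lV lW e x; have [_ _ _ h _] := Fs.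
have := h _ _ (tail_Cc_diag_ind R cs lV) (tail_Cc_diag_ind R cs lW) e.
move=> /(congr1 (fun f => f (x, x))); rewrite /diag_ind /= eqxx /=.
have h10 := oner_neq0 R[i].
by case: (V x); case: (W x) => // h01; [rewrite h01 eqxx in h10|rewrite -h01
  eqxx in h10].
Qed.

Lemma summand_simple i : simple_algebra (summand i).
Proof.
have li : loc_const (in_piece X_cover i) := @loc_const_in_piece _ _ _ X_disj
  X_cover X_clopen i.
have l0 : loc_const (fun _ : Y => false) := loc_const_app (fun _ => false) li.
split.
  exists (to_corner (summand_proj i) (summand_unit i));
    apply/eqP => /(congr1 val) /= h.
  have [x Xx] := X_neq0 i.
  have : diag_pr iota (in_piece X_cover i) = diag_pr iota (fun _ : Y => false).
    rewrite -/(summand_unit i) -(summand_unit_idem cs Fs X_disj X_cover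
      X_clopen i).
    rewrite [LHS]h -(iota0 cs Fs); congr iota.
    by apply/funext => q; rewrite /diag_ind andbF.
  move=> /(diag_pr_inj li l0) /(_ x); rewrite /in_piece.
  by move/pieceP: Xx => ->; rewrite eqxx.
move=> J [[J0 Jlin] Jcl Jid].
have [Jt|] := pselect (J = [set 0]); [by left | move=> Jn; right].
(* The image of J in [F]: as e_i is central, [F] is e_i F plus an ideal annihilated by e_i, so a
   closed ideal of the summand is also one of [F]. *)
pose J' : set F := [set y | exists2 a, J a & val a = y].
have J'0 : J' 0 by exists 0.
have J'lin (c : R[i]) a b : J' a -> J' b -> J' (c *: a + b).
  by move=> [x Jx <-] [y Jy <-]; exists (c *: x + y) => //; exact: Jlin.
have J'e y : J' y -> cmul (summand_unit i) y = y.
  by move=> [x _ <-]; exact: (@cornerP _ _ (summand_proj i) x).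
have ec := summand_unit_comm cs Fs X_disj X_cover X_clopen X_cyclic i.
have J'l a b : J' b -> J' (cmul a b).
  move=> [y Jy <-]; exists (corner_mul (to_corner (summand_proj i) a) y).
    by case: (Jid (to_corner (summand_proj i) a) y Jy).
  by rewrite val_corner_mul val_to_corner /= [LHS](_ : _ = cmul (cmul a
    (summand_unit i)) (val y)) ?ec // -cmulA (@cornerP _ _ (summand_proj i) y).
have J'r a b : J' b -> J' (cmul b a).
  move=> [y Jy <-]; exists (corner_mul y (to_corner (summand_proj i) a)).
    by case: (Jid (to_corner (summand_proj i) a) y Jy).
  by rewrite val_corner_mul val_to_corner cmulA -[X in cmul X a]ec (@cornerP _
    _ (summand_proj i) y).
have J'cl a : (forall e : R, 0 < e -> exists b,
  J' b /\ cnorm (a - b) < e) -> J' a.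
  move=> h; exists (to_corner (summand_proj i) a).
    rewrite ((closure_id J).1 Jcl); apply/closure_cnorm => e e0.
    have [b [[y Jy yb] ab]] := h e e0; exists y => //.
    have -> : cnorm (to_corner (summand_proj i) a - y) = cnorm (cmul
      (summand_unit i) a - val y) by [].
    rewrite -(@cornerP _ _ (summand_proj i) y) -cmulBr yb.
    apply: le_lt_trans (cnorm_cmul _ _) _; apply: le_lt_trans ab.
    rewrite -[X in _ <= X]mul1r ler_wpM2r ?cnorm_ge0 //.
    exact: (summand_unit_norm cs Fs X_disj X_cover X_clopen).
  rewrite val_to_corner; apply/eqP; rewrite -subr_eq0; apply/eqP/cnorm_eq0/eqP.
  rewrite eq_le cnorm_ge0 andbT; apply/ler_addgt0Pl => e e0; rewrite addr0.
  have [b [J'b ab]] := h (e / 2) (divr_gt0 e0 (ltr0Sn _ 1)).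
  have -> : cmul (summand_proj i) a - a = cmul (summand_unit i) (a - b) - (a -
    b).
    by rewrite cmulBr (J'e b J'b) opprB addrA subrK.
  apply: le_trans (cnormD _ _) _; rewrite cnormN.
  have := cnorm_cmul (summand_unit i) (a - b);
    have := summand_unit_norm cs Fs X_disj X_cover X_clopen i.
  by have := cnorm_ge0 (a - b); nra.
have [y Jy y0] : exists2 y, J' y & y != 0.
  apply: contrapT => no; apply: Jn; apply/seteqP; split=> [a Ja|a ->] //=.
  apply: contrapT => a0; apply: no; exists (val a); first by exists a.
  by apply/eqP => h; apply: a0; exact: val_inj.
have [V [lV [x0 Vx0] JV]] := ideal_contains_diag_pr cs Fs J'lin J'l J'r J'0
  J'cl Jy y0.
(* The unit of the summand fixes every element of J', so the product of 1_(X_i) and 1_V is 1_V;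
   comparing the two characteristic functions puts V inside X_i. *)
have Vi x : V x -> X i x.
  move=> Vx; have := J'e _ JV; rewrite /summand_unit (diag_pr_mul cs Fs li lV).
  have lVi : loc_const (fun x => in_piece X_cover i x && V x).
    exact: (loc_const_app (fun q : bool * bool => q.1 &&
      q.2) (loc_const_pair li lV)).
  move=> /(diag_pr_inj lVi lV) /(_ x); rewrite Vx andbT => /eqP h.
  exact/pieceP.
(* By exactness [iter (m * p) s] maps V onto X_i, so every point of X_i has the same image as some
   point of V. *)
have [|m mE] := @X_exact i _ (lV true); first by exists x0; split; [|exact: Vi].
have Je : J' (summand_unit i).
  apply: (ideal_spread cs Fs J'lin J'l J'r J'0 (r := (m * p)%N) lV li _ JV).
  move=> x /eqP /pieceP Xx.
  have : X i (iter (m * p) s x).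
    by apply/pieceP; rewrite -iter_full; elim: m {mE} => [|m IH];
      [exact/pieceP | rewrite iterS piece_full].
  rewrite -mE => -[v [Vv _] vx]; exists v; first exact: Vv.
  by rewrite -vx iter_full.
apply/seteqP; split=> // a _.
have : J' (cmul (val a) (summand_unit i)) by exact: J'l.
rewrite -ec (@cornerP _ _ (summand_proj i) a) => -[b Jb ba].
by rewrite -(val_inj ba).
Qed.

End SummandSimple.

(** * The canonical endomorphism *)

Section CanonicalEndomorphism.
Variables (R : realType) (Y : topologicalType) (s : Y -> Y) (E : nat -> Y ->
  bool).
Variable N0 : nat.
Hypothesis cs : colour_system s E N0.
Variables (F : cstarAlgType R) (iota : (Y * Y -> R[i]%C) -> F).
Hypothesis Fs : tail_cstar_completion setT s iota.
Variables (p : nat) (X : 'I_p -> set Y).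
Hypotheses (X_disj : trivIset setT X) (X_cover : \bigcup_i X i = setT).
Hypothesis X_clopen : forall i, clopen (X i).
Hypothesis X_cyclic : forall i, s @` X i = X (ordS i).
Local Open Scope complex_scope.
Local Open Scope ring_scope.
Local Notation summand := (summand cs Fs X_disj X_cover X_clopen X_cyclic).
Local Notation summand_unit := (summand_unit iota X_cover).
Local Notation summand_proj := (summand_proj cs Fs X_disj X_cover X_clopen
  X_cyclic).
Local Notation summand_incl := (@summand_incl R Y s E N0 cs F iota Fs p X
  X_disj X_cover X_clopen X_cyclic _).

Lemma loc_const_preimage_card : loc_const (preimage_card s).
Proof.
have lf := loc_const_ffun (fun k : {ffun 'I_2 * 'I_N0 -> bool} =>
  loc_const_in_fibre cs k).
have := loc_const_app (fun f : {ffun _ -> bool} => #|[pred k | f k]|) lf.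
congr loc_const; apply/funext => w; rewrite (preimage_card_fibre cs w (leqnn
  N0)) /=.
by apply: eq_card => k; rewrite !inE ffunE.
Qed.

(** The image of 1_V lives on R_1 rather than on the diagonal: it is a matrix-valued function with n
    = 1 whose entries at a given point are all equal. *)
Lemma tail_Cc_endo_diag_ind V : loc_const V ->
  tail_Cc setT s (canonical_endo_Cc s (diag_ind R V)).
Proof.
move=> lV.
pose c w : R[i] := ((Num.sqrt (preimage_card s w * preimage_card s w)%:R :
  R)^-1)%:C * (V w)%:R.
have lc : loc_const c.
  exact: (loc_const_app (fun q : nat * bool =>
    ((Num.sqrt (q.1 * q.1)%:R : R)^-1)%:C * q.2%:R) (loc_const_pair
      loc_const_preimage_card lV)).
have -> : canonical_endo_Cc s (diag_ind R V) =
   fun_of s E (fun w (k l : {ffun 'I_2 * 'I_N0 -> bool}) => c w).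
  apply/funext => -[x y]; rewrite /canonical_endo_Cc /fun_of /diag_ind /=.
  case: eqP => [->|_] /=; last by rewrite mulr0.
  by rewrite /c; case: (V _).
by apply: (tail_Cc_fun_of cs) => k l; exact: continuous_loc_const.
Qed.

(** The function giving Phi(e_i) lives on pairs (y, z) with s y in X_i, that is y in X_(i-1). Hence
    e_(i-1) Phi(e_i) = Phi(e_i), and multiplicativity extends this to Phi(x) = Phi(e_i x). *)
Lemma endo_shift (Phi : F -> F) (i : 'I_p) (x : summand i) :
  canonical_endomorphism s iota Phi ->
  exists y : summand (ord_pred i), Phi (summand_incl x) = summand_incl y.
Proof.
move=> [[_ Pmul _] PCc].
have li : loc_const (in_piece X_cover i) := @loc_const_in_piece _ _ _ X_disj
  X_cover X_clopen i.
have Pe : cmul (summand_unit (ord_pred i)) (Phi (summand_unit i)) = Phi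
  (summand_unit i).
  rewrite /summand_unit PCc; last exact: (tail_Cc_diag_ind R cs li).
  rewrite (summand_unit_iotal cs Fs X_disj X_cover X_clopen _
    (tail_Cc_endo_diag_ind li)).
  congr iota; apply/funext => -[y z]; rewrite /cutl /canonical_endo_Cc /=.
  case: ifPn => //; rewrite {1}/in_piece => h.
  rewrite /diag_ind /= /in_piece (piece_s X_disj X_cover X_cyclic).
  case: (s y =P s z) => [_|_] /=; last by rewrite mulr0.
  case: eqP => [hy|_]; last by rewrite mulr0.
  by move: h; rewrite -hy ordSK eqxx.
exists (to_corner (summand_proj (ord_pred i)) (Phi (summand_incl x))).
have xe : val x = cmul (summand_unit i) (val x) :=
  esym (@cornerP _ _ (summand_proj i) x).
change (Phi (val x) = cmul (summand_unit (ord_pred i)) (Phi (val x))).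
by rewrite xe Pmul cmulA Pe.
Qed.

End CanonicalEndomorphism.

(** The operator-algebraic half, for any space with a system of cuts; it remains to provide such a
    system for the map associated with tau. *)
Theorem tail_algebra_decomposition (R : realType) (Y : topologicalType)
    (s : Y -> Y) (E : nat -> Y -> bool) (N0 : nat) (p : nat) (X : 'I_p -> set Y)
    (F : cstarAlgType R) (iota : (Y * Y -> R[i]%C) -> F) :
  colour_system s E N0 ->
  (forall i, X i !=set0) -> trivIset setT X -> \bigcup_i X i = setT ->
  (forall i, clopen (X i)) -> (forall i, s @` X i = X (ordS i)) ->
  (forall i, topologically_exact_on (X i) (iter p s)) ->
  tail_cstar_completion setT s iota ->
  exists (A : 'I_p -> cstarAlgType R) (j : forall i, A i -> F),
    [/\ cstar_direct_sum j,
        forall i, [/\ is_tail_cstar_algebra (X i) (iter p s) (A i),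
                      simple_algebra (A i) & AF_algebra (A i)] &
        forall Phi : F -> F, canonical_endomorphism s iota Phi ->
          forall i (x : A i), exists y : A (ord_pred i),
            Phi (j i x) = j (ord_pred i) y].
Proof.
move=> cs X0 Xd Xc Xcl Xcy Xe Fs.
exists (summand cs Fs Xd Xc Xcl Xcy), (summand_incl (cs := cs) (Fs :=
  Fs) (X_disj := Xd) (X_cover := Xc)
  (X_clopen := Xcl) (X_cyclic := Xcy)).
split; first exact: summands_direct_sum.
- move=> i; split; first exact: summand_completion.
  + exact: summand_simple.
  + exact: summand_AF.
- by move=> Phi hPhi i x; exact: endo_shift.
Qed.

(** * The split interval *)

Section SplitInterval.
Variables (R : realType) (S : set R).
Local Notation X := (split_interval S).
Implicit Types (x y : X) (t u v : R).

(* [x] is some [t^+]. *)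
Definition upper x : bool := (val (x : split_order S)).2.

Definition split_at t : Prop := S t /\ 0 < t < 1.

Lemma collapse01 x : 0 <= collapse x <= 1.
Proof. by case/andP: (valP (x : split_order S)). Qed.

Lemma upper_split x : upper x -> split_at (collapse x).
Proof.
case/andP: (valP (x : split_order S)) => _ /implyP h /h /andP[/set_mem ? ?].
by split.
Qed.

Lemma split_eq x y : collapse x = collapse y -> upper x = upper y -> x = y.
Proof.
move=> e1 e2; apply: val_inj; move: e1 e2; rewrite /collapse /upper.
by case: (val x) (val y) => ? ? [? ?] /= -> ->.
Qed.

Lemma lower_subproof t : 0 <= t <= 1 -> split_carrier S (t, false).
Proof. by move=> h; rewrite /split_carrier /= h. Qed.

Definition lower_pt t (h : 0 <= t <= 1) : X :=
  exist _ (t, false) (lower_subproof h).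

Lemma upper_subproof t : split_at t -> split_carrier S (t, true).
Proof.
move=> [St t01]; apply/andP; split=> /=.
  by case/andP: t01 => /ltW -> /ltW ->.
by rewrite t01 andbT; exact: mem_set.
Qed.

Definition upper_pt t (h : split_at t) : X :=
  exist _ (t, true) (upper_subproof h).

Lemma collapse_lower t (h : 0 <= t <= 1) : collapse (lower_pt h) = t.
Proof. by []. Qed.

Lemma collapse_upper t (h : split_at t) : collapse (upper_pt h) = t.
Proof. by []. Qed.

Definition slt x y : bool := (collapse x < collapse y) ||
  (collapse x == collapse y) && (~~ upper x && upper y).

Lemma sltE (x y : split_order S) : (x < y)%O = slt x y.
Proof.
have -> : (x < y)%O = (val x < val y)%O by [].
rewrite ltEprodlexi ltEbool /slt /collapse /upper.
case: (val x) (val y) => [x1 x2] [y1 y2] /=.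
by case: (ltgtP x1 y1) => //= _; case: x2; case: y2.
Qed.

Lemma slt_open_l x : open [set y | slt y x].
Proof.
have := @lray_open _ (order_topology (split_order S)) x.
by congr open; apply/seteqP; split=> y /=; rewrite in_itv /= sltE.
Qed.

Lemma slt_open_r x : open [set y | slt x y].
Proof.
have := @rray_open _ (order_topology (split_order S)) x.
by congr open; apply/seteqP; split=> y /=; rewrite in_itv /= andbT sltE.
Qed.

Lemma slt_nbhs x (O : set X) : open O -> O x ->
  exists l r : option X, [/\ (if l is Some a then slt a x else true),
    (if r is Some b then slt x b else true) &
    forall y, (if l is Some a then slt a y else true) ->
      (if r is Some b then slt y b else true) -> O y].
Proof.
move=> oO Ox.
have : nbhs (x : order_topology (split_order S)) O by exact: open_nbhs_nbhs.
rewrite (@order_nbhs_itv _ (split_order S)) =>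
  -[[[[] a|[]] [[] b|[]]] [//= oi xi] iO].
- move: xi iO; rewrite in_itv /= !sltE => /andP[ax xb] iO.
  exists (Some a), (Some b); split=> // y ay yb; apply: iO.
  by rewrite /= in_itv /= !sltE ay yb.
- move: xi iO; rewrite in_itv /= andbT !sltE => ax iO.
  exists (Some a), None; split=> // y ay yb; apply: iO.
  by rewrite /= in_itv /= andbT !sltE ay.
- move: xi iO; rewrite in_itv /= !sltE => xb iO.
  exists None, (Some b); split=> // y ay yb; apply: iO.
  by rewrite /= in_itv /= !sltE yb.
- by exists None, None; split=> // y _ _; apply: iO.
Qed.

Lemma slt_collapse x y : collapse x < collapse y -> slt x y.
Proof. by rewrite /slt => ->. Qed.

Lemma slt_le_collapse x y : slt x y -> collapse x <= collapse y.
Proof. by move=> /orP[/ltW //|/andP[/eqP -> _]]. Qed.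

Lemma collapse_lt_open t : open [set y : X | collapse y < t].
Proof.
have [t0|t0] := leP t 0.
  rewrite (_ : [set y | _] = set0); first exact: open0.
  apply/seteqP; split=> // y /= yt; have /andP[y0 _] := collapse01 y.
  by move: (lt_le_trans yt t0); rewrite ltNge y0.
have [t1|t1] := ltP 1 t.
  rewrite (_ : [set y | _] = setT); first exact: openT.
  apply/seteqP; split=> // y _ /=; have /andP[_ y1] := collapse01 y.
  exact: le_lt_trans t1.
have t01 : 0 <= t <= 1 by rewrite ltW.
have := slt_open_l (lower_pt t01); congr open; apply/seteqP; split=> y /=.
  by rewrite /slt /collapse /upper /= !andbF orbF.
by move=> ?; exact: slt_collapse.
Qed.

(** For t in [0, 1] this is the open ray beyond t^+ when t is split, and beyond t itself
    otherwise. *)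
Lemma collapse_gt_open t : open [set y : X | t < collapse y].
Proof.
have [t0|t0] := ltP t 0.
  rewrite (_ : [set y | _] = setT); first exact: openT.
  apply/seteqP; split=> // y _ /=; have /andP[y0 _] := collapse01 y.
  exact: lt_le_trans t0 _.
have [t1|t1] := ltP 1 t.
  rewrite (_ : [set y | _] = set0); first exact: open0.
  apply/seteqP; split=> // y /= yt; have /andP[_ y1] := collapse01 y.
  by move: (lt_trans t1 yt); rewrite ltNge y1.
have t01 : 0 <= t <= 1 by rewrite t0.
have [st|nst] := pselect (split_at t).
  have := slt_open_r (upper_pt st); congr open; apply/seteqP; split=> y /=.
    by rewrite /slt /collapse /upper /= andbF orbF.
  by move=> ?; exact: slt_collapse.
have := slt_open_r (lower_pt t01); congr open; apply/seteqP; split=> y /=.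
  rewrite /slt /collapse /upper /= => /orP[//|/andP[/eqP ty uy]].
  by case: nst; rewrite ty; exact: upper_split.
by move=> ?; exact: slt_collapse.
Qed.

(* For a split point [t], this is [x <= t^-]. *)
Definition below t x : bool := (collapse x < t) || (collapse x == t) &&
  ~~ upper x.

Lemma below_clopen t : split_at t -> clopen [set x | below t x].
Proof.
move=> st; have t01 : 0 <= t <= 1 by case: st => _ /andP[/ltW -> /ltW ->].
split.
  have := slt_open_l (upper_pt st); congr open; apply/seteqP; split=> y /=;
    by rewrite /slt /below /collapse /upper /= andbT.
rewrite -openC; have := slt_open_r (lower_pt t01); congr open; apply/seteqP;
  split=> y /=.
  rewrite /slt /below /collapse /upper /= => h; apply/negP; move: h.
  case: ltgtP => //= _; by move->.
rewrite /slt /below /collapse /upper /= => /negP.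
by case: ltgtP => //= _; rewrite negbK.
Qed.

(** Any lower bound of an order interval around t^- has a strictly smaller collapse, since the only
    other point over t lies above t^-. *)
Lemma left_nbhs x (O : set X) : open O -> O x -> ~~ upper x -> 0 < collapse x ->
  exists2 e : R, 0 < e & forall y, collapse x - e < collapse y < collapse x ->
    O y.
Proof.
move=> oO Ox ux x0; have [[a|] [r [ax xr h]]] := slt_nbhs oO Ox.
  have ax' : collapse a < collapse x.
    by case/orP: ax => // /andP[_ /andP[_ ux']]; rewrite ux' in ux.
  exists (collapse x - collapse a); first by rewrite subr_gt0.
  move=> y; rewrite subKr => /andP[ay yx]; apply: h; first exact: slt_collapse.
  by case: r xr => // b xb; apply: slt_collapse;
    exact: lt_le_trans yx (slt_le_collapse xb).
exists 1 => // y /andP[_ yx]; apply: h => //.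
by case: r xr => // b xb; apply: slt_collapse;
  exact: lt_le_trans yx (slt_le_collapse xb).
Qed.

Lemma right_nbhs x (O : set X) : open O -> O x ->
  upper x \/ ~ split_at (collapse x) ->
  exists2 e : R, 0 < e & forall y, collapse x < collapse y < collapse x + e ->
    O y.
Proof.
move=> oO Ox ux; have [l [[b|] [lx xb h]]] := slt_nbhs oO Ox.
  have xb' : collapse x < collapse b.
    case/orP: xb => // /andP[/eqP e /andP[ux' ub]]; case: ux => [ux|[]].
      by rewrite ux in ux'.
    by rewrite e; exact: upper_split.
  exists (collapse b - collapse x); first by rewrite subr_gt0.
  move=> y; rewrite addrC subrK => /andP[xy yb]; apply: h;
    last exact: slt_collapse.
  by case: l lx => // a ax; apply: slt_collapse;
    exact: le_lt_trans (slt_le_collapse ax) xy.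
exists 1 => // y /andP[xy _]; apply: h => //.
by case: l lx => // a ax; apply: slt_collapse;
  exact: le_lt_trans (slt_le_collapse ax) xy.
Qed.

Lemma unsplit_nbhs x (O : set X) : open O -> O x -> ~ split_at (collapse x) ->
  exists2 e : R, 0 < e & forall y, `|collapse y - collapse x| < e -> O y.
Proof.
move=> oO Ox nx.
have ux : ~~ upper x by apply/negP => /upper_split.
have [e1 e10 h1] := right_nbhs oO Ox (or_intror nx).
have [e2 e20 h2] : exists2 e : R, 0 < e & forall y,
  collapse x - e < collapse y < collapse x -> O y.
  have [x0|x0] := ltP 0 (collapse x); first exact: left_nbhs.
  exists 1 => // y /andP[_ yx]; have /andP[y0 _] := collapse01 y.
  by move: (lt_le_trans yx x0); rewrite ltNge y0.
exists (Num.min e1 e2); first by rewrite lt_min e10.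
move=> y; rewrite lt_min ltr_norml ltr_norml => /andP[/andP[? ?] /andP[? ?]].
have [xy|yx|e] := ltgtP (collapse x) (collapse y).
- by apply: h1; apply/andP; split; lra.
- by apply: h2; apply/andP; split; lra.
- suff -> : y = x by [].
  apply: split_eq => //; rewrite (negbTE ux); apply/negbTE/negP => /upper_split.
  by rewrite -e.
Qed.

(** The image of an ultrafilter under [collapse] clusters at some t in [0, 1]. If t is split, the
    ultrafilter contains one side of the cut at t, and this decides between t^- and t^+ as its
    limit. *)
Lemma split_compact : compact [set: X].
Proof.
rewrite compact_ultra => F UF _.
have cI : compact `[(0 : R), 1] by exact: segment_compact.
have FI : F (@collapse R S @^-1` `[0, 1]%classic).
  rewrite (_ : _ @^-1` _ = setT); first exact: filterT.
  by apply/seteqP; split=> // x _; rewrite /= in_itv; exact: collapse01.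
have [t [t01 clt]] := cI (@collapse R S @ F) _ FI.
have t01' : 0 <= t <= 1 by move: t01; rewrite /= in_itv.
have Fdec (P : set X) : F P \/ F (~` P) by exact: in_ultra_setVsetC.
have Ft e : 0 < e -> F [set y : X | `|collapse y - t| < e].
  move=> e0; have [//|Fn] := Fdec [set y : X | `|collapse y - t| < e].
  have [z [zn zb]] : (~` [set z : R | `|z - t| < e]) `&` [set z : R | `|z - t|
    < e] !=set0.
    apply: clt; first exact: Fn.
    apply/nbhs_ballP; exists e => // z; rewrite /ball /= distrC; exact.
  by case: (zn zb).
have cvg_open x : (forall O : set X, open O -> O x -> F O) -> F --> x.
  by move=> h A; rewrite nbhsE => -[B [oB Bx] /filterS]; apply; exact: h.
have [st|nst] := pselect (split_at t); last first.
  exists (lower_pt t01'); split=> //; apply: cvg_open => W oW Wx.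
  have [e e0 h] := unsplit_nbhs oW Wx nst.
  by apply: filterS (Ft e e0) => y; exact: h.
have [Fb|Fb] := Fdec (below t).
  exists (lower_pt t01'); split=> //; apply: cvg_open => W oW Wx.
  have t0 : 0 < t by case: st => _ /andP[].
  have [e e0 h] := left_nbhs oW Wx isT t0.
  apply: filterS (filterI Fb (Ft e e0)) => y [/= yt].
  rewrite ltr_norml => /andP[h1 h2]; case/orP: yt => [yt|/andP[/eqP yt uy]].
    by apply: h; rewrite collapse_lower yt andbT; lra.
  by have -> : y = lower_pt t01' by apply: split_eq => //; exact: negbTE.
exists (upper_pt st); split=> //; apply: cvg_open => W oW Wx.
have [e e0 h] := right_nbhs oW Wx (or_introl isT).
apply: filterS (filterI Fb (Ft e e0)) => y [/= yt].
rewrite ltr_norml => /andP[h1 h2]; move/negP: yt; rewrite /below.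
case: ltgtP => //= yt.
  by move=> _; apply: h; rewrite collapse_upper yt; lra.
by rewrite negbK => uy; have -> : y = upper_pt st by apply: split_eq.
Qed.

(** Density handles points with different collapses; t^- and t^+ are separated by the cut at t
    itself. *)
Lemma below_separates x y : (forall u v, 0 <= u -> u < v -> v <= 1 ->
    exists2 t, split_at t & u < t < v) ->
  x <> y -> exists2 t, split_at t & below t x != below t y.
Proof.
move=> dense.
suff h a b : collapse a < collapse b -> exists2 t,
  split_at t & below t a != below t b.
  have [xy|yx|e] := ltgtP (collapse x) (collapse y).
  - by move=> _; exact: h.
  - by move=> _; have [t st tn] := h _ _ yx; exists t => //; rewrite eq_sym.
  - move=> ne; have ue : upper x != upper y by apply/eqP => ue; apply: ne;
      exact: split_eq.
    exists (collapse x); last by rewrite /below e ltxx eqxx /=;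
      case: (upper x) (upper y) ue => [] [].
    by move: ue; case ux: (upper x); case uy: (upper y) => // _; [|rewrite e];
      exact: upper_split.
move=> ab; have /andP[a0 _] := collapse01 a; have /andP[_ b1] := collapse01 b.
have [t st /andP[at' tb]] := dense _ _ a0 ab b1.
have nb : below t b = false by rewrite /below (gt_eqF tb) ltNge (ltW tb).
by exists t => //; rewrite nb /below at'.
Qed.

End SplitInterval.

(** * Piecewise monotonic maps *)

Lemma countable_setU (T : Type) (A B : set T) :
  countable A -> countable B -> countable (A `|` B).
Proof.
move=> cA cB; rewrite (_ : _ `|` _ = \bigcup_(b in [set: bool]) if b then A
  else B).
  by apply: bigcup_countable => [|[]] //; exact: countableP.
apply/seteqP; split=> x.
  by move=> [Ax|Bx]; [exists true | exists false].
by move=> [[] _ ?]; [left | right].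
Qed.

Section PiecewiseMonotonic.
Variables (R : realType) (tau : R -> R) (q : nat) (a : nat -> R).
Hypothesis pm : piecewise_monotonic tau q a.
Local Notation I1 := (I1 tau q a).
Local Notation branch := (branch tau a).
Implicit Types (x y t u v z : R) (i j : nat).

Lemma tau01 x : 0 <= x <= 1 -> 0 <= tau x <= 1.
Proof. by case: pm => h _ _ _ x01; have := h x; rewrite !in_itv /=; apply. Qed.

Lemma q_gt0 : (0 < q)%N. Proof. by case: pm => _ []. Qed.

Lemma a_0 : a 0%N = 0. Proof. by case: pm => _ []. Qed.

Lemma a_q : a q = 1. Proof. by case: pm => _ []. Qed.

Lemma a_lt i : (i < q)%N -> a i < a i.+1.
Proof. by case: pm => _ [_ _ _ h] _ _ /h. Qed.

Lemma a_le i j : (i <= j)%N -> (j <= q)%N -> a i <= a j.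
Proof.
elim: j => [|j IH]; first by rewrite leqn0 => /eqP ->.
rewrite leq_eqVlt => /orP[/eqP -> //|]; rewrite ltnS => ij jq.
by apply: le_trans (IH ij (ltnW jq)) _; exact/ltW/a_lt.
Qed.

Lemma a01 i : (i <= q)%N -> 0 <= a i <= 1.
Proof. by move=> iq; rewrite -a_0 -a_q !a_le. Qed.

Lemma a_cover x : 0 <= x <= 1 -> exists2 i, (i < q)%N & a i <= x <= a i.+1.
Proof.
move=> /andP[x0 x1].
suff h j : (0 < j <= q)%N -> x <= a j -> exists2 i,
  (i < j)%N & a i <= x <= a i.+1.
  by apply: h; rewrite ?q_gt0 ?leqnn // a_q.
elim: j => // -[_ _ xa|j IH /= jq xa]; first by exists 0%N; rewrite // a_0 x0.
have [xj|xj] := leP x (a j.+1); last by exists j.+1; rewrite // (ltW xj).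
by have [i ij h] := IH (ltnW jq) xj; exists i => //; exact: ltnW.
Qed.

Lemma itv01 i x : (i < q)%N -> a i <= x <= a i.+1 -> 0 <= x <= 1.
Proof.
move=> iq /andP[h1 h2]; have /andP[h3 _] := a01 (ltnW iq);
  have /andP[_ h4] := a01 iq.
by rewrite (le_trans h3 h1) (le_trans h2 h4).
Qed.

Lemma ooW i x : a i < x < a i.+1 -> a i <= x <= a i.+1.
Proof. by move=> /andP[/ltW -> /ltW ->]. Qed.

Lemma tau_cont i x : (i < q)%N -> a i < x < a i.+1 -> {for x, continuous tau}.
Proof.
move=> iq xi; have [_ _ h _] := pm; have [+ _] := h i iq.
rewrite continuous_open_subspace; last exact: interval_open.
by apply; rewrite inE /= in_itv.
Qed.

Lemma tau_mono i : (i < q)%N ->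
  (forall x y, a i < x < a i.+1 -> a i < y < a i.+1 -> x < y ->
    tau x < tau y) \/
  (forall x y, a i < x < a i.+1 -> a i < y < a i.+1 -> x < y -> tau y < tau x).
Proof.
move=> iq; have [_ _ h _] := pm; have [_ [inc|dec]] := h i iq;
  [left|right] => x y xi yi xy.
  by apply: inc => //; rewrite in_itv.
by apply: dec => //; rewrite in_itv.
Qed.

Lemma tau_inj i x y : (i < q)%N -> a i < x < a i.+1 -> a i < y < a i.+1 ->
  tau x = tau y -> x = y.
Proof.
move=> iq xi yi e; case: (ltgtP x y) => // xy;
  by case: (tau_mono iq) => m; [have := m _ _ xi yi xy | have :=
    m _ _ xi yi xy] ||
     (case: (tau_mono iq) => m; have := m _ _ yi xi xy); rewrite e ltxx.
Qed.

Lemma branch_eq i x l : (i < q)%N -> a i <= x <= a i.+1 ->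
  (forall e, 0 < e -> exists2 d, 0 < d &
     forall t, a i < t < a i.+1 -> `|t - x| < d -> `|tau t - l| < e) ->
  branch i x = l.
Proof.
move=> iq xi h.
(* The limit defining [branch] is determined only for a proper filter, so x has to adhere to the
   open lap, the endpoints included. *)
have cl : closure `]a i, a i.+1[%classic x.
  move=> B /nbhs_ballP[e /= e0 eB].
  have ai := a_lt iq; have /andP[x1 x2] := xi.
  have [xb|xb] := ltP x (a i.+1).
    exists (Num.min (x + e / 2) ((x + a i.+1) / 2)); split.
      rewrite /= in_itv /= lt_min gt_min; apply/andP; split; last by apply/orP;
        right; lra.
      by apply/andP; split; lra.
    apply: eB; rewrite /ball /= distrC ger0_norm ?subr_ge0 ?le_min ?ltrBlDl
      ?gt_min.
      by apply/orP; left; lra.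
    by apply/andP; split; lra.
  exists (Num.max (x - e / 2) ((a i + x) / 2)); split.
    rewrite /= in_itv /= gt_max lt_max; apply/andP; split; first by apply/orP;
      right; lra.
    by apply/andP; split; lra.
  apply: eB; rewrite /ball /= ger0_norm ?subr_ge0 ?ge_max ?ltrBlDl -?ltrBlDr
    ?lt_max.
    by apply/orP; left; lra.
  by apply/andP; split; lra.
have PF : ProperFilter (within `]a i, a i.+1[%classic (nbhs x)).
  exact: within_nbhs_proper.
apply: cvg_lim => //; apply/cvgrPdist_lt => e e0.
have [d d0 hd] := h e e0.
apply/nbhs_ballP; exists d => // t; rewrite /ball /= distrC => td;
  rewrite in_itv /= => ti.
by rewrite distrC; exact: hd.
Qed.

Lemma branch_interior i x : (i < q)%N -> a i < x < a i.+1 -> branch i x = tau x.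
Proof.
move=> iq xi; apply: branch_eq => //; first exact: ooW.
move=> e e0; have := tau_cont iq xi => /cvgrPdist_lt /(_ e e0) /nbhs_ballP[d d0
  h].
exists d => // t _ td; rewrite distrC; apply: h.
by rewrite /ball /= distrC.
Qed.

Definition lap_range i : set R := tau @` `]a i, a i.+1[%classic.

Lemma range_nonempty i : (i < q)%N -> lap_range i !=set0.
Proof.
move=> iq; exists (tau ((a i + a i.+1) / 2));
  exists ((a i + a i.+1) / 2) => //=.
by have := a_lt iq; rewrite in_itv /= => ?; apply/andP; split; lra.
Qed.

Lemma range01 i z : (i < q)%N -> lap_range i z -> 0 <= z <= 1.
Proof. by move=> iq [x /=]; rewrite in_itv /= => xi <-;
  apply/tau01/(itv01 iq)/ooW. Qed.

Lemma range_sup i : (i < q)%N -> has_sup (lap_range i).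
Proof.
move=> iq; split; first exact: range_nonempty.
by exists 1 => z /(range01 iq) /andP[].
Qed.

Lemma range_inf i : (i < q)%N -> has_inf (lap_range i).
Proof.
move=> iq; split; first exact: range_nonempty.
by exists 0 => z /(range01 iq) /andP[].
Qed.

Lemma range_le i x : (i < q)%N -> a i < x < a i.+1 ->
  inf (lap_range i) <= tau x <= sup (lap_range i).
Proof.
move=> iq xi; have rx : lap_range i (tau x) by exists x; rewrite //= in_itv.
have [_ ub] := range_sup iq; have [_ lb] := range_inf iq.
by rewrite (ge_inf lb rx) (ub_le_sup ub rx).
Qed.

(** Monotonicity makes the one-sided limits the extreme values. It follows that these lie in I_1
    ([I1_inf_sup]), so that the image of a lap is again bounded by cuts or by 0 and 1. *)
Lemma branch_endpoints i : (i < q)%N ->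
  (branch i (a i) = inf (lap_range i) /\ branch i (a i.+1) = sup (lap_range i))
    \/
  (branch i (a i) = sup (lap_range i) /\ branch i (a i.+1) = inf (lap_range i)).
Proof.
move=> iq.
have ha : a i <= a i <= a i.+1 by rewrite lexx (ltW (a_lt iq)).
have hb : a i <= a i.+1 <= a i.+1 by rewrite lexx (ltW (a_lt iq)).
have adh_inf e : 0 < e -> exists2 x0, a i < x0 < a i.+1 & tau x0 < inf
  (lap_range i) + e.
  move=> e0; have [_ [x0 /= x0i <-] h] := inf_adherent e0 (range_inf iq).
  by exists x0; rewrite // in_itv in x0i.
have adh_sup e : 0 < e -> exists2 x0, a i < x0 < a i.+1 & sup (lap_range i) - e
  < tau x0.
  move=> e0; have [_ [x0 /= x0i <-] h] := sup_adherent e0 (range_sup iq).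
  by exists x0; rewrite // in_itv in x0i.
case: (tau_mono iq) => m; [left|right]; split; apply: branch_eq => // e e0.
- have [x0 x0i h] := adh_inf e e0; exists (x0 - a i); first by case/andP: x0i;
    lra.
  move=> t ti; have := range_le iq ti; have := ti; rewrite ltr_norml ltr_norml.
  move=> /andP[? ?] /andP[? ?] /andP[? ?].
  have := m t x0 ti x0i; rewrite (_ : t < x0 = true); last lra.
  by move=> /(_ isT) ?; apply/andP; split; lra.
- have [x0 x0i h] := adh_sup e e0; exists (a i.+1 - x0);
    first by case/andP: x0i; lra.
  move=> t ti; have := range_le iq ti; have := ti; rewrite ltr_norml ltr_norml.
  move=> /andP[? ?] /andP[? ?] /andP[? ?].
  have := m x0 t x0i ti; rewrite (_ : x0 < t = true); last lra.
  by move=> /(_ isT) ?; apply/andP; split; lra.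
- have [x0 x0i h] := adh_sup e e0; exists (x0 - a i); first by case/andP: x0i;
    lra.
  move=> t ti; have := range_le iq ti; have := ti; rewrite ltr_norml ltr_norml.
  move=> /andP[? ?] /andP[? ?] /andP[? ?].
  have := m t x0 ti x0i; rewrite (_ : t < x0 = true); last lra.
  by move=> /(_ isT) ?; apply/andP; split; lra.
- have [x0 x0i h] := adh_inf e e0; exists (a i.+1 - x0);
    first by case/andP: x0i; lra.
  move=> t ti; have := range_le iq ti; have := ti; rewrite ltr_norml ltr_norml.
  move=> /andP[? ?] /andP[? ?] /andP[? ?].
  have := m x0 t x0i ti; rewrite (_ : x0 < t = true); last lra.
  by move=> /(_ isT) ?; apply/andP; split; lra.
Qed.

Lemma inf01 i : (i < q)%N -> 0 <= inf (lap_range i) <= 1.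
Proof.
move=> iq; have [[z rz] lb] := range_inf iq; have /andP[z0 z1] := range01 iq rz.
apply/andP; split; last exact: le_trans (ge_inf lb rz) z1.
by apply: lb_le_inf; [exists z | move=> y /(range01 iq) /andP[]].
Qed.

Lemma sup01 i : (i < q)%N -> 0 <= sup (lap_range i) <= 1.
Proof.
move=> iq; have [[z rz] ub] := range_sup iq; have /andP[z0 z1] := range01 iq rz.
apply/andP; split; first exact: le_trans z0 (ub_le_sup ub rz).
by apply: ge_sup; [exists z | move=> y /(range01 iq) /andP[]].
Qed.

Lemma itv_cases i x : a i <= x <= a i.+1 -> [\/ x = a i,
  x = a i.+1 | a i < x < a i.+1].
Proof.
move=> /andP[]; rewrite !le_eqVlt => /orP[/eqP <-|h1]; first by constructor 1.
by move=> /orP[/eqP ->|h2]; [constructor 2 | constructor 3; rewrite h1].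
Qed.

Lemma branch01 i x : (i < q)%N -> a i <= x <= a i.+1 -> 0 <= branch i x <= 1.
Proof.
move=> iq xi; case: (itv_cases xi) => [->|->|xo].
- by case: (branch_endpoints iq) => -[-> _]; [exact: inf01 | exact: sup01].
- by case: (branch_endpoints iq) => -[_ ->]; [exact: sup01 | exact: inf01].
- by rewrite branch_interior //; apply/tau01/(itv01 iq).
Qed.

Lemma tau_itv i u v z : (i < q)%N -> a i < u -> u <= v -> v < a i.+1 ->
  Num.min (tau u) (tau v) <= z <= Num.max (tau u) (tau v) ->
  exists2 x, u <= x <= v & tau x = z.
Proof.
move=> iq au uv va hz.
have [|x] := @IVT R tau u v z uv _ hz; last by rewrite in_itv; exists x.
apply: continuous_in_subspaceT => x; rewrite inE /= in_itv /= => /andP[ux xv].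
by apply: (tau_cont iq); rewrite (lt_le_trans au ux) (le_lt_trans xv va).
Qed.

Lemma range_itv i z : (i < q)%N ->
  inf (lap_range i) < z < sup (lap_range i) <-> exists2 x,
    a i < x < a i.+1 & tau x = z.
Proof.
move=> iq; split=> [/andP[z1 z2]|[x xi <-]].
  have [_ [x1 /= + <-] h1] := inf_lt (range_nonempty iq) z1.
  have [_ [x2 /= + <-] h2] := sup_gt (range_nonempty iq) z2.
  rewrite !in_itv /= => /andP[x2a x2b] /andP[x1a x1b].
  have [x12|x21] := leP x1 x2.
    have [|x /andP[? ?] <-] := @tau_itv i x1 x2 z iq x1a x12 x2b.
      by rewrite ge_min le_max (ltW h1) (ltW h2) orbT.
    by exists x => //; apply/andP; split; lra.
  have [|x /andP[? ?] <-] := @tau_itv i x2 x1 z iq x2a (ltW x21) x1b.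
    by rewrite ge_min le_max (ltW h1) (ltW h2) orbT.
  by exists x => //; apply/andP; split; lra.
have /andP[xa xb] := xi.
pose x1 := (a i + x) / 2; pose x2 := (x + a i.+1) / 2.
have x1i : a i < x1 < a i.+1 by rewrite /x1; apply/andP; split; lra.
have x2i : a i < x2 < a i.+1 by rewrite /x2; apply/andP; split; lra.
have x1x : x1 < x by rewrite /x1; lra.
have xx2 : x < x2 by rewrite /x2; lra.
have /andP[h1 h1'] := range_le iq x1i; have /andP[h2 h2'] := range_le iq x2i.
case: (tau_mono iq) => m; have := m _ _ x1i xi x1x;
  have := m _ _ xi x2i xx2 => ? ?;
  by apply/andP; split; lra.
Qed.

Lemma inf_lt_sup i : (i < q)%N -> inf (lap_range i) < sup (lap_range i).
Proof.
move=> iq; have := a_lt iq => aa.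
have h : a i < (a i + a i.+1) / 2 < a i.+1 by apply/andP; split; lra.
have /andP[h1 h2] : inf (lap_range i) < tau ((a i + a i.+1) / 2) < sup
  (lap_range i).
  by apply/(range_itv _ iq); exists ((a i + a i.+1) / 2).
exact: lt_trans h1 h2.
Qed.

Let invariant_set (A : set R) := [/\ A `<=` `[0, 1]%classic,
  hat_image tau q a A `<=` A & hat_preimage tau q a A `<=` A].

Lemma I1_partition i : (i <= q)%N -> I1 (a i).
Proof. by move=> iq A [_]; apply; exists i. Qed.

Lemma I1_min (A : set R) : invariant_set A -> partition_points q a `<=` A ->
  I1 `<=` A.
Proof. by move=> iA pA x; apply. Qed.

Lemma I1_branch i x : (i < q)%N -> a i <= x <= a i.+1 -> I1 x <->
  I1 (branch i x).
Proof.
move=> iq xi; split=> Ix A [iA pA]; have := Ix A (conj iA pA) => Ax;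
  case: iA => _ fwd bwd.
  by apply: fwd; exists i => //; exists x => //; split=> //=; rewrite in_itv.
by apply: bwd; exists i => //; split=> //=; rewrite in_itv.
Qed.

Lemma I1_tau i x : (i < q)%N -> a i < x < a i.+1 -> I1 x <-> I1 (tau x).
Proof. by move=> iq xi; rewrite -(branch_interior iq xi);
  apply/I1_branch => //; exact: ooW. Qed.

Lemma I1_inf_sup i : (i < q)%N -> I1 (inf (lap_range i)) /\
  I1 (sup (lap_range i)).
Proof.
move=> iq; have ha : a i <= a i <= a i.+1 by rewrite lexx (ltW (a_lt iq)).
have hb : a i <= a i.+1 <= a i.+1 by rewrite lexx (ltW (a_lt iq)).
have ia := (I1_branch iq ha).1 (I1_partition (ltnW iq)).
have ib := (I1_branch iq hb).1 (I1_partition iq).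
by case: (branch_endpoints iq) => -[<- <-].
Qed.

(** One round of images and preimages. The iterates starting at the partition points have an
    invariant union, and each is countable; this bounds I_1 from above. *)
Definition hat_closure (A : set R) : set R := hat_image tau q a A `|`
  hat_preimage tau q a A.

Let orbit_set k : set R := iter k hat_closure (partition_points q a).

Lemma hat_closure01 A : hat_closure A `<=` `[0, 1]%classic.
Proof.
move=> x [[i /= iq [y [_ yi] <-]]|[i /= iq [xi _]]]; rewrite /= in_itv /=.
  by apply: branch01 => //; move: yi; rewrite /= in_itv.
by apply: (itv01 iq); move: xi; rewrite /= in_itv.
Qed.

Lemma countable_partition : countable (partition_points q a).
Proof.
apply: (sub_countable (B := `I_q.+1)); last exact: countableP.
exact: card_image_le.
Qed.

Lemma hat_closure_countable A : countable A -> countable (hat_closure A).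
Proof.
move=> cA; apply: countable_setU.
  apply: bigcup_countable => [|i _]; first exact: countableP.
  apply: sub_countable (card_image_le _ _) _.
  by apply: sub_countable cA; apply: subset_card_le => x [].
apply: bigcup_countable => [|i iq]; first exact: countableP.
(* On the open lap [tau] is injective, so a countable set has countably many preimages there; the
   endpoints add only partition points. *)
have cI : countable [set x | a i < x < a i.+1 /\ A (tau x)].
  have inj : {in [set x | a i < x < a i.+1 /\ A (tau x)] &, injective tau}.
    by move=> x y /set_mem[xi _] /set_mem[yi _]; exact: (tau_inj iq).
  rewrite -(eq_countable (inj_card_eq inj)).
  by apply: sub_countable cA; apply: subset_card_le => _ [x [_ Ax] <-].
apply: sub_countable (countable_setU countable_partition cI).
apply: subset_card_le => x [/= xi Ax]; rewrite in_itv /= in xi.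
case: (itv_cases xi) => [->|->|xo].
- by left; exists i => //=; exact: ltnW.
- by left; exists i.+1.
- by right; split=> //; rewrite -(branch_interior iq xo).
Qed.

Lemma I1_sub_orbit : I1 `<=` \bigcup_k orbit_set k.
Proof.
apply: I1_min; last by move=> x Cx; exists 0%N.
split.
- move=> x [[|k] _]; last exact: hat_closure01.
  by move=> [i /= iq <-]; rewrite /= in_itv /=; exact: a01.
- move=> _ [i iq [x [[k _ xk] xi] <-]]; exists k.+1 => //.
  by left; exists i => //; exists x.
- move=> x [i iq [xi [k _ xk]]]; exists k.+1 => //.
  by right; exists i.
Qed.

Lemma I1_countable : countable I1.
Proof.
apply: sub_countable (subset_card_le I1_sub_orbit) _.
apply: bigcup_countable => [|k _]; first exact: countableP.
elim: k => [|k IH]; first exact: countable_partition.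
exact: hat_closure_countable.
Qed.

Lemma I1_01 x : I1 x -> 0 <= x <= 1.
Proof.
move=> /I1_sub_orbit[[|k] _].
  by move=> [i /= iq <-]; exact: a01.
by move=> /hat_closure01; rewrite /= in_itv.
Qed.

(** Being countable, I_1 is Lebesgue null and contains no interval. *)
Lemma I0_dense u v : 0 <= u -> u < v -> v <= 1 -> exists2 t, u < t < v & ~ I1 t.
Proof.
move=> u0 uv v1; apply: contrapT => no.
have sub : `]u, v[%classic `<=` I1.
  move=> t /=; rewrite in_itv /= => tuv; apply: contrapT => nt.
  by apply: no; exists t.
have := countable_lebesgue_measure0 (sub_countable (subset_card_le sub)
  I1_countable).
rewrite lebesgue_measure_itv /= lte_fin uv -EFinD => -[]; lra.
Qed.

End PiecewiseMonotonic.

(** * The associated local homeomorphism *)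

Section AssociatedMap.
Variables (R : realType) (tau : R -> R) (q : nat) (a : nat -> R).
Hypothesis pm : piecewise_monotonic tau q a.
Local Notation I1 := (I1 tau q a).
Local Notation X := (split_interval I1).
Variable sigma : X -> X.
Hypothesis sigma_tau : associated_map sigma.
Implicit Types (x y z w : X) (t u v : R) (i : nat).

Lemma I1_notsplit t : ~ I1 t -> ~ split_at I1 t.
Proof. by move=> nt []. Qed.

Lemma notI1_upper x : ~ I1 (collapse x) -> upper x = false.
Proof. by move=> nx; apply/negP => /upper_split[]. Qed.

Lemma sigma_cont : continuous sigma. Proof. by case: sigma_tau. Qed.

Lemma collapse_sigma x : ~ I1 (collapse x) -> collapse (sigma x) = tau
  (collapse x).
Proof.
move=> nx; case: sigma_tau => _; apply; split=> //.
by rewrite /= in_itv /= collapse01.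
Qed.

Lemma below_mono u v x : u <= v -> below u x -> below v x.
Proof.
rewrite /below => uv /orP[xu|/andP[/eqP xu ux]];
  first by rewrite (lt_le_trans xu uv).
by rewrite xu ux andbT orbC -le_eqVlt.
Qed.

Lemma below_notI1 u x : I1 u -> ~ I1 (collapse x) ->
  below u x = (collapse x < u).
Proof.
move=> Iu nx; rewrite /below; case: eqP => [xu|_]; last by rewrite orbF.
by case: nx; rewrite xu.
Qed.

(* The interval from [u^+] to [v^-], where [0^+ = 0] and [1^- = 1]. *)
Definition cell u v x : bool := ((u == 0) || ~~ below u x) &&
  ((v == 1) || below v x).

Lemma cell_clopen u v : I1 u -> I1 v -> u < v -> clopen [set x | cell u v x].
Proof.
move=> Iu Iv uv; have /andP[u0 _] := I1_01 pm Iu;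
  have /andP[_ v1] := I1_01 pm Iv.
have cu : clopen [set x : X | (u == 0) || ~~ below u x].
  case: (u =P 0) => [_|/eqP un] /=.
    by rewrite (_ : [set x | _] = setT); [exact: clopenT | apply/seteqP; split].
  have su : split_at I1 u by split=> //; rewrite lt0r un u0 (lt_le_trans uv v1).
  have := clopenC setT (below_clopen su); congr clopen.
  by apply/seteqP; split=> x /negP.
have cv : clopen [set x : X | (v == 1) || below v x].
  case: (v =P 1) => [_|/eqP vn] /=.
    by rewrite (_ : [set x | _] = setT); [exact: clopenT | apply/seteqP; split].
  have sv : split_at I1 v by split=> //; rewrite (le_lt_trans u0 uv) lt_neqAle
    vn v1.
  exact: (below_clopen sv).
have := clopenI cu cv; congr clopen.
by apply/seteqP; split=> x /andP.
Qed.

Lemma cell_sub u v x : I1 u -> I1 v -> ~ I1 (collapse x) ->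
  u < collapse x < v -> cell u v x.
Proof.
move=> Iu Iv nx /andP[ux xv]; rewrite /cell !below_notI1 // xv orbT andbT.
by rewrite -leNgt (ltW ux) orbT.
Qed.

(** The values of sigma are prescribed only over I_0; this density lets continuity reach every point
    of a cell. Points t^- are approached from the left and points t^+ from the right, which stays in
    the cell. *)
Lemma cell_dense u v x (O : set X) : I1 u -> I1 v -> u < v -> cell u v x ->
  open O -> O x -> exists y, [/\ O y, ~ I1 (collapse y) & u < collapse y < v].
Proof.
move=> Iu Iv uv /andP[cu cv] oO Ox.
have /andP[u0 _] := I1_01 pm Iu; have /andP[_ v1] := I1_01 pm Iv.
have /andP[x0 x1] := collapse01 x.
have ux : u <= collapse x.
  case/orP: cu => [/eqP -> //|]; rewrite /below negb_or -leNgt => /andP[]; auto.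
have xv : collapse x <= v.
  case/orP: cv => [/eqP -> //|/orP[/ltW //|/andP[/eqP -> _]]]; exact: lexx.
have right : (upper x \/ ~ split_at I1 (collapse x)) -> collapse x < v ->
    exists y, [/\ O y, ~ I1 (collapse y) & u < collapse y < v].
  move=> rx xv'; have [e e0 h] := right_nbhs oO Ox rx.
  have [||t /andP[t1 t2] nt] := I0_dense pm x0 (v :=
    Num.min v (collapse x + e)).
  - by rewrite lt_min xv' ltrDl.
  - by rewrite ge_min v1.
  move: t2; rewrite lt_min => /andP[t2 t3].
  have t01 : 0 <= t <= 1 by rewrite (le_trans x0 (ltW t1)) (le_trans (ltW t2)
    v1).
  exists (lower_pt I1 t01); split=> //.
    by apply: h; rewrite collapse_lower t1.
  by rewrite collapse_lower t2 (le_lt_trans ux t1).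
have [xu|xu] := eqVneq (collapse x) u.
  apply: right; last by rewrite xu.
  case/orP: cu => [/eqP u00|].
    by right; move=> [_]; rewrite xu u00 ltxx.
  by rewrite /below xu eqxx ltxx /= negbK; left.
have ux' : u < collapse x by rewrite lt_neqAle eq_sym xu ux.
case ux2 : (upper x).
  apply: right; first by left.
  case/orP: cv => [/eqP v11|]; first by rewrite v11;
    have [_ /andP[]] := upper_split ux2.
  by rewrite /below ux2 andbF orbF.
have [|e e0 h] := left_nbhs oO Ox (negbT ux2); first exact: le_lt_trans u0 ux'.
have [||t /andP[t1 t2] nt] := I0_dense pm (u :=
  Num.max u (collapse x - e)) (v := collapse x) _ _ x1.
- by rewrite le_max u0.
- by rewrite gt_max ux' ltrBlDr ltrDl.
move: t1; rewrite gt_max => /andP[t1 t3].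
have t01 : 0 <= t <= 1 by rewrite (le_trans u0 (ltW t1)) (le_trans (ltW t2) x1).
exists (lower_pt I1 t01); split=> //.
  by apply: h; rewrite collapse_lower t3.
by rewrite collapse_lower t1 (lt_le_trans t2 xv).
Qed.

Lemma cell_cover x : exists2 i, (i < q)%N & cell (a i) (a i.+1) x.
Proof.
suff h j : (0 < j <= q)%N -> (a j == 1) || below (a j) x ->
    exists2 i, (i < j)%N & cell (a i) (a i.+1) x.
  by apply: (h q); rewrite ?(q_gt0 pm) ?leqnn // (a_q pm) eqxx.
elim: j => // -[_ _ xa|j IH /= jq xa]; first by exists 0%N;
  rewrite // /cell (a_0 pm) eqxx.
case bx : (below (a j.+1) x).
  have [|i ij h] := IH (ltnW jq); first by rewrite bx orbT.
  by exists i => //; exact: ltnW.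
by exists j.+1 => //; rewrite /cell bx orbT.
Qed.

Local Notation lo i := (inf (lap_range tau a i)).
Local Notation hi i := (sup (lap_range tau a i)).

Lemma sigma_interior i y : (i < q)%N -> ~ I1 (collapse y) ->
  a i < collapse y < a i.+1 ->
  [/\ collapse (sigma y) = tau (collapse y), ~ I1 (collapse (sigma y)) &
      lo i < collapse (sigma y) < hi i].
Proof.
move=> iq ny yi; have e := collapse_sigma ny; split=> //.
  by rewrite e => /(I1_tau pm iq yi).
by rewrite e; apply/(range_itv pm _ iq); exists (collapse y).
Qed.

Lemma cell_I1 i : (i < q)%N -> [/\ I1 (a i), I1 (a i.+1) & a i < a i.+1].
Proof. by move=> iq; split; [by apply: I1_partition;
  exact: ltnW | exact: I1_partition | exact: (a_lt pm iq)]. Qed.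

Lemma range_I1 i : (i < q)%N -> [/\ I1 (lo i), I1 (hi i) & lo i < hi i].
Proof. by move=> iq; have [? ?] := I1_inf_sup pm iq; split=> //;
  exact: (inf_lt_sup pm iq). Qed.

Hypothesis I1_dense : forall u v, 0 <= u -> u < v -> v <= 1 ->
  exists2 t, split_at I1 t & u < t < v.

Lemma split_hausdorff : hausdorff_space X.
Proof.
rewrite open_hausdorff => x y /eqP xy.
have [t st txy] := below_separates I1_dense xy.
have lt := loc_const_bool (below_clopen st).
exists (below t @^-1` [set below t x], below t @^-1` [set below t y]);
  first by rewrite !inE.
split=> /=; [exact: lt | exact: lt |].
by apply/eqP/seteqP; split=> // z /= [e1 e2]; move: txy; rewrite -e1 -e2 eqxx.
Qed.

Lemma image_closed (A : set X) : closed A -> closed (sigma @` A).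
Proof.
move=> cA; apply: (compact_closed split_hausdorff); apply: continuous_compact.
  by apply: continuous_subspaceT => x; exact: sigma_cont.
by apply: subclosed_compact (@split_compact R I1) _.
Qed.

(** Over I_0 this is [range_itv]. By density the image stays in the clopen target, and it fills the
    target because it is closed. *)
Lemma sigma_cell i : (i < q)%N -> sigma @` [set x | cell (a i) (a i.+1) x] =
  [set x | cell (lo i) (hi i) x].
Proof.
move=> iq; have [Ia Ib ab] := cell_I1 iq; have [Il Ih lh] := range_I1 iq.
have cc := cell_clopen Il Ih lh.
apply/seteqP; split=> [_ [x /= xi <-]|z /= zi]; apply: contrapT => nz.
  have oW : open (sigma @^-1` [set x | ~ cell (lo i) (hi i) x]).
    by move/continuousP: sigma_cont; apply; apply: closed_openC; exact: cc.2.
  have [y [/= ny Iy yi]] := cell_dense Ia Ib ab xi oW nz.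
  have [_ ? ?] := sigma_interior iq Iy yi.
  by apply: ny; exact: cell_sub.
have oW : open (~` (sigma @` [set x | cell (a i) (a i.+1) x])).
  by apply: closed_openC; apply: image_closed; exact: (cell_clopen Ia Ib ab).2.
have [w [/= nw Iw wi]] := cell_dense Il Ih lh zi oW nz.
have [t ti tw] := (range_itv pm _ iq).1 wi.
have nt : ~ I1 t by rewrite (I1_tau pm iq ti) tw.
have t01 : 0 <= t <= 1 := itv01 pm iq (ooW ti).
apply: nw; exists (lower_pt I1 t01); first exact: cell_sub.
have [e Is _] := sigma_interior (y := lower_pt I1 t01) iq nt ti.
by apply: split_eq; rewrite ?e // !notI1_upper.
Qed.

Lemma split_tau i t : (i < q)%N -> I1 t -> a i < t < a i.+1 ->
  split_at I1 (tau t).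
Proof.
move=> iq It ti; split; first exact/(I1_tau pm iq ti).
have /andP[l h] : lo i < tau t < hi i by apply/(range_itv pm _ iq); exists t.
have /andP[l0 _] := inf01 pm iq; have /andP[_ h1] := sup01 pm iq.
by rewrite (le_lt_trans l0 l) (lt_le_trans h h1).
Qed.

(** On a cell sigma carries the cut at t to the cut at tau t, and [c] records the reversal on a
    decreasing lap. The cuts are locally constant, so it suffices to look over I_0. *)
Lemma below_sigma i t : (i < q)%N -> I1 t -> a i < t < a i.+1 ->
  exists c : bool, forall x, cell (a i) (a i.+1) x ->
    below (tau t) (sigma x) = c (+) below t x.
Proof.
move=> iq It ti; have [Ia Ib ab] := cell_I1 iq.
have stt := split_tau iq It ti.
have st : split_at I1 t.
  split=> //; have /andP[ta tb] := ti; have /andP[a0 _] := a01 pm (ltnW iq).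
  by have /andP[_ b1] := a01 pm iq; rewrite (le_lt_trans a0 ta) (lt_le_trans tb
    b1).
have l1 := loc_const_bool (below_clopen st);
  have l2 := loc_const_bool (below_clopen stt).
have near x : cell (a i) (a i.+1) x -> exists y, [/\ below t x = below t y,
    below (tau t) (sigma x) = below (tau t) (sigma y), ~ I1 (collapse y) &
    a i < collapse y < a i.+1].
  move=> xi.
  have oW : open ((below t @^-1` [set below t x]) `&`
      (sigma @^-1` (below (tau t) @^-1` [set below (tau t) (sigma x)]))).
    by apply: openI; [exact: l1 | move/continuousP: sigma_cont; apply;
      exact: l2].
  by have [y [[/= e1 e2] Iy yi]] := cell_dense Ia Ib ab xi oW (conj erefl
    erefl); exists y.
case: (tau_mono pm iq) => m; [exists false | exists true] => x /near[y [-> ->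
  Iy yi]];
  have [es Is _] := sigma_interior iq Iy yi;
  rewrite !below_notI1 ?es //; try exact: stt.1; try by rewrite -es.
- have yt : collapse y != t by apply/eqP => e; apply: Iy; rewrite e.
  rewrite /=; case: (ltgtP (collapse y) t) yt => // yt _; first by rewrite m.
  by apply/negbTE; rewrite -leNgt ltW // m.
- have yt : collapse y != t by apply/eqP => e; apply: Iy; rewrite e.
  rewrite /=; case: (ltgtP (collapse y) t) yt => // yt _; last by rewrite m.
  by apply/negbTE; rewrite -leNgt ltW // m.
Qed.

(** Two points of a cell are separated by a cut at some t in the open lap, as cuts elsewhere do not
    divide the cell; their images are then separated by the cut at tau t. *)
Lemma sigma_inj i x y : (i < q)%N -> cell (a i) (a i.+1) x ->
  cell (a i) (a i.+1) y ->
  sigma x = sigma y -> x = y.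
Proof.
move=> iq xi yi e; apply: contrapT => /(below_separates I1_dense)[t [It t01]
  txy].
have ti : a i < t < a i.+1.
  have /andP[xa xb] := xi; have /andP[ya yb] := yi; have /andP[t0 t1] := t01.
  have [ta|ta] := leP t (a i).
    have h z : cell (a i) (a i.+1) z -> below t z = false.
      move=> /andP[/orP[/eqP a0|nz] _]; first by move: ta; rewrite a0 leNgt t0.
      by apply/negP => /(below_mono ta); exact/negP.
    by rewrite !h in txy.
  have [tb|//] := leP (a i.+1) t.
  have h z : cell (a i) (a i.+1) z -> below t z = true.
    move=> /andP[_ /orP[/eqP b1|bz]]; first by move: tb; rewrite b1 leNgt t1.
    exact: (below_mono tb bz).
  by rewrite !h in txy.
have [c hc] := below_sigma iq It ti.
by move: (hc x xi) (hc y yi) txy; rewrite e => -> /addbI ->; rewrite eqxx.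
Qed.

Lemma sigma_open (O : set X) : open O -> open (sigma @` O).
Proof.
move=> oO.
(* Injectivity on a cell turns the image of its part in O into the image of the cell minus the image
   of the rest, which is closed. *)
have -> : sigma @` O = \bigcup_(i in `I_q) ([set x | cell (lo i) (hi i) x] `&`
    ~` (sigma @` ([set x | cell (a i) (a i.+1) x] `&` ~` O))).
  apply/seteqP; split=> [_ [x Ox <-]|z [i /= iq [zi nz]]].
    have [i iq xi] := cell_cover x; exists i => //; split.
      have : (sigma @` [set x | cell (a i) (a i.+1) x]) (sigma x) by exists x.
      by rewrite sigma_cell.
    move=> [y [yi nOy] e]; apply: nOy.
    by rewrite (sigma_inj iq yi xi e).
  have : [set x | cell (lo i) (hi i) x] z by [].
  rewrite -sigma_cell // => -[x xi xz]; exists x => //.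
  by apply: contrapT => nOx; apply: nz; exists x.
apply: bigcup_open => i /= iq.
have [Ia Ib ab] := cell_I1 iq; have [Il Ih lh] := range_I1 iq.
apply: openI; first exact: (cell_clopen Il Ih lh).1.
apply: closed_openC; apply: image_closed; apply: closedI;
  last exact: open_closedC.
exact: (cell_clopen Ia Ib ab).2.
Qed.

(* The colours are the cuts below a split point, enumerated. *)
Lemma split_colours : exists E N0, colour_system sigma E N0.
Proof.
have /countable_injP[f /= finj] : countable [set t | split_at I1 t].
  by apply: sub_countable (I1_countable pm); apply: subset_card_le => t [].
have /choice[en enE] : forall k : nat, exists c : option R,
    (forall t, c = Some t -> split_at I1 t) /\
    (forall t, split_at I1 t -> f t = k -> c = Some t).
  move=> k; have [[t [st ft]]|no] :=
    pselect (exists t, split_at I1 t /\ f t = k).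
    exists (Some t); split=> [_ [<-] //|t' st' ft']; congr Some.
    by apply: finj; rewrite ?inE // ft ft'.
  by exists None; split=> // t st ft; case: no; exists t.
have enP t : split_at I1 t -> en (f t) = Some t by move=> st;
  exact: (enE (f t)).2.
have en_split k t : en k = Some t -> split_at I1 t := (enE k).1 t.
(* Indices that code no split point receive the trivial cut. *)
pose E k x : bool := if en k is Some t then below t x else true.
(* Beyond the codes of all interior partition points, so that the first N0 cuts decide in which cell
   a point lies. *)
pose N0 := (\max_(i < q) f (a i)).+1.
exists E, N0; split.
- exact: split_compact.
- move=> k; case ek : (en k) => [t|].
    have := below_clopen (en_split _ _ ek); congr clopen.
    by apply/seteqP; split=> x; rewrite /= /E ek.
  rewrite (_ : [set x | E k x] = setT); first exact: clopenT.
  by apply/seteqP; split=> // x _; rewrite /= /E ek.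
- move=> x y h; apply: contrapT => /(below_separates I1_dense)[t st].
  by have := h (f t); rewrite /E (enP _ st) => ->; rewrite eqxx.
- exact: sigma_cont.
- exact: sigma_open.
- move=> x y h; have [i iq xi] := cell_cover x; apply: (sigma_inj iq xi).
  have ba k : (k < q)%N -> a k != 0 -> below (a k) x = below (a k) y.
    move=> kq ak0; have /andP[a0 _] := a01 pm (ltnW kq).
    have sa : split_at I1 (a k).
      split; first by apply: I1_partition; exact: ltnW.
      rewrite lt0r ak0 a0 -(a_q pm); apply: lt_le_trans (a_lt pm kq) _.
      exact: (a_le pm).
    have := h (f (a k)); rewrite /E (enP _ sa); apply.
    by rewrite ltnS; apply: (leq_bigmax (Ordinal kq)).
  move: xi; rewrite /cell => /andP[c1 c2]; apply/andP; split.
    by have [//|ai0] := eqVneq (a i) 0; rewrite -ba //; move: c1;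
      rewrite (negbTE ai0).
  have [//|b1] := eqVneq (a i.+1) 1; move: c2; rewrite (negbTE b1) /= => c2.
  have iq1 : (i.+1 < q)%N.
    rewrite ltn_neqAle iq andbT; apply: contra b1 => /eqP ->;
      by rewrite (a_q pm).
  rewrite -ba //; have /andP[a0 _] := a01 pm (ltnW iq).
  by rewrite gt_eqF // (le_lt_trans a0 (a_lt pm iq)).
Qed.

End AssociatedMap.

(** * Density of I_1 from exactness *)

Section DenseCuts.
Variables (R : realType) (tau : R -> R) (q : nat) (a : nat -> R).
Hypothesis pm : piecewise_monotonic tau q a.
Local Notation I1 := (I1 tau q a).
Local Notation X := (split_interval I1).
Variable sigma : X -> X.
Hypothesis sigma_tau : associated_map sigma.

(* An interval of [0, 1] missing I_1. *)
Definition gap (A : set R) := [/\ forall x, A x -> 0 <= x <= 1, forall x,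
  A x -> ~ I1 x &
  forall x y z, A x -> A y -> x <= z <= y -> A z].

(** A gap contains no partition point, so being an interval it cannot leave an open lap. *)
Lemma gap_lap (A : set R) x y : gap A -> A x -> A y ->
  exists2 i, (i < q)%N & a i < x < a i.+1 /\ a i < y < a i.+1.
Proof.
move=> [A01 AI Ai] Ax Ay; have [i iq xi] := a_cover pm (A01 _ Ax);
  exists i => //.
have Ia : I1 (a i) by apply: I1_partition; exact: ltnW.
have Ib : I1 (a i.+1) by exact: I1_partition.
have xo : a i < x < a i.+1.
  by case: (itv_cases xi) Ax => [->|->|//] /AI.
split=> //; have /andP[x1 x2] := xo; apply/andP; split; rewrite ltNge;
  apply/negP => h.
  by apply: (AI (a i)) Ia; apply: (Ai y x); rewrite // h ltW.
by apply: (AI (a i.+1)) Ib; apply: (Ai x y); rewrite // h ltW.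
Qed.

Lemma gap_image (A : set R) : gap A -> gap (tau @` A).
Proof.
move=> gA; have [A01 AI Ai] := gA; split.
- by move=> _ [x Ax <-]; apply: (tau01 pm); exact: A01.
- move=> _ [x Ax <-] Ix; have [i iq [xi _]] := gap_lap gA Ax Ax.
  by apply: (AI x Ax); apply/(I1_tau pm iq xi).
- move=> _ _ z [x Ax <-] [y Ay <-] /andP[z1 z2].
  have [i iq [/andP[x1 x2] /andP[y1 y2]]] := gap_lap gA Ax Ay.
  have [xy|yx] := leP x y.
    have [|t txy tz] := tau_itv pm (z := z) iq x1 xy y2.
      by rewrite ge_min z1 le_max z2 orbT.
    by exists t => //; exact: (Ai x y).
  have [|t txy tz] := tau_itv pm (z := z) iq y1 (ltW yx) x2.
    by rewrite ge_min z1 le_max z2 orbT.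
  by exists t => //; exact: (Ai y x).
Qed.

(** The image of a gap under tau is again a gap, and each gap lies in one lap, where tau is
    injective. *)
Lemma iter_sigma_inj k (A : set R) (x y : X) : gap A -> A (collapse x) ->
  A (collapse y) ->
  iter k sigma x = iter k sigma y -> x = y.
Proof.
elim: k A x y => // k IH A x y gA Ax Ay; rewrite !iterSr => e.
have [_ AI _] := gA; have [nx ny] := (AI _ Ax, AI _ Ay).
have ex := collapse_sigma sigma_tau nx; have ey := collapse_sigma sigma_tau ny.
have es : sigma x = sigma y.
  apply: IH (gap_image gA) _ _ e; first by rewrite ex; exists (collapse x).
  by rewrite ey; exists (collapse y).
have [i iq [xi yi]] := gap_lap gA Ax Ay.
apply: split_eq; last by rewrite !notI1_upper.
by apply: (tau_inj pm iq xi yi); rewrite -ex -ey es.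
Qed.

Variables (p : nat) (P : 'I_p -> set X).
Hypotheses (P_disj : trivIset setT P) (P_cover : \bigcup_i P i = setT).
Hypothesis P_clopen : forall i, clopen (P i).
Hypothesis P_cyclic : forall i, sigma @` P i = P (ordS i).
Hypothesis P_exact : forall i, topologically_exact_on (P i) (iter p sigma).

Lemma sigma_surj k (x : X) : exists y, iter k sigma y = x.
Proof.
elim: k x => [|k IH] x; first by exists x.
have [i Pi] := piece_ex P_cover x.
have : (sigma @` P (ord_pred i)) x by rewrite P_cyclic ord_predK.
by move=> [y _ <-]; have [z <-] := IH y; exists z.
Qed.

Lemma sigma_piece_surj k i (x : X) : P i x -> exists2 y,
  P i y & iter k (iter p sigma) y = x.
Proof.
move=> Px; have [y yx] := sigma_surj (k * p) x.
exists y; last by rewrite iter_full.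
have := iter_full sigma p k y; rewrite yx => e.
apply/(pieceP P_disj P_cover); move/(pieceP P_disj P_cover): Px;
  rewrite -e => <-.
elim: k {yx e} => // k IH.
by rewrite iterS (piece_full P_disj P_cover P_cyclic).
Qed.

(* On a gap of I1 every iterate of sigma is injective, whereas two disjoint
   open sets have the same image under a high iterate by exactness. *)
Lemma I1_dense_exact u v : 0 <= u -> u < v -> v <= 1 ->
  exists2 t, split_at I1 t & u < t < v.
Proof.
move=> u0 uv v1; apply: contrapT => no.
pose A : set R := [set t | u < t < v].
have gA : gap A.
  split=> [t /andP[t1 t2]|t tuv It|s t z /andP[s1 s2] /andP[t1 t2] /andP[z1
    z2]].
  - by rewrite (le_trans u0 (ltW t1)) (le_trans (ltW t2) v1).
  - apply: no; exists t => //; split=> //; have /andP[t1 t2] := tuv.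
    by rewrite (le_lt_trans u0 t1) (lt_le_trans t2 v1).
  - by apply/andP; split; [exact: lt_le_trans z1 | exact: le_lt_trans t2].
have m01 : 0 <= (u + v) / 2 <= 1 by apply/andP; split; lra.
pose x : X := lower_pt I1 m01.
have Ax : A (collapse x) by rewrite /A /= collapse_lower; apply/andP; split;
  lra.
have [_ AI _] := gA.
have [i Pi] := piece_ex P_cover x.
have [e e0 he] := unsplit_nbhs (P_clopen i).1 Pi (I1_notsplit (AI _ Ax)).
have /andP[x1 x2] := Ax.
(* Within e1 of x one stays both in the piece P_i and in the gap. *)
pose e1 := Num.min e (Num.min (collapse x - u) (v - collapse x)).
have e10 : 0 < e1 by rewrite !lt_min e0 !subr_gt0 x1.
have [ee [eu ev]] : e1 <= e /\ e1 <= collapse x - u /\ e1 <= v - collapse x.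
  by rewrite /e1 !ge_min !lexx !orbT.
(* By exactness O covers P_i at some time m. As [iter p sigma] maps P_i onto itself, x is then
   reached from O at every later time, so that two sets O can be compared at a common time. *)
have dis (O : set X) : open O -> O !=set0 ->
    (forall y, O y -> `|collapse y - collapse x| < e1) ->
    exists m, forall m', (m <= m')%N -> exists2 y,
      O y & iter m' (iter p sigma) y = x.
  move=> oO [y Oy] hO.
  have Py : P i y by apply: he; exact: lt_le_trans (hO _ Oy) ee.
  have [|m mE] := P_exact oO (i := i); first by exists y.
  exists m => m' mm'; have [z Pz zx] := sigma_piece_surj (m' - m) Pi.
  move: Pz; rewrite -mE => -[y' [Oy' _] y'z]; exists y' => //.
  by rewrite -(subnK mm') iterD y'z.
have c01 t : `|t - collapse x| < e1 -> 0 <= t <= 1.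
  by rewrite ltr_norml => /andP[h1 h2]; apply/andP; split; lra.
have [t1 t1l] : exists t, t = collapse x - e1 / 2 by eexists.
have [t2 t2r] : exists t, t = collapse x + e1 / 2 by eexists.
have h1 : 0 <= t1 <= 1 by apply: c01; rewrite ltr_norml; apply/andP; split; lra.
have h2 : 0 <= t2 <= 1 by apply: c01; rewrite ltr_norml; apply/andP; split; lra.
have [|||m1 hm1] := dis ([set y | collapse x - e1 < collapse y] `&` [set y |
  collapse y < collapse x]).
- by apply: openI; [exact: collapse_gt_open | exact: collapse_lt_open].
- by exists (lower_pt I1 h1); split; rewrite /= collapse_lower; lra.
- by move=> y [/= ? ?]; rewrite ltr_norml; apply/andP; split; lra.
have [|||m2 hm2] := dis ([set y | collapse x < collapse y] `&` [set y |
  collapse y < collapse x + e1]).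
- by apply: openI; [exact: collapse_gt_open | exact: collapse_lt_open].
- by exists (lower_pt I1 h2); split; rewrite /= collapse_lower; lra.
- by move=> y [/= ? ?]; rewrite ltr_norml; apply/andP; split; lra.
have [y1 [/= y1l y1r] y1x] := hm1 _ (leq_maxl m1 m2).
have [y2 [/= y2l y2r] y2x] := hm2 _ (leq_maxr m1 m2).
have y12 : y1 = y2.
  apply: (@iter_sigma_inj (maxn m1 m2 * p) A) => //.
  - by apply/andP; split; lra.
  - by apply/andP; split; lra.
  - by rewrite -!iter_full y1x y2x.
by move: y1r; rewrite y12; lra.
Qed.

End DenseCuts.
Theorem corollary6p13 (R : realType)
    (tau : R -> R) (q : nat) (a : nat -> R)
    (tau_pm : piecewise_monotonic tau q a)
    (tau_trans : transitive_map tau q a)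
    (tau_ninj : ~ essentially_injective tau q a)
    (sigma : split_interval (I1 tau q a) -> split_interval (I1 tau q a))
    (sigma_tau : associated_map sigma)
    (n : nat) (X : 'I_n -> set (split_interval (I1 tau q a)))
    (X_neq0 : forall i, X i !=set0)
    (X_disj : trivIset setT X)
    (X_cover : \bigcup_i X i = setT)
    (X_clopen : forall i, clopen (X i))
    (X_cyclic : forall i, sigma @` X i = X (ordS i))
    (X_exact : forall i, topologically_exact_on (X i) (iter n sigma))
    (F : cstarAlgType R)
    (iota : (split_interval (I1 tau q a) * split_interval (I1 tau q a) -> R[i])
            -> F)
    (F_tau : tail_cstar_completion setT sigma iota) :
  exists (A : 'I_n -> cstarAlgType R) (j : forall i, A i -> F),
    [/\ cstar_direct_sum j,
        forall i, [/\ is_tail_cstar_algebra (X i) (iter n sigma) (A i),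
                      simple_algebra (A i) & AF_algebra (A i)] &
        forall Phi : F -> F, canonical_endomorphism sigma iota Phi ->
          forall i (x : A i), exists y : A (ord_pred i),
            Phi (j i x) = j (ord_pred i) y].
Proof.
have dense := I1_dense_exact tau_pm sigma_tau X_disj X_cover X_clopen X_cyclic
  X_exact.
have [E [N0 cs]] := split_colours tau_pm sigma_tau dense.
exact: tail_algebra_decomposition cs X_neq0 X_disj X_cover X_clopen X_cyclic
  X_exact F_tau.
Qed.
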